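(* Suppose that $$\int_0^\infty e^{ax}\,dF(x)<\infty\quad\text{for some } a>0 .$$ Then there exist constants $c_0,c_1,c_2,c_3,c_4>0$ such that for all $r\ge c_0$, $$\mathbb P\big(|L(\mathbf 0,(r,r))-\gamma r|\ge u\big)\le c_1\exp\Big(-c_2\frac{u}{\log(r)\sqrt r}\Big)$$ for all $u\in\left[c_3\sqrt r\,\log^2 r,\ c_4r^{3/2}\log(r)\right]$.
   Context: Hammersley model with random weights: $\mathbf P\subseteq\mathbb R^2$ is a Poisson point process of intensity one. To each point $\mathbf p\in\mathbf P$ is attached a random positive weight $w_{\mathbf p}$; the weights are i.i.d. with distribution function $F(x)=\mathbb P(w_{\mathbf p}\le x)$ and are independent of $\mathbf P$. Inequalities $\mathbf p\le\mathbf q$ between points of $\mathbb R^2$ are coordinatewise. For $\mathbf p\le\mathbf q$, $\Pi(\mathbf p,\mathbf q)$ is the set of up-right paths from $\mathbf p$ to $\mathbf q$: each such path $\varpi$ is given by a finite nondecreasing sequence $(\mathbf p_1,\dots,\mathbf p_n)$ of Poisson points between $\mathbf p$ and $\mathbf q$, and is viewed as the lowest up-right continuous path starting at $\mathbf p$, passing through these points and ending at $\mathbf q$, with the starting point $\mathbf p$ then excluded. The last-passage time is $$L(\mathbf p,\mathbf q)=\max_{\varpi\in\Pi(\mathbf p,\mathbf q)}\sum_{\mathbf p'\in\varpi\cap\mathbf P}w_{\mathbf p'} .$$ Write $\mathbf 0=(0,0)$, $\mathbf n=(n,n)$, and $\gamma=\gamma(F)=\sup_{n\ge1}\mathbb E(L(\mathbf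 0,\mathbf n))/n$, where the supremum is over positive integers $n$. *)

(* Defs.v *)
From HB Require Import structures.
From mathcomp Require Import all_boot all_order all_algebra.
From mathcomp Require Import all_classical all_reals all_analysis.
From mathcomp Require Import measurable_realfun.
Set Implicit Arguments.
Unset Strict Implicit.
Unset Printing Implicit Defensive.
Import Order.TTheory GRing.Theory Num.Theory.
Import numFieldNormedType.Exports.
Local Open Scope classical_set_scope.
Local Open Scope ring_scope.

Section independence.
Context {d : measure_display} {Omega : measurableType d} {R : realType}.
Variable P : probability Omega R.

Definition mutually_independent (I : eqType) {d' : measure_display}
    {S : measurableType d'} (X : I -> Omega -> S) : Prop :=
  forall (J : seq I) (B : I -> set S), uniq J ->
    (forall i, i \in J -> measurable (B i)) ->
    P (\bigcap_(i in [set` J]) X i @^-1` B i)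
    = (\prod_(i <- J) P (X i @^-1` B i))%E.

Definition sigma_generated {I : Type} {d' : measure_display}
    {S : measurableType d'} (X : I -> Omega -> S) : set (set Omega) :=
  <<s \bigcup_i preimage_set_system setT (X i) measurable >>.

Definition independent_families {I I' : Type} {d1 d2 : measure_display}
    {S1 : measurableType d1} {S2 : measurableType d2}
    (X : I -> Omega -> S1) (Y : I' -> Omega -> S2) : Prop :=
  forall A B, sigma_generated X A -> sigma_generated Y B ->
    P (A `&` B) = (P A * P B)%E.

End independence.

Section poisson_process.
Context {d : measure_display} {Omega : measurableType d} {R : realType}.
Variable P : probability Omega R.

(* A point process on the plane is given by a measurable enumeration X of its
   points; it is almost surely infinite and simple in the Poisson case. *)
Definition point_count (X : nat -> Omega -> R * R) (A : set (R * R))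
    (omega : Omega) : \bar R :=
  counting [set i | A (X i omega)].

Definition lebesgue_measure2 : set (R * R) -> \bar R :=
  (@lebesgue_measure R \x @lebesgue_measure R)%E.

(* The second argument of poisson_prob is a dummy. The probability mass function
   poisson_pmf would be wrong here: it is constantly 1 at rate 0. *)
Definition unit_poisson_process (X : nat -> Omega -> R * R) : Prop :=
  (forall A : set (R * R), measurable A -> (lebesgue_measure2 A < +oo)%E ->
     forall k : nat, P (point_count X A @^-1` [set k%:R%:E])
       = poisson_prob (fine (lebesgue_measure2 A)) k [set k]) /\
  (forall A : nat -> set (R * R), (forall j, measurable (A j)) ->
     trivIset setT A ->
     mutually_independent P (fun j => point_count X (A j))).

End poisson_process.

Section last_passage.
Context {R : realType}.
Implicit Types p q : R * R.

Definition le2 p q : bool := (p.1 <= q.1) && (p.2 <= q.2).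

(* The lowest up-right curve from p to q: first right, then up. *)
Definition corner p q : set (R * R) :=
  [set z | p.1 <= z.1 <= q.1 /\ z.2 = p.2] `|`
  [set z | z.1 = q.1 /\ p.2 <= z.2 <= q.2].

Fixpoint lowest_curve p (s : seq (R * R)) q : set (R * R) :=
  if s is p1 :: s' then corner p p1 `|` lowest_curve p1 s' q else corner p q.

(* The empty sequence is allowed, so that the last-passage time is 0 when there
   is no point to collect. *)
Definition up_right_paths (pts : set (R * R)) p q : set (set (R * R)) :=
  [set c | exists s : seq (R * R),
     [/\ forall z, z \in s -> pts z,
         path le2 p (rcons s q)
       & c = lowest_curve p s q `\ p]].

(* x enumerates the points and w i is the weight of x i. The maximum is written
   as a supremum; it is attained whenever the rectangle contains finitely many
   points. *)
Definition last_passage (x : nat -> R * R) (w : nat -> R) p q : \bar R :=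
  ereal_sup [set (\esum_(i in [set i | c (x i)]) (w i)%:E)%E
            | c in up_right_paths (range x) p q].

End last_passage.

Section hammersley.
Context {d : measure_display} {Omega : measurableType d} {R : realType}.
Variable P : probability Omega R.

(* X i is the i-th Poisson point and W i its weight. Independence is from the
   whole enumeration X, so that the labelling carries no information on W. *)
Definition hammersley_model (F : R -> R) (X : nat -> {RV P >-> (R * R)%type})
    (W : nat -> {RV P >-> R}) : Prop :=
  [/\ unit_poisson_process P (fun i => X i : Omega -> R * R),
      forall i omega, 0 < W i omega,
      forall i t, cdf (W i) t = (F t)%:E,
      mutually_independent P (fun i => W i : Omega -> R)
    & independent_families P (fun i => X i : Omega -> R * R)
                             (fun i => W i : Omega -> R)].

Variables (X : nat -> {RV P >-> (R * R)%type}) (W : nat -> {RV P >-> R}).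

Definition LPT (p q : R * R) (omega : Omega) : \bar R :=
  last_passage (fun i => X i omega) (fun i => W i omega) p q.

Definition time_constant : \bar R :=
  ereal_sup [set ((\int[P]_omega LPT (0, 0)%R (n%:R, n%:R)%R omega)
                  * (n%:R^-1)%:E)%E | n in [set n : nat | (1 <= n)%N]].

End hammersley.

(* Main.v *)
Require Import Defs.
From HB Require Import structures.
From mathcomp Require Import all_boot all_order all_algebra.
From mathcomp Require Import all_classical all_reals all_analysis.
From mathcomp Require Import measurable_realfun finmap.
From mathcomp Require Import ring lra zify.
Set Implicit Arguments.
Unset Strict Implicit.
Unset Printing Implicit Defensive.
Import Order.TTheory GRing.Theory Num.Theory.
Import numFieldNormedType.Exports.
Local Open Scope classical_set_scope.
Local Open Scope ring_scope.

(* Cut the square of side r into antidiagonal strips of width of order 1. A chain spends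
   its stay in one strip inside a box of bounded area, so emptying a strip changes L by at
   most M, the largest total weight of O(r^2) boxes, which has exponential moments and is
   of size log r. Averaging out the O(r) independent strips one at a time bounds
   E exp(+-lam (L - E L)) by a constant for lam of order 1 / (sqrt r log r), and the
   Chernoff bound gives the deviations from the mean at exactly the claimed scale.
   For the mean e(r) = E L(0, (r, r)): by invariance under area-preserving maps E L(p, q)
   is a function of the area of the rectangle, and splitting a path at the antidiagonal of
   the square of side 2 r - 2 into two pieces, each in a rectangle of area at most r^2,
   gives e(2 r - 2) <= 2 e(r) + O(sqrt r log^2 r). With superadditivity this yields
   0 <= gamma r - e(r) = O(sqrt r log^2 r).
   Strips are made independent by refining a grid: the total weights of the cells are
   independent, with a compound Poisson law depending only on the area of the cell, and
   the maximum of their sums over chains of cells converges to L. *)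

(** * Exponential moments under a finite product measure *)

(** Cell weights are rounded to finitely many values, so that a grid carries a finite product
    measure and averaging out a strip is a finite sum; no conditional expectation on the original
    space is needed. All bounds are uniform in the resolution and survive the limit by Fatou's
    lemma. The strips are antidiagonal because the sum of the coordinates increases along a chain:
    inside a strip of width of order 1 both coordinates vary by a bounded amount, whatever the slope
    of the chain. A strip contributes to the exponent about [lam ^+ 2] times the second moment of
    [M], which is of order log(r)^2; summed over O(r) strips this is bounded for [lam] of order 1 /
    (sqrt r log r). For the mean, a maximum over O(r) pairs of passage times, each with exponential
    tails on the scale sqrt r log r, costs one more logarithm. When [r] doubles, the error sqrt r
    log(r)^2 grows by a factor close to sqrt 2 only, so relative to [r] the errors of repeated
    doubling form a convergent geometric series. *)

Section finite_product.
Context {R : realType} {T V : finType} (p : V -> R).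
Hypothesis p_ge0 : forall v, 0 <= p v.
Hypothesis p_sum1 : \sum_v p v = 1.
Local Notation config := {ffun T -> V}.

Definition fexp (f : config -> R) : R := \sum_(x : config) (\prod_c p (x c)) * f x.

Lemma fexp_prod (g : T -> V -> R) :
  fexp (fun x => \prod_c g c (x c)) = \prod_c \sum_v p v * g c v.
Proof.
rewrite /fexp bigA_distr_bigA /=.
by apply: eq_bigr => x _; rewrite big_split.
Qed.

Lemma fexp_cst k : fexp (fun=> k) = k.
Proof.
rewrite /fexp -mulr_suml -(bigA_distr_bigA (fun=> p)) /= big1 ?mul1r// => c _.
Qed.

Lemma fexp_ge0 f : (forall x, 0 <= f x) -> 0 <= fexp f.
Proof. by move=> f0; apply: sumr_ge0 => x _; rewrite mulr_ge0// prodr_ge0. Qed.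

Lemma le_fexp f g : (forall x, f x <= g x) -> fexp f <= fexp g.
Proof. by move=> fg; apply: ler_sum => x _; rewrite ler_wpM2l// prodr_ge0. Qed.

Lemma fexpD f g : fexp (fun x => f x + g x) = fexp f + fexp g.
Proof. by rewrite /fexp -big_split; apply: eq_bigr => x _; rewrite mulrDr. Qed.

Lemma fexpZ k f : fexp (fun x => k * f x) = k * fexp f.
Proof. by rewrite /fexp mulr_sumr; apply: eq_bigr => x _; rewrite mulrCA. Qed.

Lemma fexp_sum (I : finType) (P : pred I) (f : I -> config -> R) :
  fexp (fun x => \sum_(i | P i) f i x) = \sum_(i | P i) fexp (f i).
Proof.
rewrite /fexp exchange_big /=; apply: eq_bigr => x _; by rewrite mulr_sumr.
Qed.

Lemma eq_fexp f g : f =1 g -> fexp f = fexp g.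
Proof. by move=> fg; apply: eq_bigr => x _; rewrite fg. Qed.

(** Averaging over [y] plays the part of the conditional expectation given the coordinates in
    [A]. *)
Definition splice (A : pred T) (x y : config) : config :=
  [ffun c => if A c then x c else y c].

(* The exchange (x, y) |-> (splice A x y, splice A y x) is an involution that
   preserves the product weight of the pair. *)
Lemma fexp_splice A f : fexp (fun x => fexp (fun y => f (splice A x y))) = fexp f.
Proof.
pose w (x : config) := \prod_c p (x c).
pose s (u : config * config) := (splice A u.1 u.2, splice A u.2 u.1).
have sK : involutive s.
  by move=> [x y]; rewrite /s /=; congr (_, _); apply/ffunP => c; rewrite !ffunE;
     case: (A c).
transitivity (\sum_(u : config * config) w u.1 * w u.2 * f (s u).1).
  rewrite -(pair_bigA _ (fun x y => w x * w y * f (splice A x y))) /=.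
  apply: eq_bigr => x _; rewrite /fexp mulr_sumr.
  by apply: eq_bigr => y _; rewrite mulrA.
transitivity (\sum_(u : config * config) w u.1 * w u.2 * f u.1).
  rewrite [RHS](reindex_inj (inv_inj sK)) /=; apply: eq_bigr => -[x y] _.
  congr (_ * _); rewrite /w /= -!big_split; apply: eq_bigr => c _ /=.
  by rewrite !ffunE; case: ifP => // _; rewrite mulrC.
rewrite -(pair_bigA _ (fun x y => w x * w y * f x)) /=.
apply: eq_bigr => x _; rewrite -mulr_suml -mulr_sumr.
suff -> : \sum_j w j = 1 by rewrite mulr1.
by rewrite -[RHS](fexp_cst 1); apply: eq_bigr => y _; rewrite mulr1.
Qed.

Section one_block.
Variables (lam : R) (psi : config -> R) (psi0 : R) (M Th : config -> R).
Hypothesis psiM : forall x, psi0 <= psi x <= psi0 + M x.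
Hypothesis Th_ge0 : forall x, 0 <= Th x.
Hypothesis coshTh : forall x d, `|d| <= M x ->
  expR (lam * d) + expR (- (lam * d)) <= 2 * (1 + Th x).

(* Symmetrization: by Jensen, replace [fexp psi] by an independent copy of [psi]; the
   exponential of the difference then averages to a hyperbolic cosine. *)
Lemma fexp_mgf_block :
  fexp (fun x => expR (lam * (psi x - fexp psi))) <= 1 + 2 * fexp Th.
Proof.
set m := fexp psi.
pose D x y := expR (lam * (psi x - psi y)).
have step1 : fexp (fun x => expR (lam * (psi x - m))) <=
    fexp (fun x => fexp (D x)).
  apply: le_fexp => x.
  have -> : fexp (D x) = expR (lam * (psi x - m)) *
      fexp (fun y => expR (lam * (m - psi y))).
    rewrite -fexpZ; apply: eq_fexp => y; rewrite -expRD /D; congr expR; ring.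
  rewrite ler_peMr ?expR_ge0//.
  apply: (@le_trans _ _ (fexp (fun y => (1 + lam * m) + (- lam) * psi y))).
    by rewrite fexpD fexp_cst fexpZ -/m mulNr addrK.
  apply: le_fexp => y; apply: le_trans (expR_ge1Dx _).
  by rewrite le_eqVlt; apply/orP; left; apply/eqP; ring.
apply: (le_trans step1).
have swap : fexp (fun x => fexp (D x)) = fexp (fun x => fexp (D^~ x)).
  rewrite /fexp; under eq_bigr do rewrite mulr_sumr.
  rewrite exchange_big; apply: eq_bigr => x _ /=; rewrite mulr_sumr.
  by apply: eq_bigr => y _; rewrite mulrCA.
have -> : fexp (fun x => fexp (D x)) =
    2^-1 * fexp (fun x => fexp (fun y => D x y + D y x)).
  rewrite (eq_fexp (fun x => fexpD (D x) (D^~ x))).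
  rewrite (fexpD (fun x => fexp (D x))) -swap -mulr2n -[X in _ * X]mulr_natl.
  by rewrite mulrA mulVf ?mul1r.
(* Both values of [psi] lie in an interval starting at [psi0] whose length is the larger of [M x]
   and [M y], so [coshTh] applies at that point. Bounding by the sum of both [Th] keeps the two
   copies separate. *)
have bnd x y : D x y + D y x <= 2 * (1 + (Th x + Th y)).
  have Dyx : D y x = expR (- (lam * (psi x - psi y))).
    by rewrite /D; congr expR; ring.
  have /andP[a1 a2] := psiM x; have /andP[b1 b2] := psiM y.
  have := Th_ge0 x; have := Th_ge0 y => ty tx.
  have [My_le|Mx_le] := leP (M y) (M x).
    apply: (@le_trans _ _ (2 * (1 + Th x))); last by lra.
    rewrite Dyx; apply: coshTh; rewrite ler_norml; apply/andP; split; lra.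
  apply: (@le_trans _ _ (2 * (1 + Th y))); last by lra.
  rewrite Dyx; apply: coshTh; rewrite ler_norml; apply/andP; split; lra.
have -> : 1 + 2 * fexp Th =
    2^-1 * fexp (fun x => fexp (fun y => 2 * (1 + (Th x + Th y)))).
  have E x : fexp (fun y => 2 * (1 + (Th x + Th y))) = 2 * (1 + Th x + fexp Th).
    by rewrite fexpZ (fexpD (fun=> 1)) (fexpD (fun=> Th x)) !fexp_cst addrA.
  rewrite (eq_fexp E) fexpZ mulrA mulVf// mul1r.
  rewrite (fexpD (fun x => 1 + Th x) (fun=> fexp Th)) (fexpD (fun=> 1)) !fexp_cst.
  ring.
rewrite ler_pM2l ?invr_gt0//.
by apply: le_fexp => x; apply: le_fexp => y; exact: bnd.
Qed.

End one_block.

Section blocks.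
Variables (lam : R) (b : T -> nat) (z : config) (f : config -> R).
Variables (M Th : nat -> config -> R).
Hypothesis Mloc : forall m (x y : config), (forall c, b c = m -> x c = y c) ->
  M m x = M m y.
Hypothesis Th_ge0 : forall m x, 0 <= Th m x.
Hypothesis coshTh : forall m x d, `|d| <= M m x ->
  expR (lam * d) + expR (- (lam * d)) <= 2 * (1 + Th m x).
Hypothesis fM : forall m x, let x0 := splice (fun c => b c != m) x z in
  f x0 <= f x <= f x0 + M m x.

(** The Doob martingale of [f] when the blocks are revealed one after the other. *)
Let cond m x := fexp (fun y => f (splice (fun c => (b c < m)%N) x y)).

(** With the blocks below [m] frozen, the next martingale value is a function [psi] of the remaining
    coordinates, with mean [cond m x]. By [fM] its oscillation is controlled by [M m], so
    [fexp_mgf_block] yields one factor per block. *)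
Lemma fexp_mgf_cond m :
  fexp (fun x => expR (lam * (cond m.+1 x - fexp f))) <=
  fexp (fun x => expR (lam * (cond m x - fexp f))) * (1 + 2 * fexp (Th m)).
Proof.
set A := fun c => (b c < m)%N; set A' := fun c => (b c < m.+1)%N.
have cond_splice x y : cond m (splice A x y) = cond m x.
  apply: eq_fexp => u; congr f; apply/ffunP => c; rewrite !ffunE /A.
  by case: (b c < m)%N.
rewrite -(fexp_splice A) [leRHS]mulrC -[leRHS]fexpZ; apply: le_fexp => x.
pose psi y := cond m.+1 (splice A x y).
have psiE : fexp psi = cond m x.
  rewrite /cond -(fexp_splice A' (fun y => f (splice A x y))) /psi.
  apply: eq_fexp => y; apply: eq_fexp => u; congr f; apply/ffunP => c.
  rewrite !ffunE /A' /A; case: ifP => // /negbT; rewrite -leqNgt => mb.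
  by rewrite ltnNge (ltnW mb).
rewrite (@eq_fexp _ (fun y => expR (lam * (cond m x - fexp f)) *
    expR (lam * (psi y - fexp psi)))); last first.
  by move=> y; rewrite -expRD psiE; congr expR; rewrite /psi; ring.
rewrite fexpZ [leRHS]mulrC ler_pM2l ?expR_gt0//.
(* Block [m] is reset to [z] here, so the average of [h] does not depend on that block and can serve
   as the base value [psi0]. *)
pose h u := f (splice (fun c => b c != m) (splice A x u) z).
apply: (@fexp_mgf_block _ psi (fexp h) (M m)) => // y.
- have zE u : splice (fun c => b c != m) (splice A' (splice A x y) u) z =
      splice (fun c => b c != m) (splice A x u) z.
    apply/ffunP => c; rewrite !ffunE /A' /A ltnS.
    by case: ltngtP.
  apply/andP; split.
    apply: le_fexp => u; rewrite /h -zE.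
    by have /andP[] := fM m (splice A' (splice A x y) u).
  rewrite -(fexp_cst (M m y)) -fexpD; apply: le_fexp => u; rewrite /h -zE.
  rewrite (_ : M m y = M m (splice A' (splice A x y) u)).
    by have /andP[] := fM m (splice A' (splice A x y) u).
  by apply: Mloc => c bc; rewrite !ffunE /A' /A bc ltnSn ltnn.
- exact: coshTh.
Qed.

Lemma fexp_mgf N : (forall c, (b c < N)%N) ->
  fexp (fun x => expR (lam * (f x - fexp f))) <=
  \prod_(m < N) (1 + 2 * fexp (Th m)).
Proof.
move=> bN.
have main n : fexp (fun x => expR (lam * (cond n x - fexp f))) <=
    \prod_(m < n) (1 + 2 * fexp (Th m)).
  elim: n => [|n IHn].
    rewrite big_ord0 -(fexp_cst 1); apply: le_fexp => x.
    rewrite -expR0 ler_expR (_ : cond 0 x = fexp f) ?subrr ?mulr0//.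
    by apply: eq_fexp => y; congr f; apply/ffunP => c; rewrite !ffunE ltn0.
  rewrite big_ord_recr /=; apply: (le_trans (fexp_mgf_cond n)).
  by rewrite ler_wpM2r// addr_ge0// mulr_ge0// fexp_ge0.
apply: le_trans (main N); apply: le_fexp => x; rewrite ler_expR.
rewrite (_ : cond N x = f x)// /cond -[RHS]fexp_cst.
by apply: eq_fexp => y; congr f; apply/ffunP => c; rewrite !ffunE bN.
Qed.

End blocks.
End finite_product.

(** * Quadratic bounds for the hyperbolic cosine *)

Section cosh_bounds.
Context {R : realType}.
Implicit Types x y d a K lam : R.

Lemma sqr_le_expR x : 0 <= x -> x ^+ 2 <= 2 * expR x.
Proof.
move=> x0; have := expR_ge1Dxn 1 x0; have e0 := expR_ge0 x.
rewrite (_ : 2`!%:R = 2 :> R)// => h.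
have : x ^+ 2 / 2 <= expR x by apply: le_trans h; lra.
by rewrite ler_pdivrMr// mulrC.
Qed.

Lemma cosh_sub1_le x : expR x + expR (- x) - 2 <= x ^+ 2 * expR `|x|.
Proof.
have main (y : R) : 0 <= y -> expR y + expR (- y) - 2 <= y ^+ 2 * expR y.
  move=> y0; have e0 := expR_gt0 y.
  have -> : expR y + expR (- y) - 2 = (1 - expR (- y)) ^+ 2 * expR y.
    have : expR (- y) * expR y = 1 by rewrite expRN mulVf ?gt_eqF.
    by move=> h; rewrite sqrrB mulrDl mulrBl expr1n mul1r expr2 -mulrA h; lra.
  rewrite ler_pM2r//; have := expR_ge1Dx (- y) => h.
  have : expR (- y) <= 1 by rewrite -expR0 ler_expR lerNl oppr0.
  by move=> h2; rewrite lerXn2r// ?nnegrE; lra.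
have [x0|x0] := leP 0 x; first by rewrite ger0_norm//; exact: main.
rewrite ltr0_norm// -sqrrN [expR x + _]addrC -{2}[x]opprK.
by apply: main; rewrite oppr_ge0 ltW.
Qed.

(** For [y <= K] the exponent is at most 1 and the bound is of order [K ^+ 2]. For [y > K] the
    square and the exponential are absorbed in [expR (a * y / 2)], which is at most
    [expR (- (a * K / 2)) * expR (a * y)]. With [K] of order log r the first factor later beats the
    number of boxes over which the last one is summed. *)
Lemma cosh_quadratic_bound a K lam y d : 0 < a -> 0 <= K ->
  `|lam| <= a / 4 -> `|lam| * K <= 1 -> `|d| <= y ->
  expR (lam * d) + expR (- (lam * d)) <=
  2 * (1 + lam ^+ 2 * (2 * K ^+ 2 + 16 / a ^+ 2 * expR (- (a * K / 2)) *
                       expR (a * y))).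
Proof.
move=> a0 K0 la lK dy.
have y0 : 0 <= y by exact: le_trans dy.
have l0 := normr_ge0 lam.
have G0 : 0 <= 16 / a ^+ 2 * expR (- (a * K / 2)) * expR (a * y).
  by rewrite !mulr_ge0// ?expR_ge0// invr_ge0 exprn_ge0 ?ltW.
have e2 : expR (1 : R) <= 4.
    have h : 2^-1 <= expR (- 2^-1 : R) by have := expR_ge1Dx (- 2^-1 : R); lra.
    have {}h : expR (2^-1 : R) <= 2.
      by rewrite -[2^-1 : R]opprK expRN -[leRHS]invrK lef_pV2// posrE ?expR_gt0.
    rewrite [X in expR X](_ : 1 = 2^-1 + 2^-1 :> R); last by lra.
    have e0 := expR_ge0 (2^-1 : R).
    by rewrite expRD (_ : 4 = 2 * 2 :> R) ?ler_pM//; lra.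
suff H : (lam * d) ^+ 2 * expR `|lam * d| <=
    lam ^+ 2 * (4 * K ^+ 2 + 32 / a ^+ 2 * expR (- (a * K / 2)) * expR (a * y)).
  by have := cosh_sub1_le (lam * d); lra.
rewrite normrM exprMn -[leLHS]mulrA ler_wpM2l ?sqr_ge0//.
have dd : d ^+ 2 <= y ^+ 2 by rewrite -real_normK ?num_real// lerXn2r.
apply: (@le_trans _ _ (y ^+ 2 * expR (`|lam| * y))).
  by rewrite ler_pM// ?sqr_ge0 ?expR_ge0// ler_expR ler_wpM2l.
have [yK|Ky] := leP y K.
  apply: (@le_trans _ _ (K ^+ 2 * 4)); last by lra.
  rewrite ler_pM// ?sqr_ge0 ?expR_ge0// ?lerXn2r//.
  by apply: le_trans e2; rewrite ler_expR; apply: le_trans lK; rewrite ler_wpM2l.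
apply: (@le_trans _ _ (32 / a ^+ 2 * expR (- (a * K / 2)) * expR (a * y)));
  last by have := sqr_ge0 K; lra.
have h1 : y ^+ 2 <= 32 / a ^+ 2 * expR (a * y / 4).
  have := @sqr_le_expR (a * y / 4); rewrite divr_ge0 ?mulr_ge0 ?(ltW a0)//.
  move=> /(_ isT) h; rewrite [_ / _ * _]mulrAC ler_pdivlMr ?exprn_gt0//.
  have -> : y ^+ 2 * a ^+ 2 = (a * y / 4) ^+ 2 * 16 by field.
  lra.
apply: (@le_trans _ _ ((32 / a ^+ 2 * expR (a * y / 4)) * expR (a * y / 4))).
  rewrite ler_pM// ?sqr_ge0 ?expR_ge0// ler_expR.
  by rewrite mulrAC ler_wpM2r.
rewrite -!mulrA ler_wpM2l// ler_wpM2l ?invr_ge0 ?exprn_ge0 ?(ltW a0)//.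
rewrite -!expRD ler_expR.
have : a * K <= a * y by rewrite ler_pM2l// ltW.
lra.
Qed.

End cosh_bounds.

(** * Last passage on a finite grid *)

Section discrete_last_passage.
Context {R : realType}.
Variable n : nat.
Local Notation cell := ('I_n * 'I_n)%type.
Implicit Types (s t : cell -> R) (C : {set cell}).

Definition le_cell (c c' : cell) : bool := (c.1 <= c'.1)%N && (c.2 <= c'.2)%N.

Definition chain_cells C : bool :=
  [forall c in C, forall c' in C, le_cell c c' || le_cell c' c].

(** Cells of one row or column count as comparable although their points need not be, and each cell
    contributes its whole weight; on a coarse grid this may overestimate the passage time. *)
Definition grid_lp s : R := \big[Num.max/0]_(C | chain_cells C) \sum_(c in C) s c.

Lemma grid_lp_ge s C : chain_cells C -> \sum_(c in C) s c <= grid_lp s.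
Proof. by move=> Cc; rewrite /grid_lp (le_bigmax_cond 0 (fun C => \sum_(c in C) s c)). Qed.

Lemma grid_lp_le s x : 0 <= x ->
  (forall C, chain_cells C -> \sum_(c in C) s c <= x) -> grid_lp s <= x.
Proof. by move=> x0 H; apply: bigmax_le. Qed.

Lemma grid_lp_ge0 s : 0 <= grid_lp s.
Proof. exact: bigmax_ge_id. Qed.

Lemma le_grid_lp s t : (forall c, s c <= t c) -> grid_lp s <= grid_lp t.
Proof.
move=> st; apply: grid_lp_le => [|C Cc]; first exact: grid_lp_ge0.
by apply: le_trans (grid_lp_ge t Cc); apply: ler_sum.
Qed.

End discrete_last_passage.


(** Comparability and the order of the coordinate sums force [(x, y)] to dominate [(x1, y1)]. The
    increase from [x1] to [x] is then at most that of the sum, which is below [h] inside one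
    strip. *)
Lemma box_arith (h m x1 y1 x y b : nat) : (x + y < m.+1 * h)%N ->
  (m * h <= x1 + y1)%N -> (x1 + y1 <= x + y)%N ->
  (x1 <= x)%N && (y1 <= y)%N || (x <= x1)%N && (y <= y1)%N ->
  (b * h <= x1)%N -> (x1 < b.+1 * h)%N -> (b * h <= x < b * h + 2 * h)%N.
Proof. by rewrite !mulSn; move: (m * h)%N (b * h)%N => D B; lia. Qed.

Section grid_concentration.
Context {R : realType} {V : finType} (n h : nat).
Variables (p : V -> R) (wt : V -> R) (v0 : V) (a : R).
Hypothesis h_gt0 : (0 < h)%N.
Hypothesis p_ge0 : forall v, 0 <= p v.
Hypothesis p_sum1 : \sum_v p v = 1.
Hypothesis wt_ge0 : forall v, 0 <= wt v.
Hypothesis wt_v0 : wt v0 = 0.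
Hypothesis a_gt0 : 0 < a.
Local Notation cell := ('I_n * 'I_n)%type.
Local Notation config := {ffun cell -> V}.

(* The cells are cut into the antidiagonal strips [m h <= i + j < (m + 1) h]; a
   chain inside one strip fits in a square of side [2 h] with corner in [h Z^2]. *)
Let strip (c : cell) : nat := ((c.1 + c.2) %/ h)%N.
Let N0 := (n %/ h).+1.
Let in_box (u : 'I_N0 * 'I_N0) (c : cell) : bool :=
  (u.1 * h <= c.1 < u.1 * h + 2 * h)%N && (u.2 * h <= c.2 < u.2 * h + 2 * h)%N.
Let box_sum m u (x : config) : R :=
  \sum_(c | (strip c == m) && in_box u c) wt (x c).
Let M m (x : config) : R := \big[Num.max/0]_u box_sum m u x.
Let f (x : config) : R := grid_lp (fun c => wt (x c)).

Let box_sum_ge0 m u x : 0 <= box_sum m u x.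
Proof. exact: sumr_ge0. Qed.

Let chain_strip C m (x : config) : chain_cells C ->
  \sum_(c in C | strip c == m) wt (x c) <= M m x.
Proof.
move=> Cc; have [[c0 Pc0]|noc] := pselect (exists c, (c \in C) && (strip c == m)).
  (* The cell of least coordinate sum among those of the chain in the strip determines the box. *)
  have [c1 /andP[c1C /eqP c1m] c1min] :=
    @arg_minnP _ c0 (fun c => (c \in C) && (strip c == m)) (fun c => c.1 + c.2)%N Pc0.
  have bd (i : 'I_n) : (i %/ h < N0)%N by rewrite ltnS leq_div2r// ltnW.
  pose u := (Ordinal (bd c1.1), Ordinal (bd c1.2)).
  apply: (@le_trans _ _ (box_sum m u x)); last first.
    by rewrite /M (le_bigmax 0 (fun u => box_sum m u x)).
  rewrite /box_sum [leRHS](bigID (fun c => (c \in C))) /=.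
  rewrite [X in X + _](_ : _ = \sum_(c in C | strip c == m) wt (x c)).
    by rewrite lerDl sumr_ge0.
  apply: eq_bigl => c; rewrite andbC; case cC: (c \in C) => //=.
  case: eqP => //= cm.
  have := c1min c; rewrite cC cm eqxx => /(_ isT) mc.
  have /'forall_implyP/(_ c1 c1C)/'forall_implyP/(_ c cC) := Cc.
  rewrite /le_cell /in_box /u /=.
  have sc : (c.1 + c.2 < m.+1 * h)%N by rewrite -cm; apply: ltn_ceil.
  have sc1 : (m * h <= c1.1 + c1.2)%N by rewrite -c1m; apply: leq_trunc_div.
  move=> cc; apply/andP; split.
    by apply: (box_arith sc sc1 mc cc); rewrite ?leq_trunc_div ?ltn_ceil.
  rewrite addnC in sc; rewrite addnC in sc1.
  rewrite addnC [(_ + c.2)%N]addnC in mc.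
  apply: (box_arith sc sc1 mc); rewrite ?leq_trunc_div ?ltn_ceil//.
  by case/orP: cc => /andP[-> ->] //=; rewrite orbT.
rewrite big_pred0 => [|c]; first exact: bigmax_ge_id.
by apply/negP => cP; apply: noc; exists c.
Qed.


Let Mloc m (x y : config) : (forall c, strip c = m -> x c = y c) -> M m x = M m y.
Proof.
move=> xy; apply: eq_bigr => u _; apply: eq_bigr => c /andP[/eqP cm _].
by rewrite xy.
Qed.

Let fM m (x : config) : let x0 := splice (fun c => strip c != m) x [ffun=> v0] in
  f x0 <= f x <= f x0 + M m x.
Proof.
set x0 := splice _ _ _ => /=; have le0 c : wt (x0 c) <= wt (x c).
  by rewrite !ffunE; case: ifP => // _; rewrite wt_v0.
apply/andP; split; first exact: le_grid_lp.
apply: grid_lp_le => [|C Cc]; first by rewrite addr_ge0 ?grid_lp_ge0 ?bigmax_ge_id.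
rewrite (bigID (fun c => strip c == m)) /= addrC lerD ?chain_strip//.
apply: le_trans (grid_lp_ge (fun c => wt (x0 c)) Cc).
rewrite [leRHS](bigID (fun c => strip c == m)) /=.
rewrite [X in _ <= X + _]big1 ?add0r; last first.
  by move=> c /andP[_ /eqP cm]; rewrite !ffunE cm eqxx /= wt_v0.
by apply: ler_sum => c /andP[_ cm]; rewrite !ffunE cm.
Qed.

Let q := \sum_v p v * expR (a * wt v).

Let q_ge1 : 1 <= q.
Proof.
rewrite -p_sum1; apply: ler_sum => v _; rewrite ler_peMr//.
by rewrite -expR0 ler_expR mulr_ge0// ltW.
Qed.

(** By independence this is a product over the cells of the box inside the strip. There are at most
    [(2 * h) ^ 2] of them, and [q >= 1] allows for the missing ones. *)
Let box_mgf m u : fexp p (fun x => expR (a * box_sum m u x)) <= q ^+ (4 * h ^ 2).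
Proof.
pose Q (c : cell) := (strip c == m) && in_box u c.
have E x : expR (a * box_sum m u x) =
    \prod_c (if Q c then expR (a * wt (x c)) else 1).
  by rewrite /box_sum mulr_sumr expR_sum [LHS]big_mkcond.
rewrite (eq_fexp _ E).
rewrite (fexp_prod p (fun c v => if Q c then expR (a * wt v) else 1)).
apply: (@le_trans _ _ (\prod_c (if Q c then q else 1))).
  apply: ler_prod => c _; case: (Q c); first by rewrite lexx andbT (le_trans ler01).
  by under eq_bigr do rewrite mulr1; rewrite p_sum1 ler01 lexx.
rewrite -big_mkcond prodr_const.
rewrite ler_weXn2l//.
pose g (c : cell) : 'I_(2 * h).-1.+1 * 'I_(2 * h).-1.+1 :=
  (inord (c.1 - u.1 * h), inord (c.2 - u.2 * h)).
have -> : (4 * h ^ 2 = #|{: 'I_(2 * h).-1.+1 * 'I_(2 * h).-1.+1}|)%N.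
  by rewrite card_prod card_ord prednK ?muln_gt0//; lia.
have bd (i b : nat) : (b * h <= i < b * h + 2 * h)%N ->
    (i - b * h < (2 * h).-1.+1)%N.
  by move: (b * h)%N => B; lia.
have ginj : {in Q &, injective g}.
  move=> [c1 c2] [d1 d2] /andP[_ /andP[/= c1b c2b]] /andP[_ /andP[/= d1b d2b]].
  move=> [/(congr1 (@nat_of_ord _)) + /(congr1 (@nat_of_ord _))].
  rewrite !(inordK (bd _ _ _)) // => e1 e2.
  congr pair; apply: val_inj => /=.
    by move: c1b d1b e1; move: (u.1 * h)%N => B; lia.
  by move: c2b d2b e2; move: (u.2 * h)%N => B; lia.
by rewrite -(card_in_imset ginj) max_card.
Qed.

Lemma grid_mgf lam K : 0 <= K -> `|lam| <= a / 4 -> `|lam| * K <= 1 ->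
  fexp p (fun x : config => expR (lam * (f x - fexp p f))) <=
  expR (2 * ((2 * n) %/ h).+1%:R * lam ^+ 2 *
    (2 * K ^+ 2 + 16 / a ^+ 2 * expR (- (a * K / 2)) *
      ((n %/ h).+1%:R ^+ 2 * q ^+ (4 * h ^ 2)))).
Proof.
move=> K0 la lK; set G := 16 / a ^+ 2 * _.
have G0 : 0 <= G by rewrite !mulr_ge0// ?expR_ge0// invr_ge0 exprn_ge0// ltW.
(* The exponential of the maximum [M m] is replaced by the sum of the exponentials over all boxes,
   each of which has an explicit average. *)
pose Th m (x : config) :=
  lam ^+ 2 * (2 * K ^+ 2 + G * \sum_u expR (a * box_sum m u x)).
have Th0 m x : 0 <= Th m x.
  rewrite mulr_ge0 ?sqr_ge0// addr_ge0 1?mulr_ge0 ?sqr_ge0//.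
  by apply: sumr_ge0 => u _; exact: expR_ge0.
have cTh m x d : `|d| <= M m x ->
    expR (lam * d) + expR (- (lam * d)) <= 2 * (1 + Th m x).
  move=> dM; apply: le_trans (cosh_quadratic_bound a_gt0 K0 la lK dM) _.
  rewrite ler_pM2l// lerD2l ler_wpM2l ?sqr_ge0// lerD2l -/G ler_wpM2l//.
  have [u ->] : exists u, M m x = box_sum m u x.
    by eexists; apply: (bigmax_eq_arg _ (ord0, ord0)).
  rewrite (bigD1 u)//= lerDl; apply: sumr_ge0 => ? _; exact: expR_ge0.
pose N := ((2 * n) %/ h).+1.
have bN c : (strip c < N)%N.
  rewrite ltnS leq_div2r// mul2n -addnn leq_add// ltnW//.
apply: (le_trans (fexp_mgf p_ge0 p_sum1 Mloc Th0 cTh fM bN)).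
have ThE m : fexp p (Th m) <= lam ^+ 2 * (2 * K ^+ 2 + G * (N0%:R ^+ 2 * q ^+ (4 * h ^ 2))).
  rewrite fexpZ fexpD fexp_cst// fexpZ fexp_sum ler_wpM2l ?sqr_ge0// lerD2l.
  rewrite ler_wpM2l//.
  apply: (@le_trans _ _ (\sum_(u : 'I_N0 * 'I_N0) q ^+ (4 * h ^ 2))).
    by apply: ler_sum => u _; exact: box_mgf.
  rewrite sumr_const card_prod card_ord.
  by rewrite -[leLHS]mulr_natl natrM expr2.
apply: (@le_trans _ _ (\prod_(m < N)
    expR (2 * (lam ^+ 2 * (2 * K ^+ 2 + G * (N0%:R ^+ 2 * q ^+ (4 * h ^ 2))))))).
  apply: ler_prod => m _; rewrite addr_ge0 ?mulr_ge0 ?fexp_ge0//=.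
  by apply: le_trans (expR_ge1Dx _); rewrite lerD2l ler_pM2l.
rewrite -expR_sum sumr_const card_ord -mulr_natl ler_expR -/N.
by rewrite le_eqVlt; apply/orP; left; apply/eqP; rewrite /N0; ring.
Qed.

End grid_concentration.

Definition grid_value {R : realType} {V : Type} (n : nat) (wt : V -> R)
    (x : {ffun 'I_n * 'I_n -> V}) : R := grid_lp (fun c => wt (x c)).

(** The hypothesis on the exponential moment is the one of a cell of area [(r / n%:R) ^+ 2]. There
    are at most [3 * r] strips and [(2 * r) ^+ 2] boxes, and a box has exponential moment at most
    [E = expR (16 * b)]. The exponent is thus at most [2 * (3 r) * lam ^+ 2 * (32 + 64 E) * ln r ^+
    2 / a ^+ 2], and the bound on [lam] turns this into [12 + 24 E], free of [n] and [r]. *)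
Lemma grid_mgf_uniform {R : realType} {V : finType} (n : nat) (p wt : V -> R)
    (v0 : V) (a b r lam : R) :
  (forall v, 0 <= p v) -> \sum_v p v = 1 -> (forall v, 0 <= wt v) ->
  wt v0 = 0 -> 0 < a -> 0 <= b -> expR 1 <= r -> r <= n%:R ->
  \sum_v p v * expR (a * wt v) <= expR (b * (r / n%:R) ^+ 2) ->
  `|lam| <= a / 4 / (Num.sqrt r * ln r) ->
  fexp p (fun x => expR (lam * (@grid_value R V n wt x - fexp p (@grid_value R V n wt)))) <= expR (12 + 24 * expR (16 * b)).
Proof.
move=> p0 p1 w0 wv0 a0 b0 er rn hq hlam.
set L := ln r; set q := \sum_v _ in hq.
have e2 : 2 <= expR (1 : R) by have := expR_ge1Dx (1 : R); lra.
have r2 : 2 <= r := le_trans e2 er.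
have r0 : 0 < r by apply: lt_le_trans r2.
have rge0 := ltW r0; have age0 := ltW a0.
have L1 : 1 <= L by rewrite -ler_expR lnK.
have n0 : 0 < n%:R :> R by apply: lt_le_trans rn.
have s1 : 1 <= Num.sqrt r by rewrite -[leLHS]sqrtr1 ler_wsqrtr//; lra.
(* A strip is [h] cells wide, that is, between 1 and 2 units of length when the cells have side
   [r / n%:R]. *)
pose h := (Num.truncn (n%:R / r)).+1.
have /andP[t1 t2] : (Num.truncn (n%:R / r))%:R <= n%:R / r < h%:R.
  by apply: truncn_itv; rewrite divr_ge0// ltW.
have nr1 : 1 <= n%:R / r by rewrite ler_pdivlMr ?mul1r.
have h2 : h%:R <= 2 * (n%:R / r) by rewrite /h -natr1; lra.
have h0 : 0 < h%:R :> R by rewrite ltr0n.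
have nh (m : nat) : (m %/ h)%:R <= m%:R / h%:R :> R.
  by rewrite ler_pdivlMr// -natrM ler_nat leq_trunc_div.
have nhr : n%:R / h%:R <= r by rewrite ler_pdivrMr// mulrC -ler_pdivrMr// ltW.
have N2 : ((2 * n) %/ h).+1%:R <= 3 * r.
  rewrite -natr1; have := nh (2 * n)%N; rewrite natrM -mulrA; lra.
have N1 : (n %/ h).+1%:R <= 2 * r by rewrite -natr1; have := nh n; lra.
(* With this choice [expR (- (a * K / 2))] equals [r ^- 2], which cancels the number of boxes. *)
pose K := 4 / a * L.
have K0 : 0 <= K by rewrite mulr_ge0 ?divr_ge0 ?ltW//; lra.
have Lge0 : 0 <= L by lra.
have sqge0 : 0 <= Num.sqrt r by lra.
have sL : 0 < Num.sqrt r * L by rewrite mulr_gt0//; lra.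
have la : `|lam| <= a / 4.
  apply: le_trans hlam _; rewrite ler_pdivrMr// ler_peMr// ?divr_ge0 //.
  by rewrite -(mulr1 1) ler_pM.
have lK : `|lam| * K <= 1.
  apply: (@le_trans _ _ (a / 4 / (Num.sqrt r * L) * K)); first by rewrite ler_wpM2r.
  have -> : a / 4 / (Num.sqrt r * L) * K = (Num.sqrt r)^-1.
    by rewrite /K; field; rewrite !gt_eqF//; lra.
  by rewrite invf_le1//; lra.
have := @grid_mgf R V n h p wt v0 a (ltn0Sn _) p0 p1 w0 wv0 a0 lam K K0 la lK.
move=> /le_trans; apply; rewrite ler_expR -/q.
have q1 : 0 <= q by apply: sumr_ge0 => v _; rewrite mulr_ge0 ?expR_ge0.
have qh : q ^+ (4 * h ^ 2) <= expR (16 * b).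
  apply: (@le_trans _ _ (expR (b * (r / n%:R) ^+ 2) ^+ (4 * h ^ 2))).
    by rewrite lerXn2r ?nnegrE ?expR_ge0.
  rewrite -expRM_natl ler_expR natrM natrX.
  have : (h%:R * (r / n%:R)) ^+ 2 <= 2 ^+ 2.
    have rn0 : 0 <= r / n%:R by rewrite divr_ge0 .
    rewrite lerXn2r ?nnegrE ?mulr_ge0//.
    apply: (le_trans (ler_wpM2r rn0 h2)); rewrite le_eqVlt; apply/orP; left.
    by apply/eqP; field; rewrite !gt_eqF.
  move=> h4; apply: (@le_trans _ _ (4 * b * 2 ^+ 2)); last by lra.
  apply: (@le_trans _ _ (4 * b * (h%:R * (r / n%:R)) ^+ 2)); last first.
    by rewrite ler_wpM2l// mulr_ge0.
  by rewrite le_eqVlt; apply/orP; left; apply/eqP; ring.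
have lam2 : lam ^+ 2 <= a ^+ 2 / 16 / (r * L ^+ 2).
  rewrite -real_normK ?num_real//.
  have -> : a ^+ 2 / 16 / (r * L ^+ 2) = (a / 4 / (Num.sqrt r * L)) ^+ 2.
    rewrite -{1}(sqr_sqrtr (ltW r0)); field; rewrite !gt_eqF//; lra.
  by rewrite lerXn2r ?nnegrE ?normr_ge0 ?divr_ge0// ltW.
have -> : expR (- (a * K / 2)) = r ^- 2.
  have -> : - (a * K / 2) = - (2%:R * L) by rewrite /K; field; rewrite gt_eqF.
  by rewrite expRN expRM_natl lnK ?posrE.
set E := expR (16 * b) in qh *; have E0 : 0 <= E := expR_ge0 _.
have a2 : 0 < a ^+ 2 by rewrite exprn_gt0.
have in1 : 16 / a ^+ 2 * r ^- 2 * ((n %/ h).+1%:R ^+ 2 * q ^+ (4 * h ^ 2)) <=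
    64 * E / a ^+ 2.
  have -> : 64 * E / a ^+ 2 = 16 / a ^+ 2 * r ^- 2 * ((2 * r) ^+ 2 * E).
    by field; rewrite !gt_eqF.
  rewrite ler_wpM2l ?mulr_ge0 ?invr_ge0 ?exprn_ge0  //.
  by rewrite ler_pM ?exprn_ge0// lerXn2r ?nnegrE// mulr_ge0// ltW.
have in2 : 2 * K ^+ 2 + 64 * E / a ^+ 2 <= (32 + 64 * E) * L ^+ 2 / a ^+ 2.
  have -> : (32 + 64 * E) * L ^+ 2 / a ^+ 2 = 2 * K ^+ 2 + 64 * E * L ^+ 2 / a ^+ 2.
    by rewrite /K; field; rewrite gt_eqF.
  rewrite lerD2l ler_pM2r ?invr_gt0// ler_peMr ?mulr_ge0//.
  by rewrite exprn_ege1.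
apply: (@le_trans _ _ (2 * (3 * r) * (a ^+ 2 / 16 / (r * L ^+ 2)) *
    ((32 + 64 * E) * L ^+ 2 / a ^+ 2))); last first.
  rewrite le_eqVlt; apply/orP; left; apply/eqP; field.
  by rewrite !gt_eqF//; lra.
apply: ler_pM.
- by apply: mulr_ge0; rewrite ?sqr_ge0// mulr_ge0.
- apply: addr_ge0; first by apply: mulr_ge0; rewrite ?sqr_ge0.
  by rewrite mulr_ge0// mulr_ge0 ?invr_ge0 ?exprn_ge0// mulr_ge0 ?invr_ge0 ?exprn_ge0.
- by apply: ler_pM; rewrite ?sqr_ge0 ?mulr_ge0// ler_pM2l.
- by apply: le_trans in2; rewrite lerD2l.
Qed.

(** * Independence *)

Lemma emeasurable_prod {d} {T : measurableType d} {R : realType} {I : eqType}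
    (s : seq I) (h : I -> T -> \bar R) :
  (forall i, i \in s -> measurable_fun setT (h i)) ->
  measurable_fun setT (fun x => \prod_(i <- s) h i x)%E.
Proof.
elim: s => [|i s IH] mh.
  by under eq_fun do rewrite big_nil; exact: measurable_cst.
under eq_fun do rewrite big_cons.
apply: emeasurable_funM; first by apply: mh; rewrite mem_head.
by apply: IH => j js; apply: mh; rewrite inE js orbT.
Qed.

Lemma ereal_prod_ge0 {R : realType} {I : Type} (s : seq I) (p : pred I)
    (f : I -> \bar R) :
  (forall i, 0 <= f i)%E -> (0 <= \prod_(i <- s | p i) f i)%E.
Proof. by move=> f0; elim/big_ind: _ => // x y; exact: mule_ge0. Qed.

Section independence_tools.
Context {d : measure_display} {Omega : measurableType d} {R : realType}.
Variable P : probability Omega R.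
Local Open Scope ereal_scope.

Lemma integral_prob_cst (k : \bar R) : \int[P]_w k = k.
Proof.
by rewrite integral_cst// -[RHS]mule1; congr (_ * _); exact: probability_setT.
Qed.

(** Independence identifies the joint law with the product law on rectangles, hence everywhere, and
    Tonelli's theorem applies. Later uses freeze one group of variables this way while averaging
    over another. *)
Lemma indep_fubini d1 d2 (S : measurableType d1) (T : measurableType d2)
    (X : Omega -> S) (Y : Omega -> T) (f : S * T -> \bar R) :
  measurable_fun setT X -> measurable_fun setT Y ->
  (forall A B, measurable A -> measurable B ->
     P (X @^-1` A `&` Y @^-1` B) = P (X @^-1` A) * P (Y @^-1` B)) ->
  measurable_fun setT f -> (forall z, 0 <= f z) ->
  \int[P]_w f (X w, Y w) = \int[P]_w \int[P]_w' f (X w, Y w').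
Proof.
move=> mX mY XY mf f0.
pose X' : {mfun Omega >-> S} := HB.pack X (isMeasurableFun.Build _ _ _ _ _ mX).
pose Y' : {mfun Omega >-> T} := HB.pack Y (isMeasurableFun.Build _ _ _ _ _ mY).
pose Z w := (X w, Y w).
have mZ : measurable_fun setT Z by apply/measurable_fun_pairP; split.
pose Z' : {mfun Omega >-> (S * T)%type} := HB.pack Z (isMeasurableFun.Build _ _ _ _ _ mZ).
have E A : measurable A ->
    (distribution P X' \x distribution P Y') A = distribution P Z' A.
  by apply: product_measure_unique => // B C mB mC; rewrite -XY.
transitivity (\int[distribution P Z']_z f z).
  by rewrite ge0_integral_distribution.
transitivity (\int[distribution P X' \x distribution P Y']_z f z).
  by apply: eq_measure_integral => A mA _; apply/esym/E.
rewrite fubini_tonelli1// ge0_integral_distribution//; last 2 first.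
- exact: measurable_fun_fubini_tonelli_F.
- by move=> x; apply: integral_ge0.
apply: eq_integral => w _ /=; rewrite /fubini_F ge0_integral_distribution//.
exact: measurableT_comp mf (pair1_measurable _).
Qed.

Section families.
Context {I : eqType} {d' : measure_display} {S : measurableType d'}.
Variable Y : I -> Omega -> S.
Hypothesis mY : forall i, measurable_fun setT (Y i).

Definition family_events (J : seq I) : set (set Omega) :=
  \bigcup_(j in [set` J]) preimage_set_system setT (Y j) measurable.

Lemma family_events_measurable J : <<s family_events J >> `<=` measurable.
Proof.
apply: smallest_sub; first exact: sigma_algebra_measurable.
by move=> _ [j _] [B mB <-]; exact: mY.
Qed.

Lemma measurable_family (J : seq I) j : j \in J ->
  measurable_fun setT (Y j : g_sigma_algebraType (family_events J) -> S).
Proof.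
move=> jJ _ B mB; apply: sub_sigma_algebra; exists j => //.
by exists B.
Qed.

(* [indep_fubini_rest] applies this with the identity map from [Omega] to [Omega] equipped
   with the sigma-algebra generated by the remaining variables. *)
Lemma indep_rest i J : mutually_independent P Y -> uniq (i :: J) ->
  forall B C, measurable B -> <<s family_events J >> C ->
  P (Y i @^-1` B `&` C) = P (Y i @^-1` B) * P C.
Proof.
move=> indY /=/andP[iJ uJ] B C mB sC.
have mYB : measurable (Y i @^-1` B) by rewrite -[X in measurable X]setTI; exact: mY.
pose G : set (set Omega) := [set A | exists2 D : I -> set S,
  (forall j, measurable (D j)) & A = \bigcap_(j in [set` J]) Y j @^-1` D j].
have Gm : G `<=` measurable.
  move=> _ [D mD ->]; apply: fin_bigcap_measurable => // j _.
  by rewrite -[X in measurable X]setTI; exact: mY.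
have GT : G setT.
  exists (fun=> setT) => //; rewrite bigcapT//.
have GI : setI_closed G.
  move=> _ _ [D mD ->] [D' mD' ->]; exists (fun j => D j `&` D' j).
    by move=> j; exact: measurableI.
  by rewrite -bigcapI; apply: eq_bigcapr => j _; rewrite preimage_setI.
have sG : <<s family_events J >> `<=` <<s G >>.
  apply: smallest_sub; first exact: smallest_sigma_algebra.
  move=> _ [j jJ] [D mD <-]; apply: sub_sigma_algebra.
  exists (fun k => if k == j then D else setT) => [k|]; first by case: ifP.
  rewrite setTI; apply/seteqP; split => [w Dw k _|w /(_ j jJ)] /=.
    by case: eqP => [->|].
  by rewrite eqxx.
(* As functions of [C] both sides are finite measures. They agree on [G], which is stable under
   intersection and generates the events in question. *)
pose m1 := mrestr P mYB.
have Pfin : P (Y i @^-1` B) \is a fin_num by exact: fin_num_measure.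
have k0 : (0 <= fine (P (Y i @^-1` B)))%R by rewrite fine_ge0.
pose m2 := mscale (NngNum k0) P.
have -> : P (Y i @^-1` B `&` C) = m1 C by rewrite /m1 /mrestr setIC.
have -> : P (Y i @^-1` B) * P C = m2 C.
  by rewrite /m2 /mscale /= fineK.
apply: (g_sigma_algebra_measure_unique G Gm (fun=> setT)) => //.
- by rewrite bigcup_const//; exists 0%N.
- move=> _ [D mD ->]; set A := \bigcap_(j in _) _.
  change (P (A `&` Y i @^-1` B) = (fine (P (Y i @^-1` B)))%:E * P A).
  rewrite fineK// {}/A.
  pose D' k := if k == i then B else D k.
  have DE : \bigcap_(j in [set` J]) Y j @^-1` D j =
      \bigcap_(j in [set` J]) Y j @^-1` D' j.
    apply: eq_bigcapr => j /= jJ; rewrite /D'; case: eqP => // ji.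
    by move: iJ; rewrite -ji jJ.
  have -> : (\bigcap_(j in [set` J]) Y j @^-1` D j) `&` Y i @^-1` B =
      \bigcap_(j in [set` i :: J]) Y j @^-1` D' j.
    rewrite DE; apply/seteqP; split => [w [Dw Bw] j|w Dw].
      by rewrite /= inE => /orP[/eqP ->|jJ]; [rewrite /D' eqxx|exact: Dw].
    split; last by have := Dw i; rewrite /= mem_head /D' eqxx; exact.
    by move=> j /= jJ; apply: (Dw j); rewrite /= inE jJ orbT.
  have mD' j : measurable (D' j) by rewrite /D'; case: ifP.
  rewrite indY ?/=; [|by rewrite iJ|by []].
  by rewrite big_cons DE indY//= /D' eqxx.
- move=> _; change (P (setT `&` Y i @^-1` B) < +oo).
  by rewrite setTI (le_lt_trans (probability_le1 _ _))// ltry.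
- exact: sG.
Qed.

Lemma indep_fubini_rest i J
    (f : S * (g_sigma_algebraType (family_events J)) -> \bar R) :
  mutually_independent P Y -> uniq (i :: J) ->
  measurable_fun setT f -> (forall z, 0 <= f z) ->
  \int[P]_w f (Y i w, w) = \int[P]_w \int[P]_w' f (Y i w, w').
Proof.
move=> indY uJ mf f0.
pose Z : Omega -> g_sigma_algebraType (family_events J) := id.
apply: (@indep_fubini _ _ _ _ (Y i) Z) => //.
- by move=> _ B mB; rewrite setTI; exact: (family_events_measurable mB).
- by move=> A B mA mB; apply: (indep_rest indY uJ).
Qed.

Lemma indep_expect_prod (J : seq I) (g : I -> S -> \bar R) :
  mutually_independent P Y -> uniq J ->
  (forall i, measurable_fun setT (g i)) -> (forall i x, 0 <= g i x) ->
  \int[P]_w (\prod_(i <- J) g i (Y i w)) = \prod_(i <- J) \int[P]_w g i (Y i w).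
Proof.
move=> indY + mg g0; elim: J => [|i J IHJ] uJ.
  under eq_integral do rewrite big_nil.
  by rewrite integral_prob_cst big_nil.
under eq_integral do rewrite big_cons.
pose f (z : S * g_sigma_algebraType (family_events J)) :=
  g i z.1 * \prod_(j <- J) g j (Y j z.2).
have prod0 (w : Omega) : 0 <= \prod_(j <- J) g j (Y j w).
  by elim/big_ind: _ => // x y; exact: mule_ge0.
have mprod : measurable_fun setT
    (fun w : g_sigma_algebraType (family_events J) => \prod_(j <- J) g j (Y j w)).
  apply: emeasurable_prod => j jJ.
  exact: measurableT_comp (mg j) (measurable_family jJ).
rewrite (@indep_fubini_rest i J f)//; last 2 first.
- apply: emeasurable_funM; first exact: measurableT_comp.
  exact: measurableT_comp mprod _.
- by move=> z; rewrite mule_ge0.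
rewrite big_cons -IHJ; last by move: uJ => /andP[].
under eq_integral => w _.
  rewrite /f /= ge0_integralZl//; last first.
    apply: emeasurable_prod => j _.
    exact: measurableT_comp (mg j) (mY j).
  over.
rewrite ge0_integralZr//.
- exact: measurableT_comp.
- by apply: integral_ge0 => w _.
Qed.

End families.
End independence_tools.

Lemma measurable_sum_seq {d} {T : measurableType d} {R : realType} {I : eqType}
    (s : seq I) (p : pred I) (h : I -> T -> R) :
  (forall i, i \in s -> measurable_fun setT (h i)) ->
  measurable_fun setT (fun x => \sum_(i <- s | p i) h i x).
Proof.
elim: s => [|i s IH] mh.
  by under eq_fun do rewrite big_nil; exact: measurable_cst.
have IH' : measurable_fun setT (fun x => \sum_(i <- s | p i) h i x).
  by apply: IH => j js; apply: mh; rewrite inE js orbT.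
under eq_fun do rewrite big_cons.
case: (p i) => //; apply: measurable_funD => //.
by apply: mh; rewrite mem_head.
Qed.

Lemma measurable_forall_preimage {d d'} {T : measurableType d}
    {S : measurableType d'} {K : finType} (g : K -> T -> S) (B : K -> set S) :
  (forall c, measurable_fun setT (g c)) -> (forall c, measurable (B c)) ->
  measurable [set w | forall c, B c (g c w)].
Proof.
move=> mg mB; rewrite (_ : [set w | _] = \bigcap_(c in [set: K]) g c @^-1` B c).
  apply: fin_bigcap_measurable => // c _.
  by rewrite -[X in measurable X]setTI; exact: mg.
by apply/seteqP; split => z /=; [move=> h c _; exact: h|move=> h c; exact: h].
Qed.

Section iid_sums.
Context {d : measure_display} {Omega : measurableType d} {R : realType}.
Variable P : probability Omega R.
Variable W : nat -> Omega -> R.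
Hypothesis mW : forall i, measurable_fun setT (W i).
Hypothesis indW : mutually_independent P W.
Hypothesis lawW : forall i A, measurable A -> P (W i @^-1` A) = P (W 0%N @^-1` A).
Local Open Scope ereal_scope.

Lemma identically_distributed_integral i (g : R -> \bar R) :
  measurable_fun setT g -> (forall x, 0 <= g x) ->
  \int[P]_w g (W i w) = \int[P]_w g (W 0%N w).
Proof.
move=> mg g0.
pose W' j : {mfun Omega >-> R} := HB.pack (W j) (isMeasurableFun.Build _ _ _ _ _ (mW j)).
transitivity (\int[distribution P (W' i)]_x g x).
  by rewrite ge0_integral_distribution.
transitivity (\int[distribution P (W' 0%N)]_x g x).
  by apply: eq_measure_integral => A mA _; exact: lawW.
by rewrite ge0_integral_distribution.
Qed.

(* [conv_prob k B x] is the probability that [x] plus the sum of [k] independent weights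
   lies in [B]. *)
Fixpoint conv_prob (k : nat) (B : set R) (x : R) : \bar R :=
  if k is k'.+1 then \int[P]_w conv_prob k' B (x + W 0%N w)%R
  else (\1_B x)%:E.

Lemma conv_prob_ge0 k B x : 0 <= conv_prob k B x.
Proof.
elim: k x => [|k IH] x /=; first by rewrite lee_fin.
by apply: integral_ge0 => w _; exact: IH.
Qed.

Lemma measurable_conv_prob k B : measurable B -> measurable_fun setT (conv_prob k B).
Proof.
move=> mB; elim: k => [|k IH] /=.
  by apply/measurable_EFinP; exact: measurable_indic.
pose f (z : R * Omega) := conv_prob k B (z.1 + W 0%N z.2)%R.
have mf : measurable_fun setT f.
  apply: measurableT_comp IH _; apply: measurable_funD => //.
  exact: measurableT_comp (mW 0%N) _.
exact: (@measurable_fun_fubini_tonelli_F _ _ _ _ _ P f mf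
  (fun z => conv_prob_ge0 _ _ _)).
Qed.

Section groups.
Context {K : finType} (l : nat -> option K) (B : K -> set R).
Hypothesis mB : forall c, measurable (B c).

(** The label [l j] names the group of the weight [W j], if it has one. Integrating out one weight
    only shifts the offset of its own group; the offsets [x] are there to make this induction
    possible. *)
Lemma prob_group_sums J (x : K -> R) : uniq J ->
  P [set w | forall c, B c (x c + \sum_(j <- J | l j == Some c) W j w)%R] =
  \prod_(c : K) conv_prob (count (fun j => l j == Some c) J) (B c) (x c).
Proof.
elim: J x => [|i J IH] x uJ.
  rewrite (_ : [set w | _] = [set w | forall c, B c (x c)]); last first.
    by apply/seteqP; split => w /= h c; have := h c; rewrite big_nil addr0.
  have [h|/existsNP[c nBc]] := pselect (forall c, B c (x c)).
    rewrite (_ : [set w | _] = setT); last by apply/seteqP; split.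
    rewrite probability_setT big1// => c _ /=.
    by rewrite indicE mem_set.
  rewrite (_ : [set w | _] = set0); last first.
    by apply/seteqP; split => // w /(_ c).
  by rewrite measure0 (bigD1 c)//= indicE memNset// mul0e.
have /andP[iJ uJ'] : (i \notin J) && uniq J := uJ.
pose T1 := g_sigma_algebraType (family_events W J).
pose y (z : R) c := (x c + (if l i == Some c then z else 0))%R.
pose E : set (R * T1) := [set z | forall c,
  B c (y z.1 c + \sum_(j <- J | l j == Some c) W j z.2)%R].
have mE : measurable E.
  apply: (@measurable_forall_preimage _ _ _ R K (fun c (z : R * T1) =>
    (y z.1 c + \sum_(j <- J | l j == Some c) W j z.2)%R) B) => // c.
  apply: measurable_funD.
    rewrite /y; case: (l i == Some c); last exact: measurable_cst.
    by apply: measurable_funD => //; exact: measurable_cst.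
  apply: measurable_sum_seq => j jJ.
  have mWj : measurable_fun setT (W j : T1 -> R) by exact: measurable_family.
  exact: (measurableT_comp mWj measurable_snd).
pose f (z : R * T1) : \bar R := (\1_E z)%:E.
transitivity (\int[P]_w f (W i w, w)).
  rewrite (_ : (fun w => f (W i w, w)) = fun w => (\1_[set w | forall c,
      B c (x c + \sum_(j <- i :: J | l j == Some c) W j w)%R] w)%:E); last first.
    apply/funext => w; rewrite /f !indicE; congr (_%:R%:E); congr nat_of_bool.
    apply/idP/idP => /set_mem h; apply/mem_set => c; have := h c;
      by rewrite /y /= big_cons; case: eqP => _; rewrite ?addrA ?addr0.
  rewrite integral_indic ?setIT//.
  apply: (@measurable_forall_preimage _ _ _ R K (fun c (w : Omega) =>
    (x c + \sum_(j <- i :: J | l j == Some c) W j w)%R) B) => // c.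
  by apply: measurable_funD => //; apply: measurable_sum_seq => j _; exact: mW.
rewrite (@indep_fubini_rest _ _ _ P _ _ _ W mW i J f)//; last 2 first.
- by apply/measurable_EFinP; exact: measurable_indic.
- by move=> z; rewrite lee_fin.
have step w : \int[P]_w' f (W i w, w') =
    \prod_c conv_prob (count (fun j => l j == Some c) J) (B c) (y (W i w) c).
  rewrite -IH// /f.
  rewrite (_ : (fun w' => _) = fun w' => (\1_[set w' | forall c, B c (y (W i w) c
      + \sum_(j <- J | l j == Some c) W j w')%R] w')%:E); last first.
    by apply/funext => w'; rewrite !indicE; congr (_%:R%:E); congr nat_of_bool;
      apply/idP/idP => /set_mem h; apply/mem_set.
  rewrite integral_indic ?setIT//.
  apply: (@measurable_forall_preimage _ _ _ R K (fun c (w' : Omega) =>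
    (y (W i w) c + \sum_(j <- J | l j == Some c) W j w')%R) B) => // c.
  by apply: measurable_funD => //; apply: measurable_sum_seq => j _; exact: mW.
under eq_integral do rewrite step.
case li: (l i) => [c0|]; last first.
  under eq_integral => w _.
    under eq_bigr => c _ do rewrite /y li addr0; over.
  rewrite integral_prob_cst; apply: eq_bigr => c _.
  by rewrite /= li.
under eq_integral => w _.
  rewrite (bigD1 c0)//= {1}/y li eqxx.
  under eq_bigr => c cc0.
    have -> : y (W i w) c = x c.
      by rewrite /y li; case: eqP => [[e]|_]; [rewrite e eqxx in cc0|rewrite addr0].
    over.
  over.
rewrite ge0_integralZr//; last 3 first.
- apply: measurableT_comp (measurable_conv_prob _ (mB c0)) _.
  by apply: measurable_funD => //; exact: mW.
- by move=> w _; exact: conv_prob_ge0.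
- by apply: ereal_prod_ge0 => c; exact: conv_prob_ge0.
rewrite (identically_distributed_integral i
  (g := fun z => conv_prob (count (fun j => l j == Some c0) J) (B c0) (x c0 + z)%R)); last 2 first.
- by apply: measurableT_comp (measurable_conv_prob _ (mB c0)) _; exact: measurable_funD.
- by move=> z; exact: conv_prob_ge0.
rewrite [RHS](bigD1 c0)//= li eqxx /=; congr (_ * _).
apply: eq_bigr => c cc0; rewrite (_ : (Some c0 == Some c) = false)//.
by apply/eqP => -[e]; rewrite e eqxx in cc0.
Qed.
End groups.
End iid_sums.

(** * Compound Poisson weights of disjoint cells *)

Lemma nneseries_finite_set {R : realType} (I : set nat) (a : nat -> R) :
  finite_set I -> (forall i, 0 <= a i) ->
  (\sum_(i <oo) (\1_I i * a i)%:E)%E = (\sum_(i <- fset_set I) a i)%:E.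
Proof.
move=> fI a0; rewrite nneseries_esumT; last by move=> i; rewrite lee_fin mulr_ge0.
rewrite (esumID I); last by move=> i _; rewrite lee_fin mulr_ge0.
rewrite setTI setTI [X in (_ + X)%E]esum1 ?adde0; last first.
  by move=> i iI; rewrite indicE memNset ?mul0r.
rewrite esum_fset//; last by move=> i _; rewrite lee_fin mulr_ge0.
rewrite fsbig_finite//= sumEFin; congr (_%:E); apply: eq_big_seq => i.
by rewrite in_fset_set// indicE => ->; rewrite mul1r.
Qed.

Lemma esum_indic {R : realType} (I : set nat) (a : nat -> R) : (forall i, 0 <= a i) ->
  (\esum_(i in I) (a i)%:E = \sum_(i <oo) (\1_I i * a i)%:E)%E.
Proof.
move=> a0; rewrite nneseries_esumT; last by move=> i; rewrite lee_fin mulr_ge0.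
rewrite [RHS](esumID I); last by move=> i _; rewrite lee_fin mulr_ge0.
rewrite setTI setTI [X in (_ + X)%E]esum1 ?adde0; last first.
  by move=> i iI; rewrite indicE memNset ?mul0r.
by apply: eq_esum => i iI; rewrite indicE mem_set ?mul1r.
Qed.

(** The expectation of [h] at a Poisson variable. With [conv_prob] for [h] it is a compound Poisson
    law. *)
Definition poisson_mix {R : realType} (rate : R) (h : nat -> \bar R) : \bar R :=
  (\sum_(k <oo) poisson_prob rate k [set k] * h k)%E.

Section poisson_counts.
Context {d : measure_display} {Omega : measurableType d} {R : realType}.
Variable P : probability Omega R.
Variable X : nat -> Omega -> R * R.
Hypothesis mX : forall i, measurable_fun setT (X i).
Hypothesis poisX : unit_poisson_process P X.
Local Open Scope ereal_scope.

Lemma point_countE A w : point_count X A w = \sum_(i <oo) (\1_A (X i w))%:E.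
Proof.
rewrite /point_count counting_dirac; apply: eq_eseriesr => i _.
by rewrite diracE indicE; congr (_%:R%:E); congr nat_of_bool; apply/idP/idP => /set_mem h;
  apply/mem_set.
Qed.

Lemma measurable_point_count A : measurable A -> measurable_fun setT (point_count X A).
Proof.
move=> mA; rewrite (_ : point_count X A = fun w => \sum_(i <oo) (\1_A (X i w))%:E);
  last by apply/funext => w; exact: point_countE.
apply: ge0_emeasurable_sum => [i w _ _|i _]; first by rewrite lee_fin.
by apply/measurable_EFinP; apply: measurableT_comp.
Qed.

Lemma point_count_finite A w : finite_set [set i | A (X i w)] ->
  point_count X A w = (#|` fset_set [set i | A (X i w)]|)%:R%:E.
Proof. by move=> fA; rewrite /point_count /counting; case: asboolP. Qed.

Section one_set.
Variable A : set (R * R).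
Hypothesis mA : measurable A.
Hypothesis finA : lebesgue_measure2 A < +oo.

Let countk k : set Omega := point_count X A @^-1` [set k%:R%:E].

Let mcountk k : measurable (countk k).
Proof.
by rewrite -[X in measurable X]setTI; apply: measurable_point_count.
Qed.

(** The definition of the process prescribes only the probabilities of finite counts; they sum to 1,
    which leaves no mass for an infinite count. *)
Lemma ae_finite_points : {ae P, forall w, finite_set [set i | A (X i w)]}.
Proof.
have tI : trivIset setT countk.
  apply/trivIsetP => j k _ _ jk; rewrite /countk -preimage_setI.
  rewrite (_ : _ `&` _ = set0) ?preimage_set0//; apply/seteqP; split => //.
  move=> x [/= -> []] /eqP; rewrite eqr_nat => /eqP jk'.
  by rewrite jk' eqxx in jk.
have PU : P (\bigcup_k countk k) = 1.
  rewrite measure_bigcup//.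
  under eq_eseriesl => k do rewrite in_setT.
  pose rt := fine (lebesgue_measure2 A).
  have PN k : P (countk k) = poisson_prob rt k [set k] by exact: poisX.1.
  transitivity (\sum_(k <oo) poisson_prob rt k [set k]).
    by apply: eq_eseriesr => k _; exact: PN.
  have <- : poisson_prob rt 0 [set: nat] = 1 by exact: probability_setT.
  rewrite (_ : [set: nat] = \bigcup_k [set k]); last first.
    by apply/seteqP; split => // k _; exists k.
  rewrite measure_bigcup//; last first.
    by apply/trivIsetP => j k _ _ jk; apply/seteqP; split => // x [/= -> /eqP]; rewrite (negbTE jk).
  by under [RHS]eq_eseriesl => k do rewrite in_setT.
exists (~` \bigcup_k countk k); split.
- by apply: measurableC; exact: bigcup_measurable.
- rewrite probability_setC ?PU ?subee//; exact: bigcup_measurable.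
- move=> w /= nfin [k _] /=; rewrite /countk /= /point_count /counting.
  by case: asboolP.
Qed.

Variable h : nat -> \bar R.
Hypothesis h0 : forall k, 0 <= h k.

(* The factor is [0] when the count is infinite. *)
Definition count_apply (y : \bar R) : \bar R :=
  \sum_(k <oo) (\1_[set k%:R%:E] y)%:E * h k.

Lemma count_apply_ge0 y : 0 <= count_apply y.
Proof. by apply: nneseries_ge0 => k _ _; rewrite mule_ge0. Qed.

Lemma measurable_count_apply : measurable_fun setT count_apply.
Proof.
apply: ge0_emeasurable_sum => [k y _ _|k _]; first by rewrite mule_ge0.
apply: emeasurable_funM; last exact: measurable_cst.
by apply/measurable_EFinP; exact: measurable_indic.
Qed.

Lemma count_applyE (k : nat) : count_apply k%:R%:E = h k.
Proof.
rewrite /count_apply nneseries_esumT; last by move=> i; rewrite mule_ge0.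
rewrite (esumID [set k]); last by move=> i _; rewrite mule_ge0.
rewrite setTI setTI [X in _ + X]esum1 ?adde0; last first.
  move=> i /= ik; rewrite indicE (_ : (_ \in _) = false) ?mul0e//.
  by apply/negP => /set_mem /= [] /eqP; rewrite eqr_nat => /eqP ki; apply: ik.
rewrite esum_set1 ?mule_ge0// indicE mem_set ?mul1e//.
Qed.

Lemma integral_count_apply :
  \int[P]_w count_apply (point_count X A w) =
  poisson_mix (fine (lebesgue_measure2 A)) h.
Proof.
have mk k : measurable_fun setT
    (fun w => (\1_[set k%:R%:E] (point_count X A w))%:E : \bar R).
  apply/measurable_EFinP; apply: measurableT_comp; first exact: measurable_indic.
  exact: measurable_point_count.
rewrite /count_apply integral_nneseries//; last 2 first.
- by move=> k; apply: emeasurable_funM => //; exact: measurable_cst.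
- by move=> k w _; rewrite mule_ge0.
apply: eq_eseriesr => k _; rewrite ge0_integralZr//.
congr (_ * _); rewrite -(poisX.1 _ mA finA k).
transitivity (\int[P]_w (\1_(countk k) w)%:E) => //.
by rewrite integral_indic// setIT.
Qed.

End one_set.
End poisson_counts.

(** Up to the factor [expR (rate * (phi - 1))] the terms are the Poisson masses of rate
    [rate * phi], which sum to 1. *)
Lemma poisson_mix_exp {R : realType} (rate phi : R) : 0 < rate -> 0 < phi ->
  poisson_mix rate (fun k => (phi ^+ k)%:E) = (expR (rate * (phi - 1)))%:E.
Proof.
move=> r0 phi0; rewrite /poisson_mix.
have rp0 : 0 < rate * phi by rewrite mulr_gt0.
have single (s : R) k : 0 < s -> poisson_prob s k [set k] = (poisson_pmf s k)%:E.
  by move=> s0; rewrite /poisson_prob s0 esum_set1// lee_fin poisson_pmf_ge0.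
transitivity (\sum_(k <oo) (expR (rate * (phi - 1)))%:E *
    poisson_prob (rate * phi) k [set k])%E.
  apply: eq_eseriesr => k _; rewrite !single// -!EFinM /poisson_pmf r0 rp0; congr EFin.
  rewrite mulrBr mulr1 exprMn expRD expRN expRN.
  have := expR_gt0 rate; have := expR_gt0 (rate * phi) => /gt_eqF e1 /gt_eqF e2.
  by field; rewrite e1 e2 pnatr_eq0 -lt0n fact_gt0.
rewrite nneseriesZl//.
rewrite (_ : \sum_(k <oo) _ = 1)%E ?mule1//.
have <- : poisson_prob (rate * phi) 0 [set: nat] = 1%E by exact: probability_setT.
rewrite (_ : [set: nat] = \bigcup_k [set k]); last first.
  by apply/seteqP; split => // k _; exists k.
rewrite measure_bigcup//; last first.
  by apply/trivIsetP => j k _ _ jk; apply/seteqP; split => // x [/= -> /eqP]; rewrite (negbTE jk).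
by under [RHS]eq_eseriesl => k do rewrite in_setT.
Qed.

Section cell_weights.
Context {d : measure_display} {Omega : measurableType d} {R : realType}.
Variable P : probability Omega R.
Variables (X : nat -> Omega -> R * R) (W : nat -> Omega -> R).
Hypothesis mX : forall i, measurable_fun setT (X i).
Hypothesis mW : forall i, measurable_fun setT (W i).
Hypothesis W_ge0 : forall i w, 0 <= W i w.
Hypothesis poisX : unit_poisson_process P X.
Hypothesis indW : mutually_independent P W.
Hypothesis lawW : forall i A, measurable A -> P (W i @^-1` A) = P (W 0%N @^-1` A).
Hypothesis indXW : independent_families P X W.
Local Open Scope ereal_scope.

(** [T1] and [T2] are copies of [Omega] with the sigma-algebras of the points and of the weights.
    The identity maps into them are independent random elements, so [indep_fubini] separates points
    from weights in any function of the pair. *)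
Let T1 := g_sigma_algebraType (\bigcup_i preimage_set_system setT (X i) measurable).
Let T2 := g_sigma_algebraType (\bigcup_i preimage_set_system setT (W i) measurable).

Definition cell_weight (A : set (R * R)) (w : Omega) : \bar R :=
  \esum_(i in [set i | A (X i w)]) (W i w)%:E.

Lemma cell_weightE A w :
  cell_weight A w = \sum_(i <oo) (\1_A (X i w) * W i w)%:E.
Proof.
by rewrite /cell_weight esum_indic//; apply: eq_eseriesr => i _.
Qed.

Let mid1 : measurable_fun setT (id : Omega -> T1).
Proof.
move=> _ B mB; rewrite setTI.
suff : sigma_generated X `<=` measurable by apply.
apply: smallest_sub; first exact: sigma_algebra_measurable.
by move=> _ [j _] [C mC <-]; exact: mX.
Qed.

Let mid2 : measurable_fun setT (id : Omega -> T2).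
Proof.
move=> _ B mB; rewrite setTI.
suff : sigma_generated W `<=` measurable by apply.
apply: smallest_sub; first exact: sigma_algebra_measurable.
by move=> _ [j _] [C mC <-]; exact: mW.
Qed.

Let mX1 i : measurable_fun setT (X i : T1 -> R * R).
Proof. by move=> _ B mB; apply: sub_sigma_algebra; exists i => //; exists B. Qed.

Let mW2 i : measurable_fun setT (W i : T2 -> R).
Proof. by move=> _ B mB; apply: sub_sigma_algebra; exists i => //; exists B. Qed.

Lemma measurable_cell_series A : measurable A ->
  measurable_fun setT (fun z : T1 * T2 => \sum_(i <oo) (\1_A (X i z.1) * W i z.2)%:E).
Proof.
move=> mA; apply: ge0_emeasurable_sum => [i z _ _|i _].
  by rewrite lee_fin mulr_ge0.
apply/measurable_EFinP; apply: measurable_funM.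
  apply: measurableT_comp; first exact: measurable_indic.
  exact: (measurableT_comp (mX1 i) measurable_fst).
exact: (measurableT_comp (mW2 i) measurable_snd).
Qed.

Section disjoint_cells.
Context {K : finType} (A : K -> set (R * R)).
Hypothesis mA : forall c, measurable (A c).
Hypothesis finA : forall c, lebesgue_measure2 (A c) < +oo.
Hypothesis disjA : forall c c' z, A c z -> A c' z -> c = c'.

Let npoints c w := #|` fset_set [set i | A c (X i w)]|.

(** Once the weights are averaged out, the integrand depends on the points only through their
    numbers in the cells, and these are independent Poisson variables because the cells are
    disjoint. *)
Lemma integral_cells (f : T1 * T2 -> \bar R) (h : K -> nat -> \bar R) :
  measurable_fun setT f -> (forall z, 0 <= f z) -> (forall c k, 0 <= h c k) ->
  (forall w : Omega, (forall c, finite_set [set i | A c (X i w)]) ->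
     \int[P]_w' f (w, w') = \prod_c h c (npoints c w)) ->
  \int[P]_w f (w, w) =
    \prod_c poisson_mix (fine (lebesgue_measure2 (A c))) (h c).
Proof.
move=> mf f0 h0 fh.
transitivity (\int[P]_w \int[P]_w' f (w, w')).
  exact: (@indep_fubini _ _ _ P _ _ T1 T2 id id f mid1 mid2 indXW mf f0).
pose F (w : Omega) := \int[P]_w' f (w, w').
have mF : measurable_fun setT F.
  pose Q' : probability T2 R := distribution P
    (HB.pack (id : Omega -> T2) (isMeasurableFun.Build _ _ _ _ _ mid2) : {mfun Omega >-> T2}).
  have mF1 : measurable_fun setT (fun x : T1 => \int[Q']_y f (x, y)).
    exact: (@measurable_fun_fubini_tonelli_F _ _ T1 T2 R Q' f mf f0).
  rewrite (_ : F = fun x => \int[Q']_y f (x, y)); last first.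
    apply/funext => w; rewrite ge0_integral_distribution//.
    exact: measurableT_comp mf (pair1_measurable _).
  exact: (measurableT_comp mF1 mid1).
transitivity (\int[P]_w \prod_c count_apply (h c) (point_count X (A c) w)).
  apply: ge0_ae_eq_integral => //.
  - apply: emeasurable_prod => c _.
    apply: measurableT_comp; first exact: measurable_count_apply.
    exact: measurable_point_count.
  - by move=> w _; apply: integral_ge0.
  - by move=> w _; apply: ereal_prod_ge0 => c; exact: count_apply_ge0.
  - have : {ae P, forall w, forall c, finite_set [set i | A c (X i w)]}.
      by apply: filter_forall => c; exact: ae_finite_points.
    apply: filterS => w fw _; rewrite /F fh//; apply: eq_bigr => c _.
    by rewrite point_count_finite// count_applyE.
(* Independence of counts is available for sequences of disjoint sets: the cells are numbered by
   [enum_rank] and the sequence is completed by empty sets. *)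
pose inv (j : nat) : option K := [pick c | enum_rank c == j :> nat].
have invE c : inv (enum_rank c) = Some c.
  rewrite /inv; case: pickP => [c' /eqP /val_inj /enum_rank_inj -> //|/(_ c)].
  by rewrite eqxx.
pose A' j := if inv j is Some c then A c else set0.
pose g j := if inv j is Some c then count_apply (h c) else cst 0.
have mA' j : measurable (A' j) by rewrite /A'; case: (inv j).
have tA' : trivIset setT A'.
  apply/trivIsetP => j k _ _ jk; apply/seteqP; split => // z.
  rewrite /A' /inv; case: pickP => [c /eqP cj|_ []//] [Acz].
  case: pickP => [c' /eqP c'k|//] Ac'z.
  by move: jk; rewrite -cj -c'k (disjA Acz Ac'z) eqxx.
pose J : seq nat := [seq nat_of_ord (enum_rank c) | c <- enum K].
have uJ : uniq J.
  by rewrite map_inj_uniq ?enum_uniq// => c c' /val_inj /enum_rank_inj.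
have bigJ (G : K -> \bar R) (G' : nat -> \bar R) : (forall c, G' (enum_rank c) = G c) ->
    \prod_c G c = \prod_(j <- J) G' j.
  by move=> GG'; rewrite big_map big_enum; apply: eq_bigr => c _.
under eq_integral => w _.
  rewrite (bigJ _ (fun j => g j (point_count X (A' j) w))); last first.
    by move=> c; rewrite /g /A' invE.
  over.
rewrite (indep_expect_prod (Y := fun j => point_count X (A' j)) _ (poisX.2 _ mA' tA') uJ).
- rewrite (bigJ _ (fun j => \int[P]_w g j (point_count X (A' j) w)))// => c.
  by rewrite /g /A' invE integral_count_apply.
- by move=> j; exact: measurable_point_count.
- by move=> j; rewrite /g; case: (inv j) => [c|]; [exact: measurable_count_apply|].
- by move=> j y; rewrite /g; case: (inv j) => [c|//]; exact: count_apply_ge0.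
Qed.

(** The product form gives the independence of the cell weights, and each factor sees its cell only
    through the area. Both facts carry the discretization below. *)
Lemma prob_cell_weights (B : K -> set R) : (forall c, measurable (B c)) ->
  P [set w | forall c, B c (fine (cell_weight (A c) w))] =
  \prod_c poisson_mix (fine (lebesgue_measure2 (A c)))
             (fun k => conv_prob P W k (B c) 0%R).
Proof.
move=> mB.
pose S c (z : T1 * T2) : \bar R := \sum_(i <oo) (\1_(A c) (X i z.1) * W i z.2)%:E.
have mS c : measurable_fun setT (fun z => fine (S c z)).
  by apply: measurableT_comp (measurable_cell_series (mA c)); exact: fine_measurable.
pose E : set (T1 * T2) := [set z | forall c, B c (fine (S c z))].
have mE : measurable E.
  exact: (@measurable_forall_preimage _ _ _ R K (fun c z => fine (S c z)) B).
pose f (z : T1 * T2) : \bar R := (\1_E z)%:E.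
have cwS c w : cell_weight (A c) w = S c (w, w) by exact: cell_weightE.
transitivity (\int[P]_w f (w, w)).
  rewrite (_ : (fun w => f (w, w)) = fun w => (\1_[set w | forall c,
      B c (fine (cell_weight (A c) w))] w)%:E); last first.
    apply/funext => w; rewrite /f !indicE; congr (_%:R%:E); congr nat_of_bool.
    by apply/idP/idP => /set_mem h; apply/mem_set => c; have := h c; rewrite cwS.
  rewrite integral_indic ?setIT//.
  apply: (@measurable_forall_preimage _ _ _ R K (fun c w => fine (cell_weight (A c) w)) B) => // c.
  under eq_fun do rewrite cwS.
  have mdiag : measurable_fun setT (fun w : Omega => (w, w) : T1 * T2).
    by apply/measurable_fun_pairP; split; [exact: mid1|exact: mid2].
  exact: (measurableT_comp (mS c) mdiag).
apply: integral_cells.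
- by apply/measurable_EFinP; exact: measurable_indic.
- by move=> z; rewrite lee_fin.
- by move=> c k; exact: conv_prob_ge0.
move=> w fin.
pose l j := [pick c | `[< A c (X j w) >]].
have lE j c : (l j == Some c) = `[< A c (X j w) >].
  rewrite /l; case: pickP => [c' /asboolP Ac'|/(_ c) ->//].
  apply/eqP/asboolP => [[<-]//|Ac]; congr Some; exact: disjA Ac' Ac.
pose I := [set j | exists c, A c (X j w)].
have fI : finite_set I.
  rewrite (_ : I = \bigcup_(c in [set: K]) [set i | A c (X i w)]).
    by apply: bigcup_finite => // c _; exact: fin.
  by apply/seteqP; split => j /= [c]; [exists c|move=> _ Ac; exists c].
pose J : seq nat := fset_set I.
have permJ c : perm_eq [seq j <- J | l j == Some c] (fset_set [set i | A c (X i w)]).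
  apply: uniq_perm; rewrite ?filter_uniq ?fset_uniq// => j.
  rewrite mem_filter lE !in_fset_set//.
  apply/andP/idP => [[/asboolP h _]|/set_mem h]; first exact/mem_set.
  by split; [exact/asboolP|apply/mem_set; exists c].
transitivity (P [set w' | forall c,
    B c (0 + \sum_(j <- J | l j == Some c) W j w')%R]).
  rewrite (_ : (fun w' => f (w, w')) = fun w' => (\1_[set w' | forall c,
    B c (0 + \sum_(j <- J | l j == Some c) W j w')%R] w')%:E); last first.
    apply/funext => w'; rewrite /f !indicE; congr (_%:R%:E); congr nat_of_bool.
    have SE c : fine (S c (w, w')) = (\sum_(j <- J | l j == Some c) W j w')%R.
      rewrite -[RHS]big_filter (perm_big _ (permJ c)) /=.
      by rewrite -[RHS](congr1 fine (nneseries_finite_set (fin c) _)).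
    by apply/idP/idP => /set_mem h; apply/mem_set => c; have := h c; rewrite /= SE add0r.
  rewrite integral_indic ?setIT//.
  apply: (@measurable_forall_preimage _ _ _ R K (fun c (w' : Omega) =>
    (0 + \sum_(j <- J | l j == Some c) W j w')%R) B) => // c.
  by apply: measurable_funD => //; apply: measurable_sum_seq => j _; exact: mW.
rewrite (prob_group_sums mW indW lawW l mB (fun=> 0%R)) ?fset_uniq//.
by apply: eq_bigr => c _; rewrite -size_filter (perm_size (permJ c)).
Qed.

End disjoint_cells.

Lemma mgf_cell_weight (A : set (R * R)) (a phi : R) : measurable A ->
  (0 <= a)%R -> lebesgue_measure2 A < +oo -> (0 < fine (lebesgue_measure2 A))%R ->
  \int[P]_w (expR (a * W 0%N w))%:E = phi%:E ->
  \int[P]_w (expR (a * fine (cell_weight A w)))%:E =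
  (expR (fine (lebesgue_measure2 A) * (phi - 1)))%:E.
Proof.
move=> mA a0 finA A0 phiE.
pose S (z : T1 * T2) : \bar R := \sum_(i <oo) (\1_A (X i z.1) * W i z.2)%:E.
have mS : measurable_fun setT (fun z => fine (S z)).
  by apply: measurableT_comp (measurable_cell_series mA); exact: fine_measurable.
pose f (z : T1 * T2) : \bar R := (expR (a * fine (S z)))%:E.
transitivity (\int[P]_w f (w, w)).
  by apply: eq_integral => w _; rewrite cell_weightE.
have phi0 : (0 < phi)%R.
  rewrite -lte_fin -phiE; apply: (@lt_le_trans _ _ 1) => //.
  rewrite -[leLHS](integral_prob_cst P); apply: ge0_le_integral => //.
  - apply/measurable_EFinP; apply: measurableT_comp => //.
    exact: (measurable_funM (measurable_cst _) (mW 0%N)).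
  - by move=> w _; rewrite lee_fin -expR0 ler_expR mulr_ge0.
rewrite (@integral_cells unit (fun=> A) _ _ _ f (fun _ k => (phi ^+ k)%:E))//.
- by rewrite big_const card_unit /= mule1 poisson_mix_exp.
- by move=> [] [].
- apply/measurable_EFinP; apply: measurableT_comp => //.
  exact: measurable_funM.
- by move=> z; rewrite lee_fin expR_ge0.
- by move=> _ k; rewrite lee_fin exprn_ge0// ltW.
move=> w /(_ tt) fin; set J : seq nat := fset_set [set i | A (X i w)].
rewrite (_ : (fun w' => f (w, w')) = fun w' => \prod_(j <- J) (expR (a * W j w'))%:E); last first.
  apply/funext => w'; rewrite /f prodEFin; congr EFin; rewrite -expR_sum -mulr_sumr.
  by rewrite -[X in (_ = expR (_ * X))%R](congr1 fine (nneseries_finite_set fin _)).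
have mexp : measurable_fun setT (fun x : R => (expR (a * x))%:E).
  have m : measurable_fun setT (fun x : R => expR (a * x)).
    exact: (measurableT_comp (@measurable_expR R) (mulrl_measurable a)).
  exact/measurable_EFinP.
rewrite (indep_expect_prod mW indW (fset_uniq _) (g := fun _ x => (expR (a * x))%:E))//.
rewrite big_const card_unit /= mule1.
rewrite (eq_bigr (fun=> phi%:E)) => [|j _]; last first.
  by rewrite (identically_distributed_integral mW lawW j (g := fun x => (expR (a * x))%:E)).
by rewrite prodEFin big_const_seq count_predT iter_mulr_1.
Qed.

End cell_weights.

(** * Last passage times and chains of points *)

Section chains.
Context {R : realType}.
Implicit Types (p q z m : R * R) (s : seq nat).

Lemma le2_refl z : le2 z z.
Proof. by rewrite /le2 !lexx. Qed.

Lemma le2_trans : transitive (@le2 R).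
Proof.
move=> y x z /andP[a b] /andP[c e]; apply/andP.
by split; [exact: le_trans a c|exact: le_trans b e].
Qed.

Lemma le2_anti z z' : le2 z z' -> le2 z' z -> z = z'.
Proof.
case: z z' => [a b] [c e] /andP[/= h1 h2] /andP[/= h3 h4].
by congr pair; apply: le_anti; apply/andP.
Qed.

Definition comparable2 z z' := le2 z z' || le2 z' z.

Lemma corner_bounds p q z : le2 p q -> corner p q z -> le2 p z && le2 z q.
Proof.
rewrite /le2 => /andP[h1 h2] [/= [/andP[a b] ->]|/= [-> /andP[a b]]].
  by rewrite a b lexx h2.
by rewrite a b lexx h1.
Qed.

Lemma corner_comparable p q z z' : le2 p q -> corner p q z -> corner p q z' ->
  comparable2 z z'.
Proof.
rewrite /comparable2 /le2 => /andP[h1 h2].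
move=> [/= [/andP[a b] e]|/= [e /andP[a b]]] [/= [/andP[a' b'] e']|/= [e' /andP[a' b']]].
- by rewrite e e' lexx !andbT; exact: le_total.
- by rewrite e e' a' b.
- by rewrite e e' a b' orbT.
- by rewrite e e' lexx /=; exact: le_total.
Qed.

Lemma lowest_curve_bounds p (t : seq (R * R)) q z : path le2 p (rcons t q) ->
  lowest_curve p t q z -> le2 p z && le2 z q.
Proof.
elim: t p => [|p1 t IH] p /=; first by rewrite andbT; exact: corner_bounds.
move=> /andP[pp1 pt] [/(corner_bounds pp1)/andP[-> zp1]|/(IH _ pt)/andP[p1z ->]].
  have := order_path_min le2_trans pt; rewrite all_rcons => /andP[p1q _].
  by rewrite (le2_trans zp1).
by rewrite (le2_trans pp1).
Qed.

Lemma lowest_curve_comparable p (t : seq (R * R)) q z z' : path le2 p (rcons t q) ->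
  lowest_curve p t q z -> lowest_curve p t q z' -> comparable2 z z'.
Proof.
elim: t p => [|p1 t IH] p /=; first by rewrite andbT; exact: corner_comparable.
move=> /andP[pp1 pt] [cz|cz] [cz'|cz'].
- exact: corner_comparable cz cz'.
- have /andP[_ h] := corner_bounds pp1 cz.
  have /andP[h' _] := lowest_curve_bounds pt cz'.
  by rewrite /comparable2 (le2_trans h h').
- have /andP[_ h] := corner_bounds pp1 cz'.
  have /andP[h' _] := lowest_curve_bounds pt cz.
  by rewrite /comparable2 (le2_trans h h') orbT.
- exact: IH cz cz'.
Qed.

Lemma lowest_curve_mem p (t : seq (R * R)) q z : path le2 p (rcons t q) ->
  z \in t -> lowest_curve p t q z.
Proof.
elim: t p => [//|p1 t IH] p /= /andP[/andP[a b] pt].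
rewrite inE => /orP[/eqP ->|zt]; last by right; exact: IH.
by left; right => /=; rewrite b lexx.
Qed.

Variables (x : nat -> R * R) (w : nat -> R).
Hypothesis w_ge0 : forall i, 0 <= w i.

Definition in_rect p q z := [&& le2 p z, le2 z q & z != p].

(** Chains replace curves: sorting a chain gives the sequence of a path, and finitely many indices
    on a curve form a chain. They consist of indices because the weights of two indices that
    enumerate the same point both count. As for the paths, the starting corner is excluded. *)
Definition chain_in p q s := [/\ uniq s, {in s, forall i, in_rect p q (x i)} &
  {in s &, forall i j, comparable2 (x i) (x j)}].

Lemma last_passage_ge p q s : le2 p q -> chain_in p q s ->
  ((\sum_(i <- s) w i)%:E <= last_passage x w p q)%E.
Proof.
move=> pq [us rs cs].
pose le_x i j := le2 (x i) (x j).
pose s' := sort le_x s; pose t := [seq x i | i <- s'].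
have mem_s' i : (i \in s') = (i \in s) by rewrite mem_sort.
have srt : sorted le_x s'.
  apply: (@sort_sorted_in _ (mem s) le_x) => //; exact/allP.
have pt : path le2 p (rcons t q).
  rewrite rcons_path; apply/andP; split.
    have : {in s', forall i, le2 p (x i)}.
      by move=> i; rewrite mem_s' => /rs/and3P[].
    rewrite /t; case: s' srt {mem_s' t} => [//|i s'' /=] srt hp.
    by rewrite hp ?mem_head//= path_map.
  have [t0|[i si ->]] : t = [::] \/ exists2 i, i \in s & last p t = x i.
  - rewrite /t; case: s' mem_s' {srt t} => [|i s''] mem_s'; [by left|right].
    by exists (last i s''); [rewrite -mem_s' mem_last|rewrite /= last_map].
  - by rewrite t0.
  - by have /and3P[] := rs _ si.
set c := lowest_curve p t q `\ p.
apply: (@le_trans _ _ (\esum_(i in [set i | c (x i)]) (w i)%:E)%E); last first.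
  apply: ereal_sup_ubound; exists c => //; exists t; split => //.
  by move=> z /mapP[i _ ->]; exists i.
apply: esum_ge; exists [set` s].
  split; first exact: finite_seq.
  move=> i /= si; split; last by move=> /= e; have /and3P[_ _] := rs _ si; rewrite e eqxx.
  apply: lowest_curve_mem => //; apply: map_f; by rewrite mem_s'.
by rewrite -fsbig_seq// sumEFin.
Qed.

Lemma last_passage_le p q (y : \bar R) :
  (forall s, chain_in p q s -> ((\sum_(i <- s) w i)%:E <= y)%E) ->
  (last_passage x w p q <= y)%E.
Proof.
move=> H; apply: ge_ereal_sup => _ [_ [t [_ pt ->]] <-].
apply: ge_ereal_sup => _ [I [fI Ic] <-].
rewrite fsbig_finite//= sumEFin; apply: H; split.
- exact: fset_uniq.
- move=> i; rewrite in_fset_set// => /set_mem/Ic [/= ic /eqP ip].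
  by rewrite /in_rect; have /andP[-> ->] := lowest_curve_bounds pt ic; rewrite ip.
- move=> i j; rewrite !in_fset_set// => /set_mem/Ic [/= ic _] /set_mem/Ic [/= jc _].
  exact: lowest_curve_comparable ic jc.
Qed.

Lemma chain_in_nil p q : chain_in p q [::].
Proof. by split. Qed.

Lemma last_passage_ge0 p q : le2 p q -> (0 <= last_passage x w p q)%E.
Proof.
by move=> pq; have := last_passage_ge pq (chain_in_nil p q); rewrite big_nil.
Qed.

Lemma in_rectS p q p' q' z : le2 p' p -> le2 q q' -> in_rect p q z -> in_rect p' q' z.
Proof.
move=> pp qq /and3P[pz zq zp]; apply/and3P; split.
- exact: le2_trans pp pz.
- exact: le2_trans zq qq.
- apply: contraNneq zp => zp'; rewrite zp' in pz *.
  by rewrite (le2_anti pp pz).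
Qed.

Lemma le_last_passage p q p' q' : le2 p' p -> le2 p q -> le2 q q' ->
  (last_passage x w p q <= last_passage x w p' q')%E.
Proof.
move=> pp pq qq; apply: last_passage_le => s [us rs cs].
apply: last_passage_ge; first exact: le2_trans (le2_trans pp pq) qq.
by split => // i /rs; exact: in_rectS.
Qed.

(** The two rectangles meet only in [m], which the second one excludes, so no index occurs twice. *)
Lemma chain_in_cat p m q s s' : le2 p m -> le2 m q ->
  chain_in p m s -> chain_in m q s' -> chain_in p q (s ++ s').
Proof.
move=> pm mq [us rs cs] [us' rs' cs']; split.
- rewrite cat_uniq us us' andbT /=; apply/hasPn => i /rs' /and3P[mi _ im].
  apply/negP => /rs /and3P[_ im' _].
  by rewrite (le2_anti im' mi) eqxx in im.
- move=> i; rewrite mem_cat => /orP[/rs|/rs'].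
    by apply: in_rectS => //; exact: le2_refl.
  by apply: in_rectS => //; exact: le2_refl.
- move=> i j; rewrite !mem_cat => /orP[si|si] /orP[sj|sj].
  + exact: cs.
  + have /and3P[_ im _] := rs _ si; have /and3P[mj _ _] := rs' _ sj.
    by rewrite /comparable2 (le2_trans im mj).
  + have /and3P[_ jm _] := rs _ sj; have /and3P[mi _ _] := rs' _ si.
    by rewrite /comparable2 (le2_trans jm mi) orbT.
  + exact: cs'.
Qed.

Lemma last_passage_superadd p m q (y : R) : le2 p m -> le2 m q ->
  last_passage x w p q = y%:E ->
  (last_passage x w p m + last_passage x w m q <= y%:E)%E.
Proof.
move=> pm mq ly; have pq := le2_trans pm mq.
have key s s' : chain_in p m s -> chain_in m q s' ->
    \sum_(i <- s) w i + \sum_(i <- s') w i <= y.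
  move=> cs cs'; have := last_passage_ge pq (chain_in_cat pm mq cs cs').
  by rewrite ly big_cat lee_fin.
have h1 s' : chain_in m q s' ->
    (last_passage x w p m <= (y - \sum_(i <- s') w i)%:E)%E.
  move=> cs'; apply: last_passage_le => s cs; rewrite lee_fin.
  by rewrite lerBrDr; exact: key.
have l0 := last_passage_ge0 pm.
have [a la] : exists a, last_passage x w p m = a%:E.
  have := h1 _ (chain_in_nil _ _); move: l0.
  by case: (last_passage x w p m) => [a _ _|//|//]; exists a.
rewrite la -leeBrDl//; apply: last_passage_le => s' /h1.
by rewrite la -EFinB !lee_fin => h; rewrite lerBrDl -lerBrDr.
Qed.

Lemma last_passage_le_total p q (I : set nat) : finite_set I ->
  (forall i, in_rect p q (x i) -> I i) ->
  (last_passage x w p q <= (\sum_(i <- fset_set I) w i)%:E)%E.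
Proof.
move=> fI hI; apply: last_passage_le => s [us rs _]; rewrite lee_fin.
rewrite [leRHS](bigID (mem s)) /= -[X in _ <= X + _]big_filter.
rewrite [X in _ <= X + _](perm_big s) ?lerDl ?sumr_ge0//=.
apply: uniq_perm => //; first by rewrite filter_uniq ?fset_uniq.
move=> i; rewrite mem_filter /= andb_idr// => /rs/hI h.
by rewrite in_fset_set ?mem_set.
Qed.

End chains.

(** * Splitting a chain at the antidiagonal *)

Section midline.
Context {R : realType}.
Variables (x : nat -> R * R) (w : nat -> R).
Hypothesis w_ge0 : forall i, 0 <= w i.

(** The chain crosses the antidiagonal at [(t, r - t)]: this point dominates the points with
    coordinate sum at most [r] and is dominated by the others. Rounding [t] down to an integer
    leaves finitely many pairs of rectangles. The margin of 1 on each side absorbs the rounding and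
    keeps all sides positive, and the two rectangles of a pair have the same area. *)
Lemma last_passage_split (r y : R) : 0 <= r ->
  (forall k : nat, k%:R <= r ->
    (last_passage x w (0, 0)%R (k%:R + 1, r - k%:R + 1)%R +
     last_passage x w (k%:R - 1, r - k%:R - 1)%R (r, r) <= y%:E)%E) ->
  (last_passage x w (0, 0)%R (r, r) <= y%:E)%E.
Proof.
move=> r0 H; apply: last_passage_le => s [us rs cs].
pose low i := (x i).1 + (x i).2 <= r.
pose t := Num.max (\big[Num.max/0]_(i <- s | low i) (x i).1)
                  (\big[Num.max/0]_(i <- s | ~~ low i) (r - (x i).2)).
have t0 : 0 <= t by rewrite /t le_max bigmax_ge_id.
have tle u : 0 <= u -> {in s, forall i, low i -> (x i).1 <= u} ->
    {in s, forall i, ~~ low i -> r - (x i).2 <= u} -> t <= u.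
  move=> u0 h1 h2; rewrite /t ge_max; apply/andP.
  by split; rewrite big_seq_cond; apply: bigmax_le => // i /andP[]; [exact: h1|exact: h2].
have box i : i \in s -> [/\ 0 <= (x i).1, 0 <= (x i).2, (x i).1 <= r & (x i).2 <= r].
  by move=> /rs /and3P[/andP[/= -> ->] /andP[/= -> ->]].
have lt1 i : i \in s -> low i -> (x i).1 <= t.
  by move=> si li; rewrite /t le_max (le_bigmax_seq 0 i low (fun i => (x i).1) si).
have lt2 i : i \in s -> ~~ low i -> r - (x i).2 <= t.
  by move=> si li; rewrite /t le_max (le_bigmax_seq 0 i (fun i => ~~ low i) (fun i => r - (x i).2) si) ?orbT.
have up1 i : i \in s -> low i -> t <= r - (x i).2.
  move=> si li; have [a b c e] := box _ si; have := li; rewrite /low => li'.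
  apply: tle => [|j sj|j sj]; first lra.
    have := cs _ _ si sj; rewrite /comparable2 /le2 /low.
    by move=> /orP[/andP[]|/andP[]]; lra.
  have := cs _ _ si sj; rewrite /comparable2 /le2 /low -ltNge.
  by move=> /orP[/andP[]|/andP[]]; lra.
have up2 i : i \in s -> ~~ low i -> t <= (x i).1.
  move=> si li; have [a b c e] := box _ si; have := li; rewrite /low -ltNge => li'.
  apply: tle => [//|j sj|j sj].
    have := cs _ _ si sj; rewrite /comparable2 /le2 /low.
    by move=> /orP[/andP[]|/andP[]]; lra.
  have := cs _ _ si sj; rewrite /comparable2 /le2 /low -ltNge.
  by move=> /orP[/andP[]|/andP[]]; lra.
have tr : t <= r.
  apply: tle => // i si _; by have [a b c e] := box _ si; lra.
have /andP[k1 k2] := truncn_itv t0; set k := Num.truncn t in k1 k2.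
rewrite -natr1 in k2.
have kr : k%:R <= r by exact: le_trans tr.
have k0 : 0 <= k%:R :> R by [].
apply: le_trans (H k kr); rewrite (bigID low) /= EFinD; apply: leeD.
  rewrite -big_filter; apply: last_passage_ge => //.
    by rewrite /le2 /=; apply/andP; split; lra.
  split; first by rewrite filter_uniq.
    move=> i; rewrite mem_filter => /andP[li si]; have /and3P[h1 h2 h3] := rs _ si.
    apply/and3P; split => //; have := lt1 _ si li; have := up1 _ si li.
    by rewrite /le2 /= => ? ?; apply/andP; split; lra.
  by move=> i j; rewrite !mem_filter => /andP[_ si] /andP[_ sj]; exact: cs.
rewrite -big_filter; apply: last_passage_ge => //.
  by rewrite /le2 /=; apply/andP; split; lra.
split; first by rewrite filter_uniq.
  move=> i; rewrite mem_filter => /andP[li si]; have /and3P[h1 h2 h3] := rs _ si.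
  have ht := lt2 _ si li; have ht' := up2 _ si li.
  apply/and3P; split => //.
    by rewrite /le2 /=; apply/andP; split; lra.
  apply: contraNneq li => xi; rewrite /low xi /=; lra.
by move=> i j; rewrite !mem_filter => /andP[_ si] /andP[_ sj]; exact: cs.
Qed.

End midline.

(** * Comparison of the passage time with a grid *)

Lemma grid_index {R : realType} (a u : R) (n : nat) : 0 < u -> u <= n%:R * a ->
  exists i : 'I_n, i%:R * a < u <= i.+1%:R * a.
Proof.
move=> u0 un; pose Q m := u <= m%:R * a.
have exQ : exists m, Q m by exists n.
case: (ex_minnP exQ) => -[|m] Qm minm; first by move: Qm; rewrite /Q mul0r leNgt u0.
have mn : (m < n)%N by exact: minm.
exists (Ordinal mn); apply/andP; split; last exact: Qm.
rewrite ltNge; apply/negP => /= /minm.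
by rewrite ltnn.
Qed.

Lemma grid_index_mono {R : realType} (a u v : R) (i j : nat) : 0 < a ->
  i%:R * a < u -> v <= j.+1%:R * a -> u <= v -> (i <= j)%N.
Proof.
move=> a0 iu vj uv; have : i%:R * a < j.+1%:R * a by lra.
by rewrite ltr_pM2r// ltr_nat ltnS.
Qed.

Section grid_cells.
Context {R : realType}.
Variables (p q : R * R) (n : nat).
Hypothesis pq1 : p.1 < q.1.
Hypothesis pq2 : p.2 < q.2.
Hypothesis n_gt0 : (0 < n)%N.
Local Notation cell := ('I_n * 'I_n)%type.
Let a := (q.1 - p.1) / n%:R.
Let b := (q.2 - p.2) / n%:R.

Definition grid_cell (c : cell) : set (R * R) :=
  `]p.1 + c.1%:R * a, p.1 + c.1.+1%:R * a] `*`
  `]p.2 + c.2%:R * b, p.2 + c.2.+1%:R * b].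

Let nR : 0 < n%:R :> R. Proof. by rewrite ltr0n. Qed.
Let a_gt0 : 0 < a. Proof. by rewrite divr_gt0// subr_gt0. Qed.
Let b_gt0 : 0 < b. Proof. by rewrite divr_gt0// subr_gt0. Qed.

Lemma grid_cellP c z : grid_cell c z <->
  (c.1%:R * a < z.1 - p.1 <= c.1.+1%:R * a) /\
  (c.2%:R * b < z.2 - p.2 <= c.2.+1%:R * b).
Proof. by rewrite /grid_cell /= !in_itv /= !ltrBrDl !lerBlDl. Qed.

Lemma grid_cell_disjoint c c' z : grid_cell c z -> grid_cell c' z -> c = c'.
Proof.
move=> /grid_cellP[/andP[h1 h2] /andP[h3 h4]] /grid_cellP[/andP[g1 g2] /andP[g3 g4]].
rewrite [c]surjective_pairing [c']surjective_pairing.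
congr pair; apply: val_inj; apply/eqP; rewrite eqn_leq; apply/andP; split.
- exact: (grid_index_mono a_gt0 h1 g2 (lexx _)).
- exact: (grid_index_mono a_gt0 g1 h2 (lexx _)).
- exact: (grid_index_mono b_gt0 h3 g4 (lexx _)).
- exact: (grid_index_mono b_gt0 g3 h4 (lexx _)).
Qed.

Lemma grid_cell_exists z : p.1 < z.1 -> p.2 < z.2 -> le2 z q ->
  exists c, grid_cell c z.
Proof.
move=> pz1 pz2 /andP[zq1 zq2].
have [||i hi] := @grid_index R a (z.1 - p.1) n; first by rewrite subr_gt0.
  by rewrite /a mulrC divfK ?gt_eqF// lerB.
have [||j hj] := @grid_index R b (z.2 - p.2) n; first by rewrite subr_gt0.
  by rewrite /b mulrC divfK ?gt_eqF// lerB.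
by exists (i, j); apply/grid_cellP.
Qed.

Lemma grid_cell_in_rect c z : grid_cell c z -> in_rect p q z.
Proof.
move=> /grid_cellP[/andP[h1 h2] /andP[h3 h4]].
have c1 : 0 <= c.1%:R * a by rewrite mulr_ge0// ltW.
have c2 : 0 <= c.2%:R * b by rewrite mulr_ge0// ltW.
have d1 : c.1.+1%:R * a <= q.1 - p.1.
  by rewrite /a mulrA ler_pdivrMr// mulrC ler_pM2l ?subr_gt0// ler_nat.
have d2 : c.2.+1%:R * b <= q.2 - p.2.
  by rewrite /b mulrA ler_pdivrMr// mulrC ler_pM2l ?subr_gt0// ler_nat.
apply/and3P; split; first by apply/andP; split; lra.
  by apply/andP; split; lra.
apply/eqP => zp; move: h1; rewrite zp; lra.
Qed.

Variables (x : nat -> R * R) (w : nat -> R) (S : cell -> R).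
Hypothesis w_ge0 : forall i, 0 <= w i.

(** Comparable points lie in comparable cells, so the cells visited by a chain of points form a
    chain of cells. *)
Lemma last_passage_le_grid :
  (forall i, in_rect p q (x i) -> p.1 < (x i).1 /\ p.2 < (x i).2) ->
  (forall s c, uniq s -> {in s, forall i, grid_cell c (x i)} ->
     \sum_(i <- s) w i <= S c) ->
  (last_passage x w p q <= (grid_lp S)%:E)%E.
Proof.
move=> inner hS; apply: last_passage_le => s [us rs cs]; rewrite lee_fin.
have /choice[cl clP] : forall i, exists c, i \in s -> grid_cell c (x i).
  move=> i; have [si|_] := boolP (i \in s); last first.
    by exists (Ordinal n_gt0, Ordinal n_gt0).
  have ri := rs _ si; have [h1 h2] := inner _ ri; have /and3P[_ iq _] := ri.
  by have [c ?] := grid_cell_exists h1 h2 iq; exists c.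
pose C : {set cell} := [set c | has (fun i => cl i == c) s]%SET.
have CC : chain_cells C.
  apply/'forall_implyP => c; rewrite inE => /hasP[i si /eqP <-].
  apply/'forall_implyP => c'; rewrite inE => /hasP[j sj /eqP <-].
  have /grid_cellP[/andP[h1 h2] /andP[h3 h4]] := clP _ si.
  have /grid_cellP[/andP[g1 g2] /andP[g3 g4]] := clP _ sj.
  have /orP[/andP[e1 e2]|/andP[e1 e2]] := cs _ _ si sj; apply/orP; [left|right];
    apply/andP; split.
  - by apply: (grid_index_mono a_gt0 h1 g2); rewrite lerD2r.
  - by apply: (grid_index_mono b_gt0 h3 g4); rewrite lerD2r.
  - by apply: (grid_index_mono a_gt0 g1 h2); rewrite lerD2r.
  - by apply: (grid_index_mono b_gt0 g3 h4); rewrite lerD2r.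
apply: le_trans (grid_lp_ge S CC).
rewrite big_seq_cond (partition_big cl (fun c => c \in C)) /=; last first.
  by move=> i /andP[si _]; rewrite inE; apply/hasP; exists i.
apply: ler_sum => c _; rewrite (_ : \sum_(i <- s | _) w i =
    \sum_(i <- [seq i <- s | cl i == c]) w i); last first.
  rewrite big_filter [RHS]big_seq_cond; apply: eq_bigl => i.
  by rewrite andbT.
apply: hS; first by rewrite filter_uniq.
by move=> i; rewrite mem_filter => /andP[/eqP <- si]; exact: clP.
Qed.

(** When the mesh is at most the gaps between distinct coordinates, points in one column or row of
    half-open cells share that coordinate. Points of comparable cells are then comparable, and a
    chain of cells carries a chain of points. *)
Lemma grid_le_last_passage (pts : seq nat) : uniq pts ->
  {in pts &, forall i j, (x i).1 < (x j).1 -> a <= (x j).1 - (x i).1} ->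
  {in pts &, forall i j, (x i).2 < (x j).2 -> b <= (x j).2 - (x i).2} ->
  (forall c, S c <= \sum_(i <- pts | `[< grid_cell c (x i) >]) w i) ->
  ((grid_lp S)%:E <= last_passage x w p q)%E.
Proof.
move=> upts gap1 gap2 hS.
have pq : le2 p q by apply/andP; split; exact: ltW.
have l0 := last_passage_ge0 x w pq.
have Hfin C : chain_cells C ->
    ((\sum_(c in C) S c)%:E <= last_passage x w p q)%E.
  move=> CC; pose inC i := [exists c in C, `[< grid_cell c (x i) >]].
  pose s := [seq i <- pts | inC i].
  apply: (@le_trans _ _ (\sum_(i <- s) w i)%:E).
    rewrite lee_fin; apply: (le_trans (ler_sum _ (fun c _ => hS c))).
    under eq_bigr do rewrite big_mkcond.
    rewrite exchange_big /= /s big_filter [leRHS]big_mkcond; apply: ler_sum => i _.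
    case: ifPn => [/exists_inP[c cC ci]|nex].
      rewrite (bigD1 c)//= ci big1 ?addr0// => c' /andP[_ c'c].
      case: asboolP => // ci'; move/asboolP: ci => ci.
      by rewrite (grid_cell_disjoint ci ci') eqxx in c'c.
    rewrite big1// => c cC; case: asboolP => // ci.
    by case/negP: nex; apply/exists_inP; exists c => //; apply/asboolP.
  apply: last_passage_ge => //; split; first by rewrite filter_uniq.
    move=> i; rewrite mem_filter => /andP[/exists_inP[c _ /asboolP ci] _].
    exact: grid_cell_in_rect ci.
  move=> i j; rewrite !mem_filter.
  move=> /andP[/exists_inP[c cC /asboolP ci] pi].
  move=> /andP[/exists_inP[c' cC' /asboolP cj] pj].
  have /grid_cellP[/andP[h1 h2] /andP[h3 h4]] := ci.
  have /grid_cellP[/andP[g1 g2] /andP[g3 g4]] := cj.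
  have mono (u e f : R) (k l : nat) : 0 < u -> e <= k.+1%:R * u -> l%:R * u < f ->
      (k <= l)%N -> e - f < u.
    move=> u0 ek lf kl; have : k%:R * u <= l%:R * u by rewrite ler_wpM2r ?ler_nat// ltW.
    by rewrite -natr1 mulrDl mul1r in ek; lra.
  have /'forall_implyP/(_ _ cC)/'forall_implyP/(_ _ cC') := CC.
  move=> /orP[/andP[k1 k2]|/andP[k1 k2]]; apply/orP; [left|right]; apply/andP; split.
  - have := mono _ _ _ _ _ a_gt0 h2 g1 k1; rewrite leNgt => m.
    by apply/negP => /(gap1 _ _ pj pi); lra.
  - have := mono _ _ _ _ _ b_gt0 h4 g3 k2; rewrite leNgt => m.
    by apply/negP => /(gap2 _ _ pj pi); lra.
  - have := mono _ _ _ _ _ a_gt0 g2 h1 k1; rewrite leNgt => m.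
    by apply/negP => /(gap1 _ _ pi pj); lra.
  - have := mono _ _ _ _ _ b_gt0 g4 h3 k2; rewrite leNgt => m.
    by apply/negP => /(gap2 _ _ pi pj); lra.
move: l0 Hfin; case: (last_passage x w p q) => [l l0 Hfin|_ _|//]; last by rewrite leey.
by rewrite lee_fin; apply: grid_lp_le => // C /Hfin.
Qed.

End grid_cells.

(** * Discretization *)

Section discretize.
Context {R : realType}.
Implicit Types (k : nat) (s : R).

(* The resolution [8^-k] beats the number [4^k] of cells; values above [2^k] are capped. *)
Definition disc k s : 'I_(16 ^ k).+1 := inord (minn (Num.truncn (8 ^+ k * s)) (16 ^ k)).

Definition disc_val k (t : 'I_(16 ^ k).+1) : R := t%:R / 8 ^+ k.

Lemma disc_val_ge0 k t : 0 <= @disc_val k t.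
Proof. by rewrite divr_ge0. Qed.

Lemma disc_val0 k : @disc_val k ord0 = 0.
Proof. by rewrite /disc_val mul0r. Qed.

Let discE k s : disc k s = minn (Num.truncn (8 ^+ k * s)) (16 ^ k) :> nat.
Proof. by rewrite inordK// ltnS geq_minr. Qed.

Lemma disc_val_le k s : 0 <= s -> disc_val (disc k s) <= s.
Proof.
move=> s0; rewrite /disc_val ler_pdivrMr ?exprn_gt0// discE [leRHS]mulrC.
apply: (@le_trans _ _ (Num.truncn (8 ^+ k * s))%:R); first by rewrite ler_nat geq_minl.
by rewrite truncn_le mulr_ge0.
Qed.

Lemma disc_val_ge k s : s <= 2 ^+ k -> s <= disc_val (disc k s) + (8 ^+ k)^-1.
Proof.
move=> s2; rewrite /disc_val -[X in _ + X]mul1r -mulrDl ler_pdivlMr ?exprn_gt0//.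
rewrite discE natr1 [leLHS]mulrC.
have [tM|Mt] := leqP (Num.truncn (8 ^+ k * s)) (16 ^ k).
  by apply: ltW; exact: truncnS_gt.
apply: (@le_trans _ _ (16 ^ k)%:R); last by rewrite ler_nat.
rewrite natrX (_ : 16%:R = 8 * 2 :> R); last by rewrite -natrM.
by rewrite exprMn ler_pM2l ?exprn_gt0.
Qed.

Lemma measurable_disc k t : measurable [set s | disc k s = t].
Proof.
have mlt m : measurable_fun setT (fun s : R => (m < disc k s)%N).
  rewrite (_ : (fun s => _) = fun s => (m < 16 ^ k)%N && (m.+1%:R <= 8 ^+ k * s)).
    apply: measurable_and; first exact: measurable_cst.
    apply: measurable_fun_ler; first exact: measurable_cst.
    exact: mulrl_measurable.
  by apply/funext => s; rewrite discE leq_min truncn_gt_nat andbC.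
rewrite (_ : [set s | _] =
    (fun s => ~~ (t < disc k s)%N && (((t : nat) == 0)%N || (t.-1 < disc k s)%N)) @^-1`
      [set true]).
  rewrite -[X in measurable X]setTI.
  have m : measurable_fun setT (fun s : R =>
      ~~ (t < disc k s)%N && (((t : nat) == 0)%N || (t.-1 < disc k s)%N)).
    apply: measurable_and; first exact: measurable_neg.
    by apply: measurable_or; first exact: measurable_cst.
  exact: m.
apply/seteqP; split => s /=.
  by move=> ->; rewrite ltnn; case: (nat_of_ord t) => [|m] //=; rewrite ltnSn.
rewrite -leqNgt => /andP[h1 h2]; apply: val_inj; apply/eqP; rewrite eqn_leq h1 /=.
by move: h2; case: (nat_of_ord t).
Qed.

End discretize.

(** * Measurability of the passage time *)

Section measurable_last_passage.
Context {d : measure_display} {Omega : measurableType d} {R : realType}.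
Variables (X : nat -> Omega -> R * R) (W : nat -> Omega -> R).
Hypothesis mX : forall i, measurable_fun setT (X i).
Hypothesis mW : forall i, measurable_fun setT (W i).
Variables (p q : R * R).

Let mX1 i : measurable_fun setT (fun w => (X i w).1).
Proof. exact: measurableT_comp (measurable_fst) (mX i). Qed.

Let mX2 i : measurable_fun setT (fun w => (X i w).2).
Proof. exact: measurableT_comp (measurable_snd) (mX i). Qed.

Let measurable_all (s : seq nat) (f : nat -> Omega -> bool) :
  (forall i, measurable_fun setT (f i)) -> measurable_fun setT (fun w => all (f^~ w) s).
Proof.
move=> mf; elim: s => [|i s IH] /=; first exact: measurable_cst.
exact: measurable_and.
Qed.

Let chainb (s : seq nat) (w : Omega) := [&& uniq s,
  all (fun i => in_rect p q (X i w)) s &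
  all (fun i => all (fun j => comparable2 (X i w) (X j w)) s) s].

Let chainbP s w : reflect (chain_in (fun i => X i w) p q s) (chainb s w).
Proof.
apply: (iffP and3P) => -[us rs cs]; split => //.
- exact/allP.
- by move=> i j si sj; have /allP/(_ _ si)/allP/(_ _ sj) := cs.
- exact/allP.
- by apply/allP => i si; apply/allP => j sj; exact: cs.
Qed.

Let measurable_chainb s : measurable_fun setT (chainb s).
Proof.
apply: measurable_and; first exact: measurable_cst.
apply: measurable_and; apply: measurable_all => i.
  rewrite (_ : (fun w => _) = (fun w => [&& (p.1 <= (X i w).1) && (p.2 <= (X i w).2),
     ((X i w).1 <= q.1) && ((X i w).2 <= q.2) &
     (p.1 < (X i w).1) || (p.2 < (X i w).2)])).
    apply: measurable_and.
      by apply: measurable_and; apply: measurable_fun_ler => //; exact: measurable_cst.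
    apply: measurable_and.
      by apply: measurable_and; apply: measurable_fun_ler => //; exact: measurable_cst.
    by apply: measurable_or; apply: measurable_fun_ltr => //; exact: measurable_cst.
  apply/funext => w; rewrite /in_rect /le2.
  have [/andP[h1 h2]/=|//] := boolP ((p.1 <= (X i w).1) && (p.2 <= (X i w).2)).
  congr (_ && _); rewrite !lt_neqAle h1 h2 !andbT.
  case: (X i w) p => [a b] [a' b'] /=; rewrite -negb_and; congr (~~ _).
  by apply/eqP/andP => [[-> ->]|[/eqP -> /eqP ->]].
apply: measurable_all => j; rewrite /comparable2 /le2.
by apply: measurable_or; apply: measurable_and; exact: measurable_fun_ler.
Qed.

(** In terms of chains the supremum runs over lists of indices, a countable set. Codes of no list
    and lists that are no chain contribute 0, which is harmless since the passage time is
    nonnegative. *)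
Lemma measurable_last_passage : le2 p q ->
  measurable_fun setT (fun w => last_passage (X^~ w) (W^~ w) p q).
Proof.
move=> pq.
pose sq (n : nat) : seq nat := odflt [::] (choice.unpickle n).
pose g n w : \bar R := if chainb (sq n) w then (\sum_(i <- sq n) W i w)%:E else 0%E.
have mg n : measurable_fun setT (g n).
  apply: measurable_fun_ifT; [exact: measurable_chainb| |exact: measurable_cst].
  by apply/measurable_EFinP; apply: measurable_sum => i; exact: mW.
rewrite (_ : (fun w => _) = fun w => esups (g^~ w) 0%N); first exact: measurable_fun_esups.
apply/funext => w; apply/eqP; rewrite eq_le; apply/andP; split.
  apply: last_passage_le => s cs; apply: ereal_sup_ubound; exists (choice.pickle s) => //.
  by rewrite /g /sq choice.pickleK /=; case: chainbP.
apply: ge_ereal_sup => _ [n _ <-]; rewrite /g; case: chainbP => [cs|_].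
  exact: last_passage_ge.
exact: last_passage_ge0.
Qed.

End measurable_last_passage.

Lemma measurable_finite_range {d} {Omega : measurableType d} {R : realType}
    {U : finType} (u : Omega -> U) (g : U -> R) :
  (forall x, measurable [set w | u w = x]) -> measurable_fun setT (fun w => g (u w)).
Proof.
move=> mu; rewrite (_ : (fun w => g (u w)) = fun w =>
    \sum_x g x * \1_[set w | u w = x] w); last first.
  apply/funext => w; rewrite (bigD1 (u w))//= indicE mem_set// mulr1.
  by rewrite big1 ?addr0// => x xu; rewrite indicE memNset ?mulr0// => /= e;
    rewrite e eqxx in xu.
apply: measurable_sum => x; apply: measurable_funM; first exact: measurable_cst.
exact: measurable_indic.
Qed.

Lemma integral_finite_range {d} {Omega : measurableType d} {R : realType}
    (P : probability Omega R) {U : finType} (u : Omega -> U) (g : U -> R) :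
  (forall x, measurable [set w | u w = x]) -> (forall x, 0 <= g x) ->
  (\int[P]_w (g (u w))%:E = \sum_x (g x)%:E * P [set w | u w = x])%E.
Proof.
move=> mu g0.
rewrite (_ : (fun w => (g (u w))%:E) = fun w =>
    (\sum_x (g x)%:E * (\1_[set w | u w = x] w)%:E)%E); last first.
  apply/funext => w; rewrite (bigD1 (u w))//= indicE mem_set// mule1.
  by rewrite big1 ?adde0// => x xu; rewrite indicE memNset ?mule0// => /= e;
    rewrite e eqxx in xu.
rewrite ge0_integral_sum//; last 2 first.
- move=> x; apply: emeasurable_funM; first exact: measurable_cst.
  by apply/measurable_EFinP; exact: measurable_indic.
- by move=> x w _; rewrite mule_ge0// lee_fin.
apply: eq_bigr => x _; rewrite ge0_integralZl//; last 2 first.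
- by apply/measurable_EFinP; exact: measurable_indic.
- by rewrite lee_fin.
by rewrite integral_indic// setIT.
Qed.

Lemma lebesgue_measure2X {R : realType} (A B : set R) : measurable A -> measurable B ->
  lebesgue_measure2 (A `*` B) = (lebesgue_measure A * lebesgue_measure B)%E.
Proof. by move=> mA mB; rewrite /lebesgue_measure2 product_measure1E. Qed.

Section areas.
Context {R : realType}.
Variables (p q : R * R).
Hypothesis pq1 : p.1 < q.1.
Hypothesis pq2 : p.2 < q.2.

Definition area : R := (q.1 - p.1) * (q.2 - p.2).

Lemma area_gt0 : 0 < area.
Proof. by rewrite mulr_gt0// subr_gt0. Qed.

Lemma lebesgue_measure2_grid_cell n (c : 'I_n * 'I_n) :
  lebesgue_measure2 (grid_cell p q c) = (area / n%:R ^+ 2)%:E.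
Proof.
have n0 : (0 < n)%N by case: c => [[i ni] _]; exact: leq_ltn_trans ni.
have nR : 0 < n%:R :> R by rewrite ltr0n.
rewrite /grid_cell lebesgue_measure2X//; try exact: measurable_itv.
rewrite !lebesgue_measure_itv /= !lte_fin !ltrD2l !ltr_pM2r ?divr_gt0 ?subr_gt0//.
rewrite !ltr_nat !ltnSn -!EFinB -EFinM; congr EFin.
by rewrite /area -!natr1; field; rewrite gt_eqF.
Qed.

Lemma measurable_grid_cell n (c : 'I_n * 'I_n) : measurable (grid_cell p q c).
Proof. by apply: measurableX; exact: measurable_itv. Qed.

Definition box : set (R * R) := `[p.1, q.1] `*` `[p.2, q.2].

Lemma measurable_box : measurable box.
Proof. by apply: measurableX; exact: measurable_itv. Qed.

Lemma lebesgue_measure2_box : lebesgue_measure2 box = area%:E.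
Proof.
rewrite /box lebesgue_measure2X//; try exact: measurable_itv.
by rewrite !lebesgue_measure_itv /= !lte_fin pq1 pq2 -!EFinB -EFinM.
Qed.

Lemma boxP z : box z <-> le2 p z && le2 z q.
Proof.
rewrite /box /le2 /= !in_itv /=; split.
  by move=> [/andP[-> ->] /andP[-> ->]].
by move=> /andP[/andP[-> ->] /andP[-> ->]].
Qed.

Definition box_boundary : set (R * R) :=
  ([set p.1] `*` `[p.2, q.2]) `|` (`[p.1, q.1] `*` [set p.2]).

Lemma measurable_box_boundary : measurable box_boundary.
Proof.
by apply: measurableU; apply: measurableX => //; exact: measurable_itv.
Qed.

Lemma lebesgue_measure2_box_boundary : lebesgue_measure2 box_boundary = 0%E.
Proof.
apply/eqP; rewrite eq_le measure_ge0 andbT /box_boundary.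
apply: (le_trans (measureU2 _ _ _)).
- by apply: measurableX => //; exact: measurable_itv.
- by apply: measurableX => //; exact: measurable_itv.
set A := `[p.1, q.1]%classic; set B := `[p.2, q.2]%classic.
change (lebesgue_measure2 ([set p.1] `*` B) + lebesgue_measure2 (A `*` [set p.2]) <= 0)%E.
rewrite !lebesgue_measure2X//; try exact: measurable_itv.
by rewrite !lebesgue_measure_set1 mul0e mule0 adde0.
Qed.

End areas.

Section ae_points.
Context {d : measure_display} {Omega : measurableType d} {R : realType}.
Variable P : probability Omega R.
Variable X : nat -> Omega -> R * R.
Hypothesis mX : forall i, measurable_fun setT (X i).
Hypothesis poisX : unit_poisson_process P X.

Lemma ae_no_points A : measurable A -> lebesgue_measure2 A = 0%E ->
  {ae P, forall w, forall i, ~ A (X i w)}.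
Proof.
move=> mA A0.
pose Z : set Omega := point_count X A @^-1` [set 0%:R%:E].
have mZ : measurable Z.
  by rewrite -[X in measurable X]setTI; apply: measurable_point_count.
have PZ : P Z = 1%E.
  rewrite [LHS](poisX.1 A mA _ 0%N) ?A0//.
  (* At rate 0 the law [poisson_prob] is the Dirac mass at 0. *)
  by rewrite /poisson_prob ltxx diracE mem_set.
exists (~` Z); split; first exact: measurableC.
  by rewrite probability_setC// PZ subee.
move=> w /= H Zw; apply: H => i Ai; move: Zw; rewrite /Z /= /point_count /counting.
case: asboolP => [fA|_ //] [] /eqP; rewrite pnatr_eq0 cardfs_eq0 => /eqP/fsetP/(_ i).
by rewrite in_fset_set// mem_set// finmap.in_fset0.
Qed.

End ae_points.

(** * Law and exponential moment of one cell *)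

Section moments.
Context {d : measure_display} {Omega : measurableType d} {R : realType}.
Variable P : probability Omega R.
Variables (X : nat -> Omega -> R * R) (W : nat -> Omega -> R).
Hypothesis mX : forall i, measurable_fun setT (X i).
Hypothesis mW : forall i, measurable_fun setT (W i).
Hypothesis W_ge0 : forall i w, 0 <= W i w.
Hypothesis poisX : unit_poisson_process P X.
Hypothesis indW : mutually_independent P W.
Hypothesis lawW : forall i A, measurable A -> P (W i @^-1` A) = P (W 0%N @^-1` A).
Hypothesis indXW : independent_families P X W.
Variables (a phi : R).
Hypothesis a_gt0 : 0 < a.
Hypothesis phiE : (\int[P]_w (expR (a * W 0%N w))%:E = phi%:E)%E.

Lemma measurable_cell_weight A : measurable A -> measurable_fun setT (cell_weight X W A).
Proof.
move=> mA; rewrite (_ : cell_weight X W A =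
  fun w => (\sum_(i <oo) (\1_A (X i w) * W i w)%:E)%E); last first.
  by apply/funext => w; exact: cell_weightE.
apply: ge0_emeasurable_sum => [i z _ _|i _]; first by rewrite lee_fin mulr_ge0.
apply/measurable_EFinP; apply: measurable_funM => //.
by apply: measurableT_comp.
Qed.

Lemma cell_weight_ge0 A w : 0 <= fine (cell_weight X W A w).
Proof. by apply/fine_ge0/esum_ge0 => i _; rewrite lee_fin. Qed.

Lemma prob_cell_weight A (B : set R) : measurable A -> (lebesgue_measure2 A < +oo)%E ->
  measurable B ->
  P [set w | B (fine (cell_weight X W A w))] =
  poisson_mix (fine (lebesgue_measure2 A)) (fun k => conv_prob P W k B 0).
Proof.
move=> mA fA mB.
have := @prob_cell_weights _ _ _ P X W mX mW W_ge0 poisX indW lawW indXW unit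
  (fun=> A) (fun=> mA) (fun=> fA) _ (fun=> B) (fun=> mB).
rewrite big_const card_unit /= mule1 => <-; last by move=> [] [].
by congr (P _); apply/seteqP; split => w /=; [move=> ? []|move=> /(_ tt)].
Qed.

(** The law of the rounded weight of a cell of area [al]. *)
Definition cell_pmf (k : nat) (al : R) (t : 'I_(16 ^ k).+1) : R :=
  fine (poisson_mix al (fun j => conv_prob P W j [set s | disc k s = t] 0)).

Section pmf.
Variables (A : set (R * R)) (k : nat).
Hypothesis mA : measurable A.
Hypothesis fA : (lebesgue_measure2 A < +oo)%E.
Let al := fine (lebesgue_measure2 A).
Let D w := disc k (fine (cell_weight X W A w)).

Lemma measurable_disc_cell t : measurable [set w | D w = t].
Proof.
have mf : measurable_fun setT (fun w => fine (cell_weight X W A w)).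
  by apply: measurableT_comp; [exact: fine_measurable|exact: measurable_cell_weight].
by have := mf measurableT _ (@measurable_disc R k t); rewrite setTI.
Qed.

Lemma cell_pmfE t : P [set w | D w = t] = (cell_pmf al t)%:E.
Proof.
have E := prob_cell_weight mA fA (@measurable_disc R k t).
by rewrite /cell_pmf -E fineK// fin_num_measure//; exact: measurable_disc_cell.
Qed.

Lemma cell_pmf_ge0 t : 0 <= @cell_pmf k al t.
Proof. by rewrite -lee_fin -cell_pmfE measure_ge0. Qed.

Let int_disc (g : _ -> R) : (forall t, 0 <= g t) ->
  (\int[P]_w (g (D w))%:E = (\sum_t cell_pmf al t * g t)%:E)%E.
Proof.
move=> g0; rewrite (integral_finite_range P measurable_disc_cell g0) -sumEFin.
by apply: eq_bigr => t _; rewrite cell_pmfE -EFinM mulrC.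
Qed.

Lemma cell_pmf_sum : \sum_t @cell_pmf k al t = 1.
Proof.
have := int_disc (fun=> ler01 : 0 <= 1 :> R).
rewrite integral_prob_cst => -[e]; rewrite [RHS]e.
by apply: eq_bigr => t _; rewrite mulr1.
Qed.

Lemma cell_pmf_mgf : 0 < al ->
  \sum_t @cell_pmf k al t * expR (a * disc_val t) <= expR (al * (phi - 1)).
Proof.
move=> al0; rewrite -lee_fin -int_disc => [|t]; last exact: expR_ge0.
rewrite -(mgf_cell_weight mX mW W_ge0 poisX indW lawW indXW mA (ltW a_gt0) fA al0 phiE).
apply: ge0_le_integral => //.
- apply/measurable_EFinP; apply: (@measurable_finite_range _ _ _ _ D
    (fun t => expR (a * disc_val t))) => t; exact: measurable_disc_cell.
- apply/measurable_EFinP; apply: measurableT_comp => //; apply: measurable_funM.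
    exact: measurable_cst.
  by apply: measurableT_comp; [exact: fine_measurable|exact: measurable_cell_weight].
- move=> w _; rewrite lee_fin ler_expR ler_pM2l//.
  by apply: disc_val_le; exact: cell_weight_ge0.
Qed.

End pmf.
End moments.

Lemma grid_lp_addc {R : realType} n (s : 'I_n * 'I_n -> R) (e : R) : 0 <= e ->
  grid_lp (fun c => s c + e) <= grid_lp s + (n * n)%:R * e.
Proof.
move=> e0; apply: grid_lp_le => [|C CC]; first by rewrite addr_ge0 ?grid_lp_ge0 ?mulr_ge0.
rewrite big_split /= lerD ?grid_lp_ge// sumr_const -[leLHS]mulr_natl ler_wpM2r//.
by rewrite ler_nat (leq_trans (max_card _))// card_prod card_ord.
Qed.

Lemma pow2_large {R : realType} (c e : R) : 0 < e ->
  exists N, forall k, (N <= k)%N -> c / (2 ^ k)%:R <= e.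
Proof.
move=> e0; exists (Num.truncn (c / e)) => k Nk.
rewrite ler_pdivrMr ?ltr0n ?expn_gt0// mulrC -ler_pdivrMr//.
apply: (@le_trans _ _ (Num.truncn (c / e)).+1%:R); first exact/ltW/truncnS_gt.
by rewrite ler_nat (leq_ltn_trans Nk)// ltn_expl.
Qed.

Lemma finite_gap {R : realType} (h : nat -> R) (s : seq nat) :
  exists2 e : R, 0 < e & {in s &, forall i j, h i < h j -> e <= h j - h i}.
Proof.
suff [e e0 H] : exists2 e : R, 0 < e &
    {in [seq (i, j) | i <- s, j <- s], forall u, h u.1 < h u.2 -> e <= h u.2 - h u.1}.
  exists e => // i j si sj; apply: (H (i, j)).
  by apply/allpairsP; exists (i, j).
elim: [seq _ | _ <- _, _ <- _] => [|u l [e e0 He]]; first by exists 1.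
have [hu|hu] := ltP (h u.1) (h u.2).
  exists (Num.min e (h u.2 - h u.1)); first by rewrite lt_min e0 subr_gt0.
  move=> v; rewrite inE => /orP[/eqP -> _|vl hv]; first by rewrite ge_min lexx orbT.
  by rewrite ge_min He.
exists e => // v; rewrite inE => /orP[/eqP ->|]; last exact: He.
by rewrite ltNge hu.
Qed.

(** * Grid approximation in a rectangle *)

Section rectangle.
Context {d : measure_display} {Omega : measurableType d} {R : realType}.
Variable P : probability Omega R.
Variables (X : nat -> Omega -> R * R) (W : nat -> Omega -> R).
Hypothesis mX : forall i, measurable_fun setT (X i).
Hypothesis mW : forall i, measurable_fun setT (W i).
Hypothesis W_ge0 : forall i w, 0 <= W i w.
Hypothesis poisX : unit_poisson_process P X.
Variables (p q : R * R).
Hypothesis pq1 : p.1 < q.1.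
Hypothesis pq2 : p.2 < q.2.

(* Boundary points count for the passage time but lie in no (half-open) grid cell. *)
Definition good (w : Omega) : Prop :=
  finite_set [set i | box p q (X i w)] /\ forall i, ~ box_boundary p q (X i w).

Lemma ae_good : {ae P, forall w, good w}.
Proof.
have h1 : {ae P, forall w, finite_set [set i | box p q (X i w)]}.
  apply: ae_finite_points => //; first exact: measurable_box.
  by rewrite lebesgue_measure2_box// ltry.
have h2 : {ae P, forall w, forall i, ~ box_boundary p q (X i w)}.
  apply: ae_no_points => //; first exact: measurable_box_boundary.
  exact: lebesgue_measure2_box_boundary.
by apply: filterS2 h1 h2 => w; split.
Qed.

Definition rect_passage (w : Omega) : \bar R := last_passage (X^~ w) (W^~ w) p q.

Let pts w : seq nat := fset_set [set i | box p q (X i w)].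

Let le2pq : le2 p q.
Proof. by apply/andP; split; apply: ltW. Qed.

Let good_inner w i : good w -> in_rect p q (X i w) ->
  p.1 < (X i w).1 /\ p.2 < (X i w).2.
Proof.
move=> [_ nb] /and3P[/andP[h1 h2] /andP[h3 h4] _]; have := nb i.
rewrite !lt_neqAle h1 h2 !andbT => nbi; split; apply/eqP => e; apply: nbi.
  by left; split => //=; rewrite in_itv /= h2.
by right; split => //=; rewrite in_itv /= h1.
Qed.

Lemma rect_passage_fin w : good w ->
  rect_passage w = (fine (rect_passage w))%:E.
Proof.
move=> [fI _]; have H := @last_passage_le_total R (X^~ w) (W^~ w) (fun i => W_ge0 i w) p q _ fI.
have l0 := @last_passage_ge0 R (X^~ w) (W^~ w) p q le2pq.
rewrite fineK//; apply/fin_numP; split.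
  by apply/eqP => e; move: l0; rewrite -/(rect_passage w) e.
apply/eqP => e; move: H; rewrite -/(rect_passage w) e leye_eq => /(_ _)/eqP H.
suff : +oo%E = (\sum_(i <- pts w) W i w)%:E by [].
by rewrite H// => i /and3P[h1 h2 _]; apply/boxP; rewrite h1 h2.
Qed.

Lemma cell_weight_finite A w : finite_set [set i | A (X i w)] ->
  cell_weight X W A w = (\sum_(i <- fset_set [set i | A (X i w)]) W i w)%:E.
Proof.
move=> fA; rewrite /cell_weight esum_fset//; last by move=> i _; rewrite lee_fin.
by rewrite fsbig_finite//= sumEFin.
Qed.

Section grid.
Variable n : nat.
Hypothesis n_gt0 : (0 < n)%N.
Let S w (c : 'I_n * 'I_n) := fine (cell_weight X W (grid_cell p q c) w).

Let cell_box c z : @grid_cell R p q n c z -> box p q z.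
Proof.
move=> /(grid_cell_in_rect pq1 pq2 n_gt0)/and3P[h1 h2 _]; apply/boxP.
by rewrite h1 h2.
Qed.

Lemma cell_sumE w c : good w ->
  S w c = \sum_(i <- pts w | `[< grid_cell p q c (X i w) >]) W i w.
Proof.
move=> [fI _]; have sub : [set i | grid_cell p q c (X i w)] `<=` [set i | box p q (X i w)].
  by move=> i; exact: cell_box.
have fc := sub_finite_set sub fI.
rewrite /S cell_weight_finite//= -[RHS]big_filter; apply: perm_big.
apply: uniq_perm; rewrite ?filter_uniq ?fset_uniq// => i.
rewrite mem_filter !in_fset_set//; apply/idP/andP => [/set_mem h|[/asboolP h _]].
  by split; [exact/asboolP|apply/mem_set/sub].
exact/mem_set.
Qed.

Lemma grid_lp_le_total w : good w ->
  grid_lp (S w) <= fine (cell_weight X W (box p q) w).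
Proof.
move=> gw; have [fI _] := gw.
have -> : fine (cell_weight X W (box p q) w) = \sum_(i <- pts w) W i w.
  by rewrite cell_weight_finite.
apply: grid_lp_le => [|C _]; first exact: sumr_ge0.
under eq_bigr do rewrite (cell_sumE _ gw) big_mkcond.
rewrite exchange_big /=; apply: ler_sum => i _.
have [[c0 [c0C h0]]|nex] := pselect (exists c, c \in C /\ grid_cell p q c (X i w)).
  rewrite (bigD1 c0)//= big1 ?addr0; first by case: ifP.
  move=> c /andP[_ cc0]; case: asboolP => // hc.
  by rewrite (grid_cell_disjoint pq1 pq2 n_gt0 hc h0) eqxx in cc0.
rewrite big1// => c cC; case: asboolP => // hc.
by exfalso; apply: nex; exists c.
Qed.

Lemma le_rect_passage_grid w (T : 'I_n * 'I_n -> R) : good w ->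
  (forall c, S w c <= T c) -> fine (rect_passage w) <= grid_lp T.
Proof.
move=> gw ST; rewrite -lee_fin -rect_passage_fin//.
apply: last_passage_le_grid => //.
- by move=> i; exact: good_inner.
- move=> s c us sc; apply: le_trans (ST c); rewrite cell_sumE//.
  rewrite -[leRHS]big_filter [leRHS](bigID (mem s)) /= -[X in _ <= X + _]big_filter.
  rewrite [X in _ <= X + _](perm_big s) ?lerDl ?sumr_ge0//=.
  have [fI _] := gw; apply: uniq_perm => //; first by rewrite !filter_uniq ?fset_uniq.
  move=> i; rewrite !mem_filter /= andb_idr// => si; have := sc _ si => gi.
  rewrite in_fset_set//; apply/andP; split; first exact/asboolP.
  by apply/mem_set; exact: cell_box gi.
Qed.

Lemma grid_le_rect_passage w (e1 e2 : R) : good w ->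
  {in pts w &, forall i j, (X i w).1 < (X j w).1 -> e1 <= (X j w).1 - (X i w).1} ->
  {in pts w &, forall i j, (X i w).2 < (X j w).2 -> e2 <= (X j w).2 - (X i w).2} ->
  (q.1 - p.1) / n%:R <= e1 -> (q.2 - p.2) / n%:R <= e2 ->
  grid_lp (S w) <= fine (rect_passage w).
Proof.
move=> gw g1 g2 n1 n2; rewrite -lee_fin -rect_passage_fin//.
apply: (@grid_le_last_passage R p q n pq1 pq2 n_gt0 (X^~ w) (W^~ w) _ (pts w)) => //.
- exact: fset_uniq.
- by move=> i j si sj /(g1 _ _ si sj); exact: le_trans.
- by move=> i j si sj /(g2 _ _ si sj); exact: le_trans.
- by move=> c; rewrite -cell_sumE.
Qed.

End grid.

Definition cell_config k (w : Omega) : {ffun 'I_(2 ^ k) * 'I_(2 ^ k) -> 'I_(16 ^ k).+1} :=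
  [ffun c => disc k (fine (cell_weight X W (grid_cell p q c) w))].

Definition grid_passage k (w : Omega) : R := grid_value (@disc_val R k) (cell_config k w).

Lemma grid_passage_ge0 k w : 0 <= grid_passage k w.
Proof. exact: grid_lp_ge0. Qed.

Let grid_passage_le k w : grid_passage k w <=
  grid_lp (fun c : 'I_(2 ^ k) * 'I_(2 ^ k) => fine (cell_weight X W (grid_cell p q c) w)).
Proof.
apply: le_grid_lp => c; rewrite ffunE; apply: disc_val_le.
exact: cell_weight_ge0.
Qed.

(** Gives a majorant independent of [k] for dominated convergence. *)
Lemma grid_passage_le_total k w : good w ->
  grid_passage k w <= fine (cell_weight X W (box p q) w).
Proof.
move=> gw; apply: (le_trans (grid_passage_le k w)).
by apply: grid_lp_le_total => //; rewrite expn_gt0.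
Qed.

(** From [N] on the mesh is below the gaps of both coordinates and the total weight is below the cap
    [2 ^+ k]. What remains is the rounding: [4 ^+ k] cells with an error of [8 ^- k] each. *)
Lemma grid_passage_approx w : good w -> exists N, forall k, (N <= k)%N ->
  fine (rect_passage w) - (2 ^+ k)^-1 <= grid_passage k w <= fine (rect_passage w).
Proof.
move=> gw; have [e1 e10 g1] := finite_gap (fun i => (X i w).1) (pts w).
have [e2 e20 g2] := finite_gap (fun i => (X i w).2) (pts w).
have [N1 hN1] := pow2_large (q.1 - p.1) e10.
have [N2 hN2] := pow2_large (q.2 - p.2) e20.
have [N3 hN3] := pow2_large (fine (cell_weight X W (box p q) w)) (@ltr01 R).
exists (maxn N1 (maxn N2 N3)) => k; rewrite !geq_max => /and3P[k1 k2 k3].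
have k0 : (0 < 2 ^ k)%N by rewrite expn_gt0.
apply/andP; split; last first.
  apply: (le_trans (grid_passage_le k w)).
  by apply: (grid_le_rect_passage k0 gw g1 g2); [exact: hN1|exact: hN2].
rewrite lerBlDr.
apply: (@le_trans _ _ (grid_lp (fun c : 'I_(2 ^ k) * 'I_(2 ^ k) =>
   disc_val (cell_config k w c) + (8 ^+ k)^-1))).
  apply: le_rect_passage_grid => // c; rewrite ffunE; apply: disc_val_ge.
  apply: (@le_trans _ _ (fine (cell_weight X W (box p q) w))).
    rewrite cell_sumE// cell_weight_finite; last by case: gw.
    rewrite /= big_mkcond; apply: ler_sum => i _; by case: ifP.
  by have := hN3 _ k3; rewrite ler_pdivrMr ?ltr0n// mul1r natrX.
apply: (le_trans (grid_lp_addc _ _)); first by rewrite invr_ge0 exprn_ge0.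
rewrite lerD2l natrM natrX (_ : 8%:R = 2 * 2 * 2 :> R); last by rewrite -!natrM.
rewrite !exprMn le_eqVlt; apply/orP; left; apply/eqP; field.
by rewrite gt_eqF// exprn_gt0.
Qed.

End rectangle.

(** The argument is the area [A] and not the rectangle: two rectangles of equal area have the same
    approximating means, hence the same limit. *)
Definition grid_mean {d} {Omega : measurableType d} {R : realType}
    (P : probability Omega R) (W : nat -> Omega -> R) (A : R) (k : nat) : R :=
  fexp (@cell_pmf _ _ _ P W k (A / (2 ^ k)%:R ^+ 2))
       (@grid_value R _ (2 ^ k) (@disc_val R k)).

(** * Passage to the continuum limit *)

Section passage_law.
Context {d : measure_display} {Omega : measurableType d} {R : realType}.
Variable P : probability Omega R.
Variables (X : nat -> Omega -> R * R) (W : nat -> Omega -> R).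
Hypothesis mX : forall i, measurable_fun setT (X i).
Hypothesis mW : forall i, measurable_fun setT (W i).
Hypothesis W_ge0 : forall i w, 0 <= W i w.
Hypothesis poisX : unit_poisson_process P X.
Hypothesis indW : mutually_independent P W.
Hypothesis lawW : forall i A, measurable A -> P (W i @^-1` A) = P (W 0%N @^-1` A).
Hypothesis indXW : independent_families P X W.
Variables (a phi : R).
Hypothesis a_gt0 : 0 < a.
Hypothesis phiE : (\int[P]_w (expR (a * W 0%N w))%:E = phi%:E)%E.
Variables (p q : R * R).
Hypothesis pq1 : p.1 < q.1.
Hypothesis pq2 : p.2 < q.2.

Let al k : R := area p q / (2 ^ k)%:R ^+ 2.
Let pk k (t : 'I_(16 ^ k).+1) : R := cell_pmf P W (al k) t.
Arguments pk : clear implicits.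
Let n_gt0 k : (0 < 2 ^ k)%N. Proof. by rewrite expn_gt0. Qed.
Let nR k : 0 < (2 ^ k)%:R :> R. Proof. by rewrite ltr0n. Qed.
Let al_gt0 k : 0 < al k.
Proof. by rewrite divr_gt0 ?area_gt0// exprn_gt0. Qed.

Let alE k (c : 'I_(2 ^ k) * 'I_(2 ^ k)) :
  fine (lebesgue_measure2 (grid_cell p q c)) = al k.
Proof. by rewrite lebesgue_measure2_grid_cell. Qed.

Let fin_cell k (c : 'I_(2 ^ k) * 'I_(2 ^ k)) :
  (lebesgue_measure2 (grid_cell p q c) < +oo)%E.
Proof. by rewrite lebesgue_measure2_grid_cell// ltry. Qed.

Let c0 k : 'I_(2 ^ k) * 'I_(2 ^ k) := (Ordinal (n_gt0 k), Ordinal (n_gt0 k)).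

Let pk_ge0 k t : 0 <= pk k t.
Proof.
rewrite /pk -(alE (c0 k)).
by apply: (cell_pmf_ge0 mX mW W_ge0 poisX indW lawW indXW); first exact: measurable_grid_cell.
Qed.

Let pk_sum k : \sum_t pk k t = 1.
Proof.
rewrite /pk -(alE (c0 k)).
by apply: (cell_pmf_sum mX mW W_ge0 poisX indW lawW indXW); first exact: measurable_grid_cell.
Qed.

Let pk_mgf k : \sum_t pk k t * expR (a * disc_val t) <= expR (al k * (phi - 1)).
Proof.
rewrite /pk -(alE (c0 k)).
apply: (cell_pmf_mgf mX mW W_ge0 poisX indW lawW indXW a_gt0 phiE) => //.
  exact: measurable_grid_cell.
by rewrite alE.
Qed.

Let config_event k (x : {ffun 'I_(2 ^ k) * 'I_(2 ^ k) -> 'I_(16 ^ k).+1}) :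
  [set w | cell_config X W p q k w = x] =
  [set w | forall c, [set s | disc k s = x c] (fine (cell_weight X W (grid_cell p q c) w))].
Proof.
apply/seteqP; split => w /=; first by move=> <- c; rewrite ffunE.
by move=> h; apply/ffunP => c; rewrite ffunE h.
Qed.

Lemma measurable_cell_config k x : measurable [set w | cell_config X W p q k w = x].
Proof.
rewrite config_event.
apply: (@measurable_forall_preimage _ _ _ R _
  (fun c w => fine (cell_weight X W (grid_cell p q c) w)) (fun c => [set s | disc k s = x c])).
  move=> c; apply: measurableT_comp; first exact: fine_measurable.
  by apply: measurable_cell_weight => //; exact: measurable_grid_cell.
by move=> c; exact: measurable_disc.
Qed.

Lemma prob_cell_config k x :
  P [set w | cell_config X W p q k w = x] = (\prod_c pk k (x c))%:E.
Proof.
rewrite config_event.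
rewrite (@prob_cell_weights _ _ _ P X W mX mW W_ge0 poisX indW lawW indXW _
  (fun c : 'I_(2 ^ k) * 'I_(2 ^ k) => grid_cell p q c) _ _ _ (fun c => [set s | disc k s = x c])).
- rewrite -prodEFin; apply: eq_bigr => c _.
  have mg : measurable (grid_cell p q c) by exact: measurable_grid_cell.
  rewrite /pk -(alE c) -(cell_pmfE mX mW W_ge0 poisX indW lawW indXW mg (fin_cell c)).
  by rewrite (prob_cell_weight mX mW W_ge0 poisX indW lawW indXW mg (fin_cell c)
       (@measurable_disc R k (x c))).
- by move=> c; exact: measurable_grid_cell.
- by move=> c; exact: fin_cell.
- by move=> c c' z; exact: grid_cell_disjoint.
- by move=> c; exact: measurable_disc.
Qed.

Lemma integral_cell_config k (f : _ -> R) : (forall x, 0 <= f x) ->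
  (\int[P]_w (f (cell_config X W p q k w))%:E = (fexp (pk k) f)%:E)%E.
Proof.
move=> f0; rewrite (integral_finite_range P (@measurable_cell_config k) f0).
rewrite /fexp -sumEFin; apply: eq_bigr => x _.
by rewrite prob_cell_config -EFinM mulrC.
Qed.

Let mean k := grid_mean P W (area p q) k.

(** Exceeds the total weight of the box because [a * s <= expR (a * s)], and is integrable by
    [mgf_cell_weight]. *)
Let bound (w : Omega) : R := a^-1 * expR (a * fine (cell_weight X W (box p q) w)).

Let measurable_exp_box :
  measurable_fun setT (fun w => expR (a * fine (cell_weight X W (box p q) w))).
Proof.
apply: measurableT_comp => //; apply: measurable_funM; first exact: measurable_cst.
apply: measurableT_comp; first exact: fine_measurable.
by apply: measurable_cell_weight => //; exact: measurable_box.
Qed.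

Let measurable_bound : measurable_fun setT bound.
Proof. by apply: measurable_funM => //; exact: measurable_cst. Qed.

Let bound_ge0 w : 0 <= bound w.
Proof. by rewrite mulr_ge0 ?expR_ge0// invr_ge0 ltW. Qed.

Let integrable_bound : P.-integrable setT (EFin \o bound).
Proof.
apply/integrableP; split; first exact/measurable_EFinP.
under eq_integral => w _ do rewrite /= ger0_norm//.
rewrite /bound; under eq_integral => w _ do rewrite EFinM.
rewrite ge0_integralZl//; last 2 first.
- exact/measurable_EFinP.
- by rewrite lee_fin invr_ge0 ltW.
by rewrite (mgf_cell_weight mX mW W_ge0 poisX indW lawW indXW (measurable_box p q)
  (ltW a_gt0) _ _ phiE) ?lebesgue_measure2_box ?ltry ?area_gt0//.
Qed.

Let measurable_grid_passage k : measurable_fun setT (grid_passage X W p q k).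
Proof.
apply: (@measurable_finite_range _ _ _ _ (cell_config X W p q k)) => x.
exact: measurable_cell_config.
Qed.

Lemma measurable_rect_passage : measurable_fun setT (rect_passage X W p q).
Proof. by apply: measurable_last_passage => //; apply/andP; split; exact: ltW. Qed.

Let grid_passage_cvg w : good X p q w ->
  grid_passage X W p q k w @[k --> \oo] --> fine (rect_passage X W p q w).
Proof.
move=> gw; have [N hN] := grid_passage_approx W_ge0 pq1 pq2 gw.
apply: (@squeeze_cvgr _ _ _ _ (fun k => fine (rect_passage X W p q w) - (2 ^+ k)^-1)
  (fun=> fine (rect_passage X W p q w))).
- by exists N => // k /= /hN.
- rewrite -[X in _ --> X]subr0; apply: cvgB; first exact: cvg_cst.
  apply: (@cvg_trans _ ((2^-1 : R) ^+ k @[k --> \oo])).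
    by apply: near_eq_cvg; apply: nearW => k; rewrite exprVn.
  by apply: cvg_expr; rewrite ger0_norm ?invf_lt1 ?ltr1n.
- exact: cvg_cst.
Qed.

Lemma passage_mean :
  P.-integrable setT (rect_passage X W p q) /\
  mean k @[k --> \oo] --> fine (\int[P]_w rect_passage X W p q w)%E.
Proof.
have ae := ae_good mX poisX pq1 pq2.
have [] := @dominated_convergence _ _ _ P setT measurableT
  (fun k => EFin \o grid_passage X W p q k) (rect_passage X W p q) (EFin \o bound).
- by move=> k; apply/measurable_EFinP.
- exact: measurable_rect_passage.
- apply: filterS ae => w gw _; rewrite (rect_passage_fin W_ge0 pq1 pq2 gw).
  by apply: cvg_EFin; [exact: nearW|exact: grid_passage_cvg].
- exact: integrable_bound.
- apply: filterS ae => w gw k _ /=; rewrite lee_fin ger0_norm ?grid_passage_ge0//.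
  apply: (le_trans (grid_passage_le_total W_ge0 pq1 pq2 k gw)).
  rewrite /bound mulrC ler_pdivlMr// mulrC; apply: le_trans (expR_ge1Dx _).
  by rewrite lerDr.
move=> irp _ cv; split => //.
have fin : (\int[P]_w rect_passage X W p q w)%E \is a fin_num by exact: integrable_fin_num.
have cv' : (EFin \o mean) @ \oo --> (fine (\int[P]_w rect_passage X W p q w))%:E.
  rewrite fineK//; apply: cvg_trans cv; apply: near_eq_cvg; apply: nearW => k /=.
  by rewrite -integral_cell_config// => x; exact: grid_lp_ge0.
by move/fine_cvgP: cv' => [].
Qed.

(** Fatou's lemma carries the bound of [grid_mgf_uniform] to the limit. The rectangle need not be a
    square: strips are cut in terms of cell indices, so only the area of the cells enters. *)
Lemma passage_mgf (r lam : R) : 1 <= phi -> expR 1 <= r -> area p q <= r ^+ 2 ->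
  `|lam| <= a / 4 / (Num.sqrt r * ln r) ->
  (\int[P]_w (expR (lam * (fine (rect_passage X W p q w) -
                           fine (\int[P]_w rect_passage X W p q w))))%:E <=
   (expR (12 + 24 * expR (16 * (phi - 1))))%:E)%E.
Proof.
move=> phi1 er Ar hlam; set C := expR (12 + _).
set m := fine (\int[P]_w rect_passage X W p q w)%E.
have r0 : 0 < r by apply: lt_le_trans er; exact: expR_gt0.
have [N hN] := pow2_large r (@ltr01 R).
(* The shift by [N] ensures [r <= 2 ^ (k + N)], which [grid_mgf_uniform] requires. *)
pose f k w : \bar R := (expR (lam * (grid_passage X W p q (k + N) w - mean (k + N))))%:E.
have mf k : measurable_fun setT (f k).
  apply/measurable_EFinP; apply: measurableT_comp => //; apply: measurable_funM.
    exact: measurable_cst.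
  by apply: measurable_funB => //; exact: measurable_cst.
have f0 k w : (0 <= f k w)%E by rewrite lee_fin expR_ge0.
have fC k : (\int[P]_w f k w <= C%:E)%E.
  rewrite /f (integral_cell_config (f := fun x => expR (lam *
    (grid_value (@disc_val R (k + N)) x - mean (k + N))))); last by move=> x; exact: expR_ge0.
  rewrite lee_fin; apply: (@grid_mgf_uniform R _ (2 ^ (k + N)) (pk (k + N)) (@disc_val R (k + N))
     ord0 a (phi - 1) r lam) => //.
  - exact: disc_val_ge0.
  - exact: disc_val0.
  - by rewrite subr_ge0.
  - by have := hN _ (leq_addl k N); rewrite ler_pdivrMr// mul1r.
  - apply: (le_trans (pk_mgf _)); rewrite ler_expR mulrC ler_wpM2l ?subr_ge0//.
    by rewrite expr_div_n ler_pM2r// invr_gt0 exprn_gt0.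
have ae := ae_good mX poisX pq1 pq2.
have cvf w : good X p q w -> f k w @[k --> \oo] -->
    (expR (lam * (fine (rect_passage X W p q w) - m)))%:E.
  move=> gw; apply: cvg_EFin; first exact: nearW.
  apply: continuous_cvg; first exact: continuous_expR.
  apply: cvgMr; apply: cvgB.
    by apply: (@cvg_comp _ _ _ (addn^~ N)) (grid_passage_cvg gw); exact: cvg_addnr.
  by apply: (@cvg_comp _ _ _ (addn^~ N)) (passage_mean.2); exact: cvg_addnr.
have E w : good X p q w -> limn_einf (f^~ w) =
    (expR (lam * (fine (rect_passage X W p q w) - m)))%:E.
  by move=> /cvf/cvg_limn_einf_sup[].
apply: (@le_trans _ _ (\int[P]_w limn_einf (f^~ w))%E).
  rewrite le_eqVlt; apply/orP; left; apply/eqP; apply: ge0_ae_eq_integral => //.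
  - apply/measurable_EFinP; apply: measurableT_comp => //; apply: measurable_funM.
      exact: measurable_cst.
    apply: measurable_funB; last exact: measurable_cst.
    by apply: measurableT_comp; [exact: fine_measurable|exact: measurable_rect_passage].
  - rewrite /limn_einf; apply: measurableT_comp => //.
    by apply: measurable_fun_limn_esup => k; exact: measurableT_comp.
  - move=> w _; rewrite limn_einf_lim; apply: lime_ge; first exact: is_cvg_einfs.
    by apply: nearW => k; apply: le_ereal_inf_tmp => _ [j _ <-].
  - by apply: filterS ae => w gw _; rewrite E.
apply: (le_trans (fatou P measurableT mf _)) => //.
rewrite limn_einf_lim; apply: lime_le; first exact: is_cvg_einfs.
apply: nearW => k; apply: le_trans (fC k).
by apply: ereal_inf_lbound; exists k => /=.
Qed.

End passage_law.

(** * Mean passage times *)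

Section mean_passage.
Context {d : measure_display} {Omega : measurableType d} {R : realType}.
Variable P : probability Omega R.
Variables (X : nat -> Omega -> R * R) (W : nat -> Omega -> R).
Hypothesis mX : forall i, measurable_fun setT (X i).
Hypothesis mW : forall i, measurable_fun setT (W i).
Hypothesis W_ge0 : forall i w, 0 <= W i w.
Hypothesis poisX : unit_poisson_process P X.
Hypothesis indW : mutually_independent P W.
Hypothesis lawW : forall i A, measurable A -> P (W i @^-1` A) = P (W 0%N @^-1` A).
Hypothesis indXW : independent_families P X W.
Variables (a phi : R).
Hypothesis a_gt0 : 0 < a.
Hypothesis phiE : (\int[P]_w (expR (a * W 0%N w))%:E = phi%:E)%E.

Local Notation L := (rect_passage X W).

Definition mean_rect (p q : R * R) : R := fine (\int[P]_w L p q w)%E.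

Let lt2 (p q : R * R) : Prop := p.1 < q.1 /\ p.2 < q.2.

Let lt2_le p q : lt2 p q -> le2 p q.
Proof. by move=> [h1 h2]; apply/andP; split; apply: ltW. Qed.

Let L_ge0 p q w : le2 p q -> (0 <= L p q w)%E.
Proof. exact: last_passage_ge0. Qed.

Let mL p q : lt2 p q -> measurable_fun setT (L p q).
Proof. by case => h1 h2; exact: measurable_rect_passage. Qed.

Lemma integrable_rect p q : lt2 p q -> P.-integrable setT (L p q).
Proof.
case => h1 h2.
exact: (passage_mean mX mW W_ge0 poisX indW lawW indXW a_gt0 phiE h1 h2).1.
Qed.

Lemma mean_rectE p q : lt2 p q -> (\int[P]_w L p q w = (mean_rect p q)%:E)%E.
Proof. by move=> pq; rewrite fineK//; apply: integrable_fin_num => //; exact: integrable_rect. Qed.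

(* Area-preserving linear maps leave the Poisson process invariant; here the invariance is
   read off the discretization, whose law only involves the area. *)
Lemma mean_rect_area p q p' q' : lt2 p q -> lt2 p' q' -> area p q = area p' q' ->
  mean_rect p q = mean_rect p' q'.
Proof.
case => h1 h2 [h1' h2'] ee.
have c := (passage_mean mX mW W_ge0 poisX indW lawW indXW a_gt0 phiE h1 h2).2.
have c' := (passage_mean mX mW W_ge0 poisX indW lawW indXW a_gt0 phiE h1' h2').2.
by rewrite ee in c; exact: cvg_unique c c'.
Qed.

Lemma le_mean_rect p q p' q' : lt2 p q -> le2 p' p -> le2 q q' ->
  mean_rect p q <= mean_rect p' q'.
Proof.
move=> pq pp qq; have pq' : lt2 p' q'.
  case: pq => h1 h2; case/andP: pp => h3 h4; case/andP: qq => h5 h6.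
  by split; [apply: le_lt_trans h3 (lt_le_trans h1 h5)|apply: le_lt_trans h4 (lt_le_trans h2 h6)].
rewrite -lee_fin -!mean_rectE//; apply: ge0_le_integral => //; try exact: mL.
  by move=> w _; apply/L_ge0/lt2_le.
by move=> w _; apply: le_last_passage => //; exact: lt2_le.
Qed.

Lemma mean_rect_ge0 p q : lt2 p q -> 0 <= mean_rect p q.
Proof.
by move=> pq; apply: fine_ge0; apply: integral_ge0 => w _; apply/L_ge0/lt2_le.
Qed.

Lemma mean_rect_superadd p m q : lt2 p m -> lt2 m q ->
  mean_rect p m + mean_rect m q <= mean_rect p q.
Proof.
move=> pm mq; have [h1 h2] := pm; have [h3 h4] := mq.
have pq : lt2 p q by split; [exact: lt_trans h1 h3|exact: lt_trans h2 h4].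
rewrite -lee_fin EFinD -!mean_rectE//.
rewrite -ge0_integralD//; try by [exact: mL | move=> w _; apply/L_ge0/lt2_le].
apply: ae_ge0_le_integral => //.
- by move=> w _; apply: adde_ge0; apply/L_ge0/lt2_le.
- by apply: emeasurable_funD; exact: mL.
- by move=> w _; apply/L_ge0/lt2_le.
- exact: mL.
- have [g1 g2] := pq.
  apply: filterS (ae_good mX poisX g1 g2) => w gw _.
  rewrite (rect_passage_fin W_ge0 g1 g2 gw).
  apply: last_passage_superadd => //; try exact: lt2_le.
  exact: (rect_passage_fin W_ge0 g1 g2 gw).
Qed.

Definition mean_square (r : R) : R := mean_rect (0, 0) (r, r).

Lemma mean_squareE p q : lt2 p q -> mean_rect p q = mean_square (Num.sqrt (area p q)).
Proof.
move=> pq; have [h1 h2] := pq; have A0 := area_gt0 h1 h2.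
apply: mean_rect_area => //; first by split; rewrite /= sqrtr_gt0.
by rewrite /area /= !subr0 -expr2 sqr_sqrtr// ltW.
Qed.

Lemma le_mean_square r s : 0 < r -> r <= s -> mean_square r <= mean_square s.
Proof.
move=> r0 rs; apply: le_mean_rect => //; first exact: le2_refl.
by apply/andP; split.
Qed.

Lemma mean_square_ge0 r : 0 < r -> 0 <= mean_square r.
Proof. by move=> r0; exact: mean_rect_ge0. Qed.

Lemma mean_square_superadd r s : 0 < r -> 0 < s ->
  mean_square r + mean_square s <= mean_square (r + s).
Proof.
move=> r0 s0; have -> : mean_square s = mean_rect (r, r) (r + s, r + s).
  apply: mean_rect_area => //; first by split; rewrite /= ltrDl.
  by rewrite /area /=; ring.
by apply: mean_rect_superadd; split => //=; rewrite ltrDl.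
Qed.

Lemma rect_mgf (r lam : R) p q : 1 <= phi -> lt2 p q -> expR 1 <= r -> area p q <= r ^+ 2 ->
  `|lam| <= a / 4 / (Num.sqrt r * ln r) ->
  (\int[P]_w (expR (lam * (fine (L p q w) - mean_rect p q)))%:E <=
   (expR (12 + 24 * expR (16 * (phi - 1))))%:E)%E.
Proof. by move=> phi1 [h1 h2]; exact: passage_mgf. Qed.

End mean_passage.

(** * The doubling inequality for the mean *)

Section doubling.
Context {d : measure_display} {Omega : measurableType d} {R : realType}.
Variable P : probability Omega R.
Variables (X : nat -> Omega -> R * R) (W : nat -> Omega -> R).
Hypothesis mX : forall i, measurable_fun setT (X i).
Hypothesis mW : forall i, measurable_fun setT (W i).
Hypothesis W_ge0 : forall i w, 0 <= W i w.
Hypothesis poisX : unit_poisson_process P X.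
Hypothesis indW : mutually_independent P W.
Hypothesis lawW : forall i A, measurable A -> P (W i @^-1` A) = P (W 0%N @^-1` A).
Hypothesis indXW : independent_families P X W.
Variables (a phi : R).
Hypothesis a_gt0 : 0 < a.
Hypothesis phi_ge1 : 1 <= phi.
Hypothesis phiE : (\int[P]_w (expR (a * W 0%N w))%:E = phi%:E)%E.

Local Notation L := (rect_passage X W).
Local Notation mean_rect := (mean_rect P X W).
Local Notation e := (mean_square P X W).

Let lt2 (p q : R * R) : Prop := p.1 < q.1 /\ p.2 < q.2.
Let C : R := expR (12 + 24 * expR (16 * (phi - 1))).

Let measurable_exp_rect p q (lam m : R) : lt2 p q ->
  measurable_fun setT (fun w => expR (lam * (fine (L p q w) - m))).
Proof.
move=> [h1 h2]; apply: measurableT_comp => //; apply: measurable_funM.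
  exact: measurable_cst.
apply: measurable_funB; last exact: measurable_cst.
by apply: measurableT_comp; [exact: fine_measurable|exact: measurable_rect_passage].
Qed.

(* A chain in [[0, 2 r - 2]^2] crosses the antidiagonal, hence is split by one of [O(r)]
   pairs of rectangles, from the origin to [q1 k] and from [p2 k] to the far corner, each
   of area at most [r^2] by AM-GM, so of mean at most [e r]. The exponential moments bound
   the maximum over [k] of the centred passage times. *)
Lemma mean_square_doubling : exists2 C2 : R, 0 <= C2 &
  forall r, expR 1 <= r -> e (2 * r - 2) <= 2 * e r + C2 * (Num.sqrt r * ln r ^+ 2).
Proof.
have C12 : expR 12 <= C by rewrite /C ler_expR lerDl mulr_ge0// expR_ge0.
have C0 : 0 < C by exact: expR_gt0.
have e12 : 1 <= expR 12 :> R by rewrite -expR0 ler_expR.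
have l4C : 0 <= ln (4 * C) by rewrite ln_ge0//; lra.
(* The error is [lam^-1 * b]: the factor [8 / a] comes from [lam^-1], the other one bounds
   [b / ln r]. *)
exists (8 / a * (ln (4 * C) + 1)).
  by rewrite mulr_ge0 ?divr_ge0 ?(ltW a_gt0)// addr_ge0.
move=> r er; set Rr := 2 * r - 2.
have e2 : 2 <= expR 1 :> R by have := @expR_ge1Dx R 1; lra.
have r2 : 2 <= r by exact: le_trans er.
have r0 : 0 < r by lra.
have Rr0 : 0 < Rr by rewrite /Rr; lra.
have L1 : 1 <= ln r by rewrite -ler_expR lnK.
have s1 : 1 <= Num.sqrt r by rewrite -[leLHS]sqrtr1 ler_wsqrtr//; lra.
have sL : 0 < Num.sqrt r * ln r by rewrite mulr_gt0//; lra.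
pose K := (Num.truncn Rr).+1.
have KR : K%:R <= 2 * r.
  have /andP[t1 _] := truncn_itv (ltW Rr0).
  by rewrite /K -natr1; move: t1; rewrite /Rr; lra.
have K0 : 1 <= K%:R :> R by rewrite ler1n.
(* Half of what [rect_mgf] admits: the product of two exponentials is bounded by the sum of their
   squares, which have parameter [2 * lam]. *)
pose lam := a / 8 / (Num.sqrt r * ln r).
have lam0 : 0 < lam by rewrite !divr_gt0.
pose q1 (k : 'I_K) : R * R := (k%:R + 1, Rr - k%:R + 1).
pose p2 (k : 'I_K) : R * R := (k%:R - 1, Rr - k%:R - 1).
have kR (k : 'I_K) : (k%:R : R) <= Rr.
  have /andP[t1 _] := truncn_itv (ltW Rr0).
  by apply: le_trans t1; rewrite ler_nat -ltnS.
have l1 k : lt2 (0, 0) (q1 k).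
  by have := kR k; have : 0 <= k%:R :> R by []; move=> *; split => /=; lra.
have l2 k : lt2 (p2 k) (Rr, Rr).
  by have := kR k; have : 0 <= k%:R :> R by []; move=> *; split => /=; lra.
have a1 k : area (0, 0) (q1 k) <= r ^+ 2.
  rewrite /area /= !subr0 -subr_ge0.
  (* The sides add up to [Rr + 2 = 2 * r]; hence the choice of [Rr]. *)
  have -> : r ^+ 2 - (k%:R + 1) * (Rr - k%:R + 1) = (r - k%:R - 1) ^+ 2 by rewrite /Rr; ring.
  exact: sqr_ge0.
have a2 k : area (p2 k) (Rr, Rr) <= r ^+ 2.
  by apply: le_trans (a1 k); rewrite le_eqVlt; apply/orP; left; apply/eqP; rewrite /area /=; ring.
have mle p q : lt2 p q -> area p q <= r ^+ 2 -> mean_rect p q <= e r.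
  move=> pq Ar; have [h1 h2] := pq.
  rewrite (mean_squareE mX mW W_ge0 poisX indW lawW indXW a_gt0 phiE pq).
  apply: (le_mean_square mX mW W_ge0 poisX indW lawW indXW a_gt0 phiE).
    by rewrite sqrtr_gt0 area_gt0.
  by rewrite -(ger0_norm (ltW r0)) -sqrtr_sqr ler_wsqrtr.
(* The value [expR b] bounds the mean of the sum of all [2 K] exponentials, so after scaling by
   [expR (- b)] that sum has mean at most 1. *)
pose b := ln (2 * K%:R * C).
have KC0 : 0 < 2 * K%:R * C by rewrite !mulr_gt0//; lra.
have eb : expR b = 2 * K%:R * C by rewrite /b lnK.
have b1 : 0 <= b - 1.
  rewrite subr_ge0 -ler_expR eb; apply: le_trans (_ : expR 12 <= _); first by rewrite ler_expR ler1n.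
  apply: (le_trans C12); rewrite ler_peMl ?ltW//; lra.
have bL : b <= (ln (4 * C) + 1) * ln r.
  apply: (@le_trans _ _ (ln (4 * C) + ln r)).
    rewrite -lnM ?posrE//; last by rewrite mulr_gt0.
    rewrite ler_ln ?posrE//; last by rewrite !mulr_gt0.
    by rewrite [leRHS]mulrAC ler_pM2r//; lra.
  by rewrite [leRHS]mulrDl mul1r lerD2r ler_peMr.
pose E1 k w := expR (2 * lam * (fine (L (0, 0) (q1 k) w) - mean_rect (0, 0) (q1 k))).
pose E2 k w := expR (2 * lam * (fine (L (p2 k) (Rr, Rr) w) - mean_rect (p2 k) (Rr, Rr))).
have mE1 k : measurable_fun setT (E1 k) by exact: measurable_exp_rect.
have mE2 k : measurable_fun setT (E2 k) by exact: measurable_exp_rect.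
have hlam : `|2 * lam| <= a / 4 / (Num.sqrt r * ln r).
  rewrite ger0_norm; last by rewrite mulr_ge0// ltW.
  rewrite /lam le_eqVlt; apply/orP; left; apply/eqP; field.
  by rewrite !gt_eqF//; lra.
have iE1 k : (\int[P]_w (E1 k w)%:E <= C%:E)%E.
  exact: (rect_mgf mX mW W_ge0 poisX indW lawW indXW a_gt0 phiE phi_ge1 (l1 k) er (a1 k) hlam).
have iE2 k : (\int[P]_w (E2 k w)%:E <= C%:E)%E.
  exact: (rect_mgf mX mW W_ge0 poisX indW lawW indXW a_gt0 phiE phi_ge1 (l2 k) er (a2 k) hlam).
pose c0 := 2 * e r + lam^-1 * (b - 1).
pose c1 := lam^-1 * expR (- b).
have c00 : 0 <= c0.
  rewrite addr_ge0// mulr_ge0 ?invr_ge0 ?(ltW lam0)//.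
  exact: (mean_square_ge0 P X W r0).
have c10 : 0 <= c1 by rewrite mulr_ge0 ?expR_ge0// invr_ge0 ltW.
pose Y w := c0 + c1 * \sum_(k < K) (E1 k w + E2 k w).
have key k w : good X (0, 0) (q1 k) w -> good X (p2 k) (Rr, Rr) w ->
    (L (0, 0)%R (q1 k) w + L (p2 k) (Rr, Rr) w <= (Y w)%:E)%E.
  move=> g1 g2; have [h1 h1'] := l1 k; have [h2 h2'] := l2 k.
  rewrite (rect_passage_fin W_ge0 h1 h1' g1) (rect_passage_fin W_ge0 h2 h2' g2).
  rewrite -EFinD lee_fin.
  set F1 := fine (L _ (q1 k) w); set F2 := fine (L (p2 k) _ w).
  have m1 := mle _ _ (l1 k) (a1 k); have m2 := mle _ _ (l2 k) (a2 k).
  set x := lam * (F1 - mean_rect (0, 0) (q1 k)).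
  set y := lam * (F2 - mean_rect (p2 k) (Rr, Rr)).
  (* The inequality [1 + z <= expR z] at [z = x + y - b] replaces Jensen's inequality for the
     logarithm. Adding the terms of all other [j] makes the bound independent of [k]. *)
  have h : x + y <= (b - 1) + expR (- b) * \sum_(j < K) (E1 j w + E2 j w).
    apply: (@le_trans _ _ ((b - 1) + expR (x + y - b))).
      by have := expR_ge1Dx (x + y - b); lra.
    rewrite lerD2l addrC expRD ler_wpM2l ?expR_ge0// expRD.
    apply: (@le_trans _ _ (expR x ^+ 2 + expR y ^+ 2)).
      by have := sqr_ge0 (expR x - expR y); have := sqr_ge0 (expR x + expR y); lra.
    rewrite (bigD1 k)//=; apply: (@le_trans _ _ (E1 k w + E2 k w)).
      rewrite -!expRM_natl /E1 /E2 -/F1 -/F2 /x /y !mulrA.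
      by [].
    rewrite lerDl; apply: sumr_ge0 => j _; rewrite addr_ge0// ?expR_ge0//.
  have -> : F1 + F2 = mean_rect (0, 0) (q1 k) + mean_rect (p2 k) (Rr, Rr) + lam^-1 * (x + y).
    by rewrite /x /y; field; rewrite gt_eqF.
  set Sg := \sum_(j < K) _ in h.
  have -> : Y w = e r + e r + lam^-1 * (b - 1 + expR (- b) * Sg).
    by rewrite /Y /c0 /c1 -/Sg; ring.
  by apply: lerD; [exact: lerD|rewrite ler_pM2l ?invr_gt0].
have lR : lt2 (0, 0) (Rr, Rr) by split.
have mY : measurable_fun setT Y.
  apply: measurable_funD; first exact: measurable_cst.
  apply: measurable_funM; first exact: measurable_cst.
  by apply: measurable_sum => k; exact: measurable_funD.
have LY : {ae P, forall w, (L (0, 0)%R (Rr, Rr) w <= (Y w)%:E)%E}.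
  have g1 : {ae P, forall w, forall k, good X (0, 0) (q1 k) w}.
    by apply: filter_forall => k; have [h1 h2] := l1 k; exact: ae_good.
  have g2 : {ae P, forall w, forall k, good X (p2 k) (Rr, Rr) w}.
    by apply: filter_forall => k; have [h1 h2] := l2 k; exact: ae_good.
  apply: filterS2 g1 g2 => w g1 g2.
  apply: last_passage_split => //; first exact: ltW.
  move=> k kr; have kK : (k < K)%N by rewrite /K ltnS truncn_ge_nat// ltW.
  exact: (key (Ordinal kK)).
have : (\int[P]_w L (0, 0)%R (Rr, Rr) w <= \int[P]_w (Y w)%:E)%E.
  have [h1 h2] := lR.
  apply: ae_ge0_le_integral => //.
  - by move=> w _; apply: last_passage_ge0; apply/andP; split; exact: ltW.
  - exact: measurable_rect_passage.
  - move=> w _; rewrite lee_fin addr_ge0// mulr_ge0//; apply: sumr_ge0 => k _.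
    by rewrite addr_ge0// expR_ge0.
  - exact/measurable_EFinP.
  - by apply: filterS LY => w h _.
rewrite (mean_rectE mX mW W_ge0 poisX indW lawW indXW a_gt0 phiE lR) -/(e Rr).
have iY : (\int[P]_w (Y w)%:E <= (c0 + c1 * (2 * K%:R * C))%:E)%E.
  have mS : measurable_fun setT
      (fun w => \sum_(k < K) ((E1 k w)%:E + (E2 k w)%:E) : \bar R)%E.
    apply: emeasurable_sum => k; apply: emeasurable_funD; exact/measurable_EFinP.
  have S0 w : (0 <= \sum_(k < K) ((E1 k w)%:E + (E2 k w)%:E))%E.
    by apply: sume_ge0 => k _; rewrite adde_ge0// lee_fin expR_ge0.
  rewrite (_ : (fun w => (Y w)%:E) = fun w =>
      (c0%:E + c1%:E * \sum_(k < K) ((E1 k w)%:E + (E2 k w)%:E))%E); last first.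
    by apply/funext => w; rewrite /Y EFinD EFinM -sumEFin.
  rewrite ge0_integralD//; last 2 first.
  - by move=> w _; rewrite mule_ge0.
  - by apply: emeasurable_funM => //; exact: measurable_cst.
  rewrite integral_prob_cst ge0_integralZl// [leRHS]EFinD.
  apply: leeD => //.
  rewrite [leRHS]EFinM.
  apply: lee_wpmul2l => //.
  rewrite ge0_integral_sum//; last 2 first.
  - by move=> k; apply: emeasurable_funD; exact/measurable_EFinP.
  - by move=> k w _; rewrite adde_ge0// lee_fin expR_ge0.
  apply: (@le_trans _ _ (\sum_(k < K) (C%:E + C%:E))%E).
    apply: lee_sum => k _; rewrite ge0_integralD//; try exact/measurable_EFinP.
    - exact: leeD.
    - by move=> w _; rewrite lee_fin expR_ge0.
    - by move=> w _; rewrite lee_fin expR_ge0.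
  rewrite -EFinD sumEFin lee_fin sumr_const card_ord.
  rewrite le_eqVlt; apply/orP; left; apply/eqP; rewrite -mulr_natl; ring.
move=> /le_trans/(_ iY); rewrite lee_fin => /le_trans; apply.
have -> : c1 * (2 * K%:R * C) = lam^-1.
  by rewrite /c1 -eb -mulrA -expRD addNr expR0 mulr1.
rewrite /c0 -addrA lerD2l -[X in _ + X]mulr1 -mulrDr subrK.
have -> : lam^-1 = 8 / a * (Num.sqrt r * ln r).
  by rewrite /lam; field; rewrite !gt_eqF//; lra.
rewrite -[leLHS]mulrA -[leRHS]mulrA ler_pM2l ?divr_gt0//.
have -> : (ln (4 * C) + 1) * (Num.sqrt r * ln r ^+ 2) =
    Num.sqrt r * ln r * ((ln (4 * C) + 1) * ln r) by ring.
by rewrite ler_pM2l.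
Qed.

End doubling.

(** * Nonrandom fluctuations *)

Section time_constant_bounds.
Context {R : realType}.
Variables (e : R -> R) (C2 : R).
Hypothesis e_ge0 : forall r, 0 < r -> 0 <= e r.
Hypothesis le_e : forall r s, 0 < r -> r <= s -> e r <= e s.
Hypothesis e_superadd : forall r s, 0 < r -> 0 < s -> e r + e s <= e (r + s).
Hypothesis C2_ge0 : 0 <= C2.
Let g (r : R) : R := Num.sqrt r * ln r ^+ 2.
Hypothesis doubling : forall r, expR 1 <= r -> e (2 * r - 2) <= 2 * e r + C2 * g r.

Let g_ge0 r : 0 <= g r.
Proof. by rewrite mulr_ge0 ?sqrtr_ge0 ?sqr_ge0. Qed.

(** For [ln r >= 20] the growth factor is at most [10 / 7 * (21 / 20) ^+ 2 = 1.575], whence the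
    threshold [expR 20]. The value [8 / 5] is small enough for [F_double], where
    [1 + 3 * (8 / 5) <= 6] is used. *)
Let g_double r : expR 20 <= r -> g (2 * r - 2) <= 8 / 5 * g r.
Proof.
move=> er; have e21 : 21 <= expR 20 :> R by have := @expR_ge1Dx R 20; lra.
have r0 : 0 < r by lra.
have l20 : 20 <= ln r by rewrite -ler_expR lnK.
have r2 : 0 < 2 * r - 2 by lra.
have ln2 : ln 2 <= 1 :> R by rewrite -ler_expR lnK ?posrE//; have := @expR_ge1Dx R 1; lra.
have lnle : ln (2 * r - 2) <= 21 / 20 * ln r.
  apply: (@le_trans _ _ (ln (2 * r))); first by rewrite ler_ln ?posrE; lra.
  by rewrite lnM ?posrE//; lra.
have ln0 : 0 <= ln (2 * r - 2) by apply: ln_ge0; lra.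
have s2 : Num.sqrt (2 : R) <= 10 / 7.
  have h : 0 <= 10 / 7 :> R by lra.
  by rewrite -(ger0_norm h) -sqrtr_sqr ler_wsqrtr//; lra.
have sle : Num.sqrt (2 * r - 2) <= 10 / 7 * Num.sqrt r.
  apply: (@le_trans _ _ (Num.sqrt (2 * r))); first by rewrite ler_wsqrtr//; lra.
  by rewrite sqrtrM// ler_wpM2r// sqrtr_ge0.
apply: (@le_trans _ _ (10 / 7 * Num.sqrt r * (21 / 20 * ln r) ^+ 2)).
  by rewrite ler_pM ?sqrtr_ge0 ?sqr_ge0// lerXn2r// nnegrE; lra.
have g0 : 0 <= g r by rewrite mulr_ge0 ?sqrtr_ge0 ?sqr_ge0.
have -> : 10 / 7 * Num.sqrt r * (21 / 20 * ln r) ^+ 2 =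
    (10 / 7 * (21 / 20) ^+ 2) * g r by rewrite /g; ring.
by apply: ler_wpM2r => //; lra.
Qed.

(* The shift by [2] centres the recursion at the fixed point of [r |-> 2 r - 2], and the
   correction [3 C2 g] absorbs the error of [doubling]: [F (2 s) <= 2 F s]. *)
Let F s := e (2 + s) + 3 * C2 * g (2 + s).

Let F_double s : expR 20 <= 2 + s -> F (2 * s) <= 2 * F s.
Proof.
move=> es; have e1 : expR 1 <= 2 + s by apply: le_trans es; rewrite ler_expR ler1n.
have gd := g_double es; have de := doubling e1.
have E : 2 * (2 + s) - 2 = 2 + 2 * s by ring.
rewrite E in gd de; have g0 : 0 <= g (2 + s) by rewrite mulr_ge0 ?sqrtr_ge0 ?sqr_ge0.
have : C2 * g (2 + 2 * s) <= C2 * (8 / 5 * g (2 + s)) by rewrite ler_wpM2l.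
have : 0 <= C2 * g (2 + s) by rewrite mulr_ge0.
by rewrite /F; lra.
Qed.

Let F_iter s k : expR 20 <= 2 + s -> F (2 ^+ k * s) <= 2 ^+ k * F s.
Proof.
move=> es; elim: k => [|k IH]; first by rewrite !expr0 !mul1r.
have s0 : 0 <= s by have := @expR_ge1Dx R 20; lra.
have le1 : s <= 2 ^+ k * s by rewrite ler_peMl// exprn_ege1// ler1n.
rewrite exprS -!mulrA; apply: (le_trans (F_double _)); last by rewrite ler_pM2l.
by apply: (le_trans es); rewrite lerD2l.
Qed.

Let e_mulS (m : nat) r : 0 < r -> m.+1%:R * e r <= e (m.+1%:R * r).
Proof.
move=> r0; elim: m => [|n IH]; first by rewrite !mul1r.
rewrite -[in leLHS]natr1 -[in leRHS]natr1 !mulrDl !mul1r.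
by apply: le_trans (e_superadd _ r0); [rewrite lerD2r|rewrite mulr_gt0].
Qed.

Let le_all_pow2 (x y z : R) : (forall k : nat, x <= y + z / 2 ^+ k) -> x <= y.
Proof.
move=> H; rewrite leNgt; apply/negP => yx; have d0 : 0 < x - y by rewrite subr_gt0.
have [z0|z0] := leP z 0.
  by have := H 0%N; rewrite expr0 divr1; lra.
pose k := Num.truncn (z / (x - y)).
have : z / (x - y) < 2 ^+ k.
  apply: (lt_le_trans (truncnS_gt _)); rewrite -natrX ler_nat; exact: ltn_expl.
rewrite ltr_pdivrMr// mulrC -ltr_pdivrMr ?exprn_gt0// => h.
by have := H k; lra.
Qed.

(** Superadditivity gives [(2 ^+ k * s / n%:R - 1) * e n%:R <= e (2 ^+ k * s)], and iterated
    doubling bounds the right side by [2 ^+ k * F s]. Divide by [2 ^+ k] and let [k] tend to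
    infinity. *)
Lemma mean_over_n (n : nat) s : (0 < n)%N -> expR 20 <= 2 + s ->
  s * (e n%:R / n%:R) <= F s.
Proof.
move=> n0 es; have nR : 0 < n%:R :> R by rewrite ltr0n.
have s0 : 0 < s by have := @expR_ge1Dx R 20; lra.
apply: (@le_all_pow2 _ _ (e n%:R)) => k.
have k0 : 0 < 2 ^+ k :> R by rewrite exprn_gt0.
have ps0 : 0 < 2 ^+ k * s by rewrite mulr_gt0.
have Fk := F_iter k es.
have en0 := e_ge0 nR.
have g0 : 0 <= 3 * C2 * g (2 + 2 ^+ k * s).
  by rewrite mulr_ge0// mulr_ge0.
have eF : e (2 ^+ k * s) <= F (2 ^+ k * s).
  apply: (@le_trans _ _ (e (2 + 2 ^+ k * s))); first by apply: le_e => //; lra.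
  by rewrite /F; lra.
have key : (2 ^+ k * s / n%:R - 1) * e n%:R <= 2 ^+ k * F s.
  apply: le_trans Fk; apply: le_trans eF.
  set x := 2 ^+ k * s / n%:R; have x0 : 0 <= x by rewrite divr_ge0 ?ler0n// ltW.
  have /andP[t1 t2] := truncn_itv x0; move: t1 t2; case: (Num.truncn x) => [|m] t1 t2.
    apply: (@le_trans _ _ 0); last exact: e_ge0.
    by rewrite mulr_le0_ge0//; lra.
  apply: (@le_trans _ _ (m.+1%:R * e n%:R)).
    by rewrite ler_wpM2r//; move: t2; rewrite -[m.+2%:R]natr1; lra.
  apply: (le_trans (e_mulS m nR)); apply: le_e; first by rewrite mulr_gt0.
  by rewrite -ler_pdivlMr.
rewrite -(ler_pM2l k0) mulrDr.
have -> : 2 ^+ k * (e n%:R / 2 ^+ k) = e n%:R by field; rewrite gt_eqF.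
have -> : 2 ^+ k * (s * (e n%:R / n%:R)) = 2 ^+ k * s / n%:R * e n%:R.
  by field; rewrite gt_eqF.
by move: key; rewrite mulrBl mul1r lerBlDr.
Qed.

Lemma time_constant_exists : exists2 gam : R, 0 <= gam &
  [/\ forall n : nat, (0 < n)%N -> e n%:R / n%:R <= gam,
      forall y, (forall n : nat, (0 < n)%N -> e n%:R / n%:R <= y) -> gam <= y &
      exists2 C', 0 < C' & forall r, expR 20 <= r -> `|e r - gam * r| <= C' * g r].
Proof.
pose U : set R := [set e n%:R / n%:R | n in [set n : nat | (0 < n)%N]].
have e20 : 21 <= expR 20 :> R by have := @expR_ge1Dx R 20; lra.
pose s0 : R := expR 20 - 2.
have s00 : 0 < s0 by rewrite /s0; lra.
have Ub y : (forall n : nat, (0 < n)%N -> e n%:R / n%:R <= y) -> ubound U y.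
  by move=> H _ [n n0 <-]; exact: H.
have U0 : U !=set0 by exists (e 1%:R / 1%:R); exists 1%N.
have hU : has_sup U.
  split=> //; exists (F s0 / s0); apply: Ub => n n0.
  by rewrite ler_pdivlMr// mulrC; apply: mean_over_n => //; rewrite /s0; lra.
have gn n : (0 < n)%N -> e n%:R / n%:R <= sup U.
  by move=> n0; apply: ub_le_sup => //; [case: hU|exists n].
have gl y : (forall n : nat, (0 < n)%N -> e n%:R / n%:R <= y) -> sup U <= y.
  by move=> H; apply: ge_sup => //; exact: Ub.
set gam := sup U in gn gl *.
have gam0 : 0 <= gam.
  by apply: le_trans (gn 1%N isT); rewrite divr1 e_ge0.
exists gam => //; split => //.
(* [3 * C2] is the correction in [F], [2 * gam] pays for the shift by 2 since [g r >= 1], and 1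
   makes the constant positive. *)
exists (3 * C2 + 2 * gam + 1); first by rewrite ltr_pwDr// addr_ge0// mulr_ge0.
move=> r er; have r0 : 0 < r by lra.
have g1 : 1 <= g r.
  have l20 : 20 <= ln r by rewrite -ler_expR lnK.
  have s1 : 1 <= Num.sqrt r by rewrite -[leLHS]sqrtr1 ler_wsqrtr//; lra.
  by rewrite /g -(mulr1 1) ler_pM// exprn_ege1//; lra.
(* The supremum runs over integers only. For real [r], the mean over [2 ^ k * r] is compared with
   the next integer; the rounding costs at most [gam], which disappears after division by
   [2 ^ k]. *)
have up : e r <= gam * r.
  apply: (@le_all_pow2 _ _ gam) => k.
  have k0 : (0 < 2 ^ k)%N by rewrite expn_gt0.
  have kR : 0 < (2 ^ k)%:R :> R by rewrite ltr0n.
  pose N := (Num.truncn ((2 ^ k)%:R * r)).+1.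
  have N1 : (2 ^ k)%:R * r < N%:R by exact: truncnS_gt.
  have /andP[N2 _] := truncn_itv (ltW (mulr_gt0 kR r0)).
  have h1 : (2 ^ k)%:R * e r <= e N%:R.
    rewrite -(prednK k0); apply: (le_trans (e_mulS _ r0)); rewrite (prednK k0).
    by apply: le_e; [rewrite mulr_gt0|exact: ltW].
  have h2 : e N%:R <= gam * N%:R by rewrite -ler_pdivrMr ?ltr0n//; exact: gn.
  have h3 : gam * N%:R <= gam * ((2 ^ k)%:R * r + 1).
    by rewrite ler_wpM2l// /N -natr1 lerD2r.
  rewrite -(ler_pM2l kR) -natrX; apply: (le_trans h1); apply: (le_trans h2).
  apply: (le_trans h3); rewrite le_eqVlt; apply/orP; left; apply/eqP; field.
  by rewrite gt_eqF.
have lo : gam * (r - 2) <= e r + 3 * C2 * g r.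
  have Fe : F (r - 2) = e r + 3 * C2 * g r by rewrite /F [2 + _]addrC subrK.
  rewrite -Fe -ler_pdivlMr; last by lra.
  apply: gl => n n0; rewrite ler_pdivlMr; last by lra.
  by rewrite mulrC; apply: mean_over_n => //; lra.
have gg : gam <= gam * g r by rewrite ler_peMr.
rewrite ler_norml; apply/andP; split; last by have : 0 <= C2 * g r; [rewrite mulr_ge0//; lra|lra].
by lra.
Qed.

End time_constant_bounds.

(** * Deviations *)

Section weight_law.
Context {d : measure_display} {Omega : measurableType d} {R : realType}.
Variables (P : probability Omega R) (V : {RV P >-> R}).
Variable F : cumulativeBounded (0 : R) (1 : R).
Hypothesis cdfV : forall t, cdf V t = (F t)%:E.

(* The Stieltjes measure lives on [measurableTypeR R], which carries the Borel sets of
   [R] under another display; hence this copy of [V]. *)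
Let mV : measurable_fun setT (V : Omega -> measurableTypeR R).
Proof. by move=> _ B mB; rewrite setTI; exact: (measurable_funPTI V mB). Qed.

Let V' : {mfun Omega >-> measurableTypeR R} :=
  HB.pack (V : Omega -> measurableTypeR R) (isMeasurableFun.Build _ _ _ _ _ mV).

(** A Stieltjes measure is determined by the half-open intervals, where both sides are increments of
    [F]. This also makes the weights identically distributed. *)
Lemma distribution_lebesgue_stieltjes (A : set R) : measurable A ->
  P (V @^-1` A) = lebesgue_stieltjes_measure F A.
Proof.
move=> mA; apply/esym.
suff H : forall I, ocitv I -> lebesgue_stieltjes_measure F I = distribution P V' I.
  exact: (@lebesgue_stieltjes_measure_unique R F (distribution P V') H A mA).
move=> I [[b c] /= _ <-].
rewrite /lebesgue_stieltjes_measure /measure_extension/=.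
rewrite measurable_mu_extE/=; last exact: is_ocitv.
have [bc|cb] := leP b c; last first.
  by rewrite set_itv_ge ?wlength0 ?measure0// bnd_simp -leNgt ltW.
rewrite wlength_itv_bnd// EFinB -!cdfV.
rewrite /cdf.
have -> : `]b, c]%classic = `]-oo, c] `\` `]-oo, b] => [|].
  by rewrite -[RHS]setCK setCD setCitvl setUC -[LHS]setCK setCitv.
rewrite measureD//; first by rewrite setIidr//; exact: subset_itvl.
by rewrite -ge0_fin_numE// fin_num_measure.
Qed.

Lemma integral_weight (a : R) : (forall w, 0 < V w) ->
  (\int[P]_w (expR (a * V w))%:E =
   \int[lebesgue_stieltjes_measure F]_(x in `[0%R, +oo[) (expR (a * x))%:E)%E.
Proof.
move=> V0.
have me : measurable_fun setT (fun x : R => expR (a * x)).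
  exact: (measurableT_comp (@measurable_expR R) (mulrl_measurable a)).
pose D : set (measurableTypeR R) := [set` `[0 : R, +oo[].
have mD : measurable D by exact: (measurable_itv `[0 : R, +oo[).
have /measurable_EFinP me2 := me.
have me' : measurable_fun D (fun x : measurableTypeR R => (expR (a * x))%:E : \bar R).
  by move=> _ B mB; exact: (@measurable_funTS _ _ _ _ D _ me2 mD B mB).
transitivity (\int[distribution P V']_(x in `[0%R, +oo[) (expR (a * x))%:E)%E.
  rewrite ge0_integral_pushforward//.
  rewrite (_ : V' @^-1` _ = setT)//; apply/seteqP; split => // w _ /=.
  by rewrite in_itv /= andbT ltW.
apply: eq_measure_integral => A mA _; exact: distribution_lebesgue_stieltjes.
Qed.

End weight_law.

Section deviation.
Context {d : measure_display} {Omega : measurableType d} {R : realType}.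
Variable P : probability Omega R.

(** The event is controlled by [Z] only almost everywhere because [Z] will be the real part of an
    extended real passage time, known to be finite on good configurations only. *)
Lemma two_sided_chernoff (Z : Omega -> R) (lam C u : R) (E : set Omega) :
  measurable_fun setT Z -> measurable E -> 0 <= lam ->
  {ae P, forall w, E w -> u <= `|Z w|} ->
  (\int[P]_w (expR (lam * Z w))%:E <= C%:E)%E ->
  (\int[P]_w (expR (- lam * Z w))%:E <= C%:E)%E ->
  (P E <= (2 * C * expR (- (lam * u)))%:E)%E.
Proof.
move=> mZ mE lam0 EZ h1 h2.
have me l : measurable_fun setT (fun w => (expR (l * Z w))%:E).
  apply/measurable_EFinP; apply: measurableT_comp => //.
  by apply: measurable_funM => //; exact: measurable_cst.
rewrite -(setIT E) -integral_indic//.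
pose Y w : \bar R := ((expR (- (lam * u)))%:E *
  ((expR (lam * Z w))%:E + (expR (- lam * Z w))%:E))%E.
have mY : measurable_fun setT (fun w =>
    ((expR (lam * Z w))%:E + (expR (- lam * Z w))%:E)%E).
  exact: emeasurable_funD.
apply: (@le_trans _ _ (\int[P]_w Y w)%E).
  apply: ae_ge0_le_integral => //.
  - by apply/measurable_EFinP; exact: measurable_indic.
  - by move=> w _; rewrite /Y mule_ge0 ?adde_ge0// lee_fin expR_ge0.
  - by apply: emeasurable_funM => //; exact: measurable_cst.
  - apply: filterS EZ => w EZ _; rewrite /Y -EFinD -EFinM lee_fin indicE.
    have [wE|_] := boolP (w \in E); last by rewrite mulr_ge0 ?addr_ge0 ?expR_ge0.
    rewrite mulrDr -!expRD.
    have /EZ uZ : E w by exact/set_mem.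
    have [Z0|Z0] := leP 0 (Z w).
      rewrite ger0_norm// in uZ; rewrite -[leLHS]addr0 lerD ?expR_ge0//.
      rewrite -[leLHS]expR0 ler_expR addrC -mulrBr mulr_ge0// subr_ge0//.
    rewrite ltr0_norm// in uZ; rewrite -[leLHS]add0r lerD ?expR_ge0//.
    by rewrite -[leLHS]expR0 ler_expR mulNr -mulrN addrC -mulrBr mulr_ge0// subr_ge0.
rewrite /Y ge0_integralZl//; last first.
  by move=> w _; rewrite adde_ge0// lee_fin expR_ge0.
rewrite ge0_integralD//.
have -> : 2 * C * expR (- (lam * u)) = expR (- (lam * u)) * (C + C) by ring.
rewrite EFinM; apply: lee_wpmul2l => //.
by rewrite EFinD; exact: leeD.
Qed.

End deviation.

Theorem theorem1p2 (R : realType) (F : cumulativeBounded (0 : R) (1 : R))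
    (d : measure_display) (Omega : measurableType d) (P : probability Omega R)
    (X : nat -> {RV P >-> (R * R)%type}) (W : nat -> {RV P >-> R}) :
  hammersley_model F X W ->
  (exists2 a : R, 0 < a &
     (\int[lebesgue_stieltjes_measure F]_(x in `[0%R, +oo[) (expR (a * x))%:E
        < +oo)%E) ->
  exists c0 c1 c2 c3 c4 : R,
    [/\ 0 < c0, 0 < c1, 0 < c2, 0 < c3 & 0 < c4] /\
    forall r : R, c0 <= r ->
    forall u : R,
      c3 * Num.sqrt r * ln r ^+ 2 <= u <= c4 * r `^ (3 / 2) * ln r ->
      (P [set omega | (u%:E <=
            `| LPT X W (0, 0)%R (r, r) omega - time_constant X W * r%:E |)%E]
       <= (c1 * expR (- (c2 * (u / (ln r * Num.sqrt r)))))%:E)%E.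
Proof.
move=> [poisX W_gt0 cdfW indW indXW] [a a_gt0 expfin].
pose X' i : Omega -> R * R := X i; pose W' i : Omega -> R := W i.
have mX i : measurable_fun setT (X' i) by exact: measurable_funPT.
have mW i : measurable_fun setT (W' i) by exact: measurable_funPT.
have W_ge0 i w : 0 <= W' i w by exact/ltW/W_gt0.
have lawW i A : measurable A -> P (W' i @^-1` A) = P (W' 0%N @^-1` A).
  move=> mA; rewrite (distribution_lebesgue_stieltjes (cdfW i) mA).
  by rewrite (distribution_lebesgue_stieltjes (cdfW 0%N) mA).
have iW := integral_weight (cdfW 0%N) a (W_gt0 0%N).
have me0 : measurable_fun setT (fun w => (expR (a * W' 0%N w))%:E).
  apply/measurable_EFinP; apply: measurableT_comp => //.
  by apply: measurable_funM => //; exact: measurable_cst.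
have ge1 : (1 <= \int[P]_w (expR (a * W' 0%N w))%:E)%E.
  rewrite -[leLHS](integral_prob_cst P); apply: ge0_le_integral => //.
  by move=> w _; rewrite lee_fin -expR0 ler_expR mulr_ge0// ltW.
pose phi := fine (\int[P]_w (expR (a * W' 0%N w))%:E)%E.
have phiE : (\int[P]_w (expR (a * W' 0%N w))%:E = phi%:E)%E.
  rewrite fineK// ge0_fin_numE; last exact: le_trans ge1.
  by rewrite [X in (X < _)%E]iW.
have phi1 : 1 <= phi by rewrite -lee_fin -phiE.
pose e := mean_square P X' W'.
have [C2 C20 dbl] := mean_square_doubling mX mW W_ge0 poisX indW lawW indXW a_gt0 phi1 phiE.
have e0 r : 0 < r -> 0 <= e r by exact: mean_square_ge0.
have le_e r s : 0 < r -> r <= s -> e r <= e s.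
  exact: (le_mean_square mX mW W_ge0 poisX indW lawW indXW a_gt0 phiE).
have sup_e r s : 0 < r -> 0 < s -> e r + e s <= e (r + s).
  exact: (mean_square_superadd mX mW W_ge0 poisX indW lawW indXW a_gt0 phiE).
have [gam gam0 [gub glub [C' C'0 gapp]]] := time_constant_exists e0 le_e sup_e C20 dbl.
have meanE r : 0 < r -> (\int[P]_w LPT X W (0, 0)%R (r, r) w = (e r)%:E)%E.
  move=> r0; apply: (mean_rectE mX mW W_ge0 poisX indW lawW indXW a_gt0 phiE).
  by split.
have tcE : time_constant X W = gam%:E.
  apply/eqP; rewrite eq_le; apply/andP; split.
    apply: ge_ereal_sup => _ [n n1 <-]; rewrite meanE ?ltr0n// -EFinM lee_fin.
    exact: gub.
  have ub n : (0 < n)%N -> ((e n%:R / n%:R)%:E <= time_constant X W)%E.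
    move=> n0; apply: ereal_sup_ubound; exists n => //.
    by rewrite meanE ?ltr0n// -EFinM.
  move: (ub); case: (time_constant X W) => [y H|_|/(_ 1%N isT)//]; last by rewrite leey.
  by rewrite lee_fin; apply: glub => n n0; rewrite -lee_fin; exact: H.
pose C : R := expR (12 + 24 * expR (16 * (phi - 1))).
(* [2 * C'] makes the bias [e r - gam * r] at most [u / 2], so half of [u] is left for the deviation
   from the mean; this halves the rate [a / 4] of [rect_mgf]. The factor 2 in [2 * C] counts the two
   tails. *)
exists (expR 20), (2 * C), (a / 8), (2 * C'), 1.
split; first by split; rewrite ?mulr_gt0 ?expR_gt0 ?divr_gt0.
move=> r er u /andP[hu _].
have e21 : 21 <= expR 20 :> R by have := @expR_ge1Dx R 20; lra.
have r0 : 0 < r by lra.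
have l20 : 20 <= ln r by rewrite -ler_expR lnK.
have s1 : 1 <= Num.sqrt r by rewrite -[leLHS]sqrtr1 ler_wsqrtr//; lra.
have sL : 0 < Num.sqrt r * ln r by rewrite mulr_gt0//; lra.
pose lam := a / 4 / (Num.sqrt r * ln r).
have lam0 : 0 <= lam by rewrite ltW// !divr_gt0.
have e1r : expR 1 <= r by apply: le_trans er; rewrite ler_expR ler1n.
pose Lr := rect_passage X' W' (0, 0) (r, r).
have mL : measurable_fun setT Lr by apply: measurable_rect_passage.
pose Z w := fine (Lr w) - e r.
have mZ : measurable_fun setT Z.
  apply: measurable_funB; last exact: measurable_cst.
  by apply: measurableT_comp; first exact: fine_measurable.
have mgf l : `|l| <= lam -> (\int[P]_w (expR (l * Z w))%:E <= C%:E)%E.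
  move=> hl; apply: (rect_mgf mX mW W_ge0 poisX indW lawW indXW a_gt0 phiE phi1 _ e1r _ hl).
    by split.
  by rewrite /area /= !subr0 expr2.
have -> : a / 8 * (u / (ln r * Num.sqrt r)) = lam * (u / 2).
  by rewrite /lam; field; rewrite !gt_eqF//; lra.
apply: (two_sided_chernoff mZ _ lam0).
- have mf : measurable_fun setT (fun w => `|Lr w - time_constant X W * r%:E|)%E.
    apply: measurableT_comp; first exact: abse_measurable.
    by apply: emeasurable_funB => //; exact: measurable_cst.
  have := mf measurableT _ (emeasurable_itv `[u%:E, +oo[); rewrite setTI.
  by congr measurable; apply/seteqP; split => w /=; rewrite in_itv /= andbT.
- have ae := @ae_good _ _ _ P X' mX poisX (0, 0) (r, r) r0 r0.
  apply: filterS ae => w gw /=.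
  have -> : LPT X W (0, 0)%R (r, r) w = (fine (Lr w))%:E.
    exact: (@rect_passage_fin _ _ _ X' W' W_ge0 (0, 0) (r, r) r0 r0 w gw).
  rewrite tcE -EFinM -EFinB lee_fin => hE.
  have hg := gapp r er.
  have : `|fine (Lr w) - gam * r| <= `|Z w| + `|e r - gam * r|.
    by apply: le_trans (ler_normD _ _); rewrite /Z le_eqVlt; apply/orP; left;
      apply/eqP; congr `| _ |; ring.
  by move: hu; rewrite -mulrA => hu; lra.
- by apply: mgf; rewrite ger0_norm.
- by apply: mgf; rewrite normrN ger0_norm.
Qed.
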